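(* Fix $t\ge1$. Set $\beta_0^{(t)}=1$ and for $n\ge1$ let $\beta_n^{(t)}=\mathrm{Pch}\big(\tilde H_{n-2}(B_n^{(t)})\big)$. Then for every $n\ge1$, \[\sum_{i=0}^n(-1)^i\,\beta_i^{(t)}\prod_{j=1}^t h_{n-i}(X^j)=0.\]
   Context: $B_n$ is the Boolean lattice of subsets of $[n]$. For $t\ge2$ the $t$-fold Segre power $B_n^{(t)}$ is the subposet of $B_n\times\cdots\times B_n$ ($t$ factors, componentwise order) of $t$-tuples $(A_1,\ldots,A_t)$ with $|A_1|=\cdots=|A_t|$; $B_n^{(1)}=B_n$. The group $\mathfrak{S}_n^{\times t}=\mathfrak{S}_n\times\cdots\times\mathfrak{S}_n$ acts by $(\sigma_1,\ldots,\sigma_t)\cdot(A_1,\ldots,A_t)=(\sigma_1(A_1),\ldots,\sigma_t(A_t))$, hence on the reduced homology (rational coefficients) of the order complex of the proper part $B_n^{(t)}\setminus\{\hat0,\hat1\}$; $\tilde H_{n-2}(B_n^{(t)})$ denotes the top reduced homology of this complex (for $n=1$ the complex is empty and $\tilde H_{-1}$ is the one-dimensional trivial module). For a character $\chi$ of $\mathfrak{S}_n^{\times t}$, the product Frobenius characteristic is $\mathrm{Pch}(\chi)=\sum_{\boldsymbol\lambda}a_{\boldsymbol\lambda}\prod_{j=1}^t s_{\lambda^j}(X^j)$ if $\chi=\sum a_{\boldsymbol\lambda}\chi^{\lambda^1}\otimes\cdots\otimes\chi^{\lambda^t}$, where $X^1,\ldots,X^t$ are disjoint sets of variables, $s_\lambda$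 is the Schur function and $\chi^\lambda$ the irreducible character of $\mathfrak{S}_n$ indexed by $\lambda\vdash n$. $h_m$ is the complete homogeneous symmetric function ($h_0=1$). *)

(* Defs.v *)
From HB Require Import structures.
From mathcomp Require Import all_boot all_order all_fingroup all_algebra.
From mathcomp.multinomials Require Import mpoly.
From Stdlib Require Import ClassicalEpsilon.

Set Implicit Arguments.
Unset Strict Implicit.
Unset Printing Implicit Defensive.

Import GRing.Theory.
Local Open Scope ring_scope.

(** * The Segre power of the Boolean lattice *)

Definition segre_le (t n : nat) : rel {ffun 'I_t -> {set 'I_n}} :=
  fun A B => [forall j, A j \subset B j].

Definition segre_power (t n : nat) : {set {ffun 'I_t -> {set 'I_n}}} :=
  [set A : {ffun 'I_t -> {set 'I_n}} | [forall i, forall j, #|A i| == #|A j|]].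

Definition segre_proper (t n : nat) : {set {ffun 'I_t -> {set 'I_n}}} :=
  segre_power t n :\ [ffun=> set0] :\ [ffun=> [set: 'I_n]].

Definition segre_act (t n : nat) (s : {ffun 'I_t -> 'S_n})
    (A : {ffun 'I_t -> {set 'I_n}}) : {ffun 'I_t -> {set 'I_n}} :=
  [ffun j => s j @: A j].

(** * Reduced simplicial homology of an order complex, over [rat] *)

(* [V] is the vertex set and [le] a partial order on it.  Simplices are indexed
   by their number [k] of vertices, i.e. by dimension plus one; the empty chain
   ([k = 0]) is the simplex of dimension -1 of the augmented complex. *)
Definition is_simplex (T : finType) (le : rel T) (V : {set T}) (k : nat)
    (C : {set T}) : bool :=
  [&& C \subset V, [forall x in C, forall y in C, le x y || le y x]
    & #|C| == k].

Definition simplex (T : finType) (le : rel T) (V : {set T}) (k : nat) :=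
  {C : {set T} | is_simplex le V k C}.

(* The coefficient of [D] in the boundary of the chain C = x_0 < ... < x_(k-1),
   which is \sum_i (-1)^i (C without x_i): the exponent below is the position of
   [x] in [C]. *)
Definition boundary_coef (T : finType) (le : rel T) (C D : {set T}) : rat :=
  \sum_(x in C | D == C :\ x) (-1) ^+ #|[set y in C | (y != x) && le y x]|.

(* Matrices act on row vectors.  For [k = 0] the matrix is zero, the only
   simplex being the empty chain. *)
Definition boundary (T : finType) (le : rel T) (V : {set T}) (k : nat) :
    'M[rat]_(#|{: simplex le V k}|, #|{: simplex le V k.-1}|) :=
  \matrix_(i < #|{: simplex le V k}|, j < #|{: simplex le V k.-1}|)
    boundary_coef le (val (enum_val i)) (val (enum_val j)).

(* The matrix of C |-> f(C); no sign occurs when f is order-preserving, since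
   simplices are oriented by the order. *)
Definition simplex_act (T : finType) (le : rel T) (V : {set T}) (k : nat)
    (f : T -> T) : 'M[rat]_#|{: simplex le V k}| :=
  \matrix_(i < #|{: simplex le V k}|, j < #|{: simplex le V k}|)
    (f @: val (enum_val i) == val (enum_val j))%:R.

(* Given row spaces B <= Z stable under A, the trace of A on Z / B.
   Right multiplication by [cokermx B] has kernel B, so it identifies Z / B with
   the row space of [Z *m cokermx B]; the conjugate of A by it is the
   endomorphism induced by A. *)
Definition quotient_trace (m : nat) (Z B A : 'M[rat]_m) : rat :=
  \tr (restrictmx (Z *m cokermx B) (pinvmx (cokermx B) *m A *m cokermx B)).

(* The trace of f on the reduced homology in dimension [k - 1]. *)
Definition homology_trace (T : finType) (le : rel T) (V : {set T}) (k : nat)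
    (f : T -> T) : rat :=
  quotient_trace (kermx (boundary le V k)) <<boundary le V k.+1>>%MS
    (simplex_act le V k f).

(* The character of the reduced homology of degree n - 2, for [n >= 1]; the
   simplices of dimension n - 2 have n - 1 vertices. *)
Definition segre_top_homology_char (t n : nat) (s : {ffun 'I_t -> 'S_n}) : rat :=
  homology_trace (@segre_le t n) (segre_proper t n) n.-1 (segre_act s).

(** * Partitions and the irreducible characters of the symmetric group *)

(* A partition of n is padded with zeros to length n. *)
Definition is_partition (n : nat) (la : n.-tuple 'I_n.+1) : bool :=
  sorted geq (map val la) && (sumn (map val la) == n).

Definition intpart (n : nat) := {la : n.-tuple 'I_n.+1 | is_partition la}.

(* Cells are (row, column) pairs of the Young diagram. *)
Definition cell (n : nat) (la : intpart n) :=
  {c : 'I_n * 'I_n | c.2 < tnth (val la) c.1}%N.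

(* The tabloid of a filling [T], given by the set of entries of each row. *)
Definition tabloid (n : nat) (la : intpart n) (T : {ffun cell la -> 'I_n}) :
    {ffun 'I_n -> {set 'I_n}} :=
  [ffun r => [set T c | c : cell la & (val c).1 == r]].

Definition column_stabilizer (n : nat) (la : intpart n)
    (T : {ffun cell la -> 'I_n}) : {set 'S_n} :=
  [set p : 'S_n | [forall c : cell la, forall c' : cell la,
     (p (T c) == T c') ==> ((val c).2 == (val c').2)]].

(* Tabloids of shape [la] are among the basis vectors of a space having one
   basis vector for each [R : {ffun 'I_n -> {set 'I_n}}]. *)
Definition polytabloid (n : nat) (la : intpart n) (T : {ffun cell la -> 'I_n}) :
    'rV[rat]_#|{: {ffun 'I_n -> {set 'I_n}}}| :=
  \sum_(p in column_stabilizer T)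
    (-1) ^+ odd_perm p *: delta_mx 0 (enum_rank (tabloid [ffun c => p (T c)])).

(* As [la] has n cells, injective fillings by 'I_n are bijective. *)
Definition specht (n : nat) (la : intpart n) :
    'M[rat]_#|{: {ffun 'I_n -> {set 'I_n}}}| :=
  (\sum_(T : {ffun cell la -> 'I_n} | injectiveb T) <<polytabloid T>>)%MS.

Definition tabloid_perm (n : nat) (s : 'S_n) (R : {ffun 'I_n -> {set 'I_n}}) :
    {ffun 'I_n -> {set 'I_n}} :=
  [ffun r => s @: R r].

Definition tabloid_act (n : nat) (s : 'S_n) :
    'M[rat]_#|{: {ffun 'I_n -> {set 'I_n}}}| :=
  \matrix_(i < #|{: {ffun 'I_n -> {set 'I_n}}}|,
           j < #|{: {ffun 'I_n -> {set 'I_n}}}|)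
    (tabloid_perm s (enum_val i) == enum_val j)%:R.

Definition specht_char (n : nat) (la : intpart n) (s : 'S_n) : rat :=
  \tr (restrictmx (specht la) (tabloid_act s)).

(** * Symmetric functions in t alphabets *)

(* The ring of symmetric functions in infinitely many variables is the inverse
   limit of the rings of symmetric polynomials in N variables.  A symmetric
   function of t alphabets is thus given by its values with N variables in each
   alphabet, for all N. *)
Definition symfun (t : nat) := forall N : nat, {mpoly rat[t * N]}.

Definition complete_poly (N m : nat) : {mpoly rat[N]} :=
  \sum_(e : 'X_{1..N < m.+1} | mdeg e == m) 'X_[e].

Definition is_semistandard (N n : nat) (la : intpart n)
    (T : {ffun cell la -> 'I_N}) : bool :=
  [forall c : cell la, forall c' : cell la,
     (((val c).1 == (val c').1) && ((val c).2 < (val c').2) ==> (T c <= T c'))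
  && (((val c).2 == (val c').2) && ((val c).1 < (val c').1) ==> (T c < T c'))]%N.

Definition schur_poly (N n : nat) (la : intpart n) : {mpoly rat[N]} :=
  \sum_(T : {ffun cell la -> 'I_N} | is_semistandard T) \prod_c 'X_(T c).

(* p(X^j): variable k of the alphabet X^j is number [mxvec_index j k]. *)
Definition in_alphabet (t N : nat) (j : 'I_t) (p : {mpoly rat[N]}) :
    {mpoly rat[t * N]} :=
  p \mPo [tuple 'X_(mxvec_index j k) | k < N].

Definition hsym (t : nat) (j : 'I_t) (m : nat) : symfun t :=
  fun N => in_alphabet j (complete_poly N m).

Definition schur (t n : nat) (j : 'I_t) (la : intpart n) : symfun t :=
  fun N => in_alphabet j (schur_poly N la).

(** * The product Frobenius characteristic *)

Definition char_decomposition (t n : nat) (chi : {ffun 'I_t -> 'S_n} -> rat)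
    (a : {ffun 'I_t -> intpart n} -> rat) : Prop :=
  forall s, chi s = \sum_la a la * \prod_(j < t) specht_char (la j) (s j).

(* The coefficients a in chi = \sum_la a_la chi^{la_1} (x) ... (x) chi^{la_t};
   they exist for every character and are unique. *)
Definition irr_coef (t n : nat) (chi : {ffun 'I_t -> 'S_n} -> rat) :
    {ffun 'I_t -> intpart n} -> rat :=
  epsilon (inhabits (fun=> 0)) (char_decomposition chi).

Definition Pch (t n : nat) (chi : {ffun 'I_t -> 'S_n} -> rat) : symfun t :=
  fun N => \sum_la irr_coef chi la *: \prod_(j < t) schur j (la j) N.

Definition beta (t n : nat) : symfun t :=
  if n is 0 then fun=> 1 else Pch (@segre_top_homology_char t n).

(* Main.v *)
(** For s in S_n let p_s be the power sum of the cycle type of s; its coefficient of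
    x^m is the character of the permutation module M^m on the colourings of [n] with
    content m.  Burnside's lemma and Cauchy's identity (proved from a local toggle of
    interlacing partitions) give <M^a, M^m> = sum_la K_(la,a) K_(la,m).  By the usual
    argument of James, a Specht module S^la has, up to scalars, one equivariant map into
    M^la, and none into M^a unless la dominates a.  As K is unitriangular for dominance,
    this forces p_s = sum_la chi^la(s) s_la, so that Pch is the averaged product of the
    characters with the p_(s_j)(X^j), and M^m corresponds to the product of the h_(m_i).

    The maximal chains of the proper part of B_n^(t) are the t-tuples w of permutations.
    Top cycles are the functions on them killed by each map forgetting one rank.  The
    vectors b_w = b_(w_1) x ... x b_(w_t), where b_v is the signed sum over the coset of
    the parabolic subgroup generated by the descents of v, form a basis adapted to all
    these maps at once: the map that forgets the ranks in R kills b_w if some w_j has a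
    descent in R, and the remaining b_w have independent images.  Reading the traces off
    the diagonal of the action in this basis, inclusion-exclusion over the descent sets
    expresses the character of the top homology as the alternating sum, over the
    compositions a of n, of the t-fold tensor powers of M^a.  Hence beta_n is the
    alternating sum of the products of the h_(a_i)(X^j), and splitting off one part of
    the composition gives the recursion. *)

Require Import Defs.
From HB Require Import structures.
From mathcomp Require Import all_boot all_order all_fingroup all_algebra.
From mathcomp.multinomials Require Import mpoly.
From mathcomp Require Import zify ring lra.

Set Implicit Arguments.
Unset Strict Implicit.
Unset Printing Implicit Defensive.

Import GRing.Theory.
Local Open Scope ring_scope.

(** * Interlacing shapes and the Cauchy identity *)

(** [Pch] is defined through traces on Specht modules, while the homology comes out as a combination
    of permutation characters; the two can be compared only after Specht characters are tied to
    Schur polynomials. The tool is positivity over the rationals: functions on the group whose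
    difference has norm 0 are equal.

    A rank forgotten in a chain is forgotten in all t coordinates at once. A tensor product of basis
    vectors is killed as soon as one factor is, so the descent set that matters is the union over
    the coordinates, and adapted bases of single permutations multiply to an adapted basis of
    tuples. No simplex lies above the maximal chains, so the top homology is a space of cycles and
    its trace is that of a projection.

    With H_m the product over j of h_m(X^j), the result says that the series of (-1)^i beta_i u^i is
    inverse to that of H_i u^i. A composition of n with l parts has sign (-1)^l in this inverse,
    hence (-1)^(n-l) in beta_n, where n - l is the number of merged neighbours. *)

Lemma big_bij (R : Type) (idx : R) (op : Monoid.com_law idx) (I J : finType)
    (A : pred I) (B : pred J) (f : I -> J) (g : J -> I) (F : I -> R) (G : J -> R) :
  (forall i, A i -> B (f i) /\ g (f i) = i) ->
  (forall j, B j -> A (g j) /\ f (g j) = j) ->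
  (forall i, A i -> F i = G (f i)) ->
  \big[op/idx]_(i | A i) F i = \big[op/idx]_(j | B j) G j.
Proof.
move=> hf hg FG; rewrite [RHS](reindex_onto f g) => [|j /hg[]//].
apply: eq_big => [i|i /FG//].
apply/idP/andP => [Ai|[Bfi /eqP <-]]; last by case: (hg _ Bfi).
by have [-> ->] := hf _ Ai; rewrite eqxx.
Qed.

Lemma card_ord_ltn m k : (k <= m)%N -> #|[set i : 'I_m | i < k]%N| = k.
Proof.
move=> hk; rewrite -sum1dep_card (big_ord_narrow hk) sum1_card; exact: card_ord.
Qed.

Lemma mem_ord_downset m (A : {set 'I_m}) (c : 'I_m) :
  (forall c c' : 'I_m, (c <= c')%N -> c' \in A -> c \in A) -> (c \in A) = (c < #|A|)%N.
Proof.
move=> hA; apply/idP/idP => [cA|].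
  rewrite -[X in (X <= _)%N](@card_ord_ltn m c.+1 (ltn_ord c)); apply: subset_leq_card.
  by apply/subsetP=> c'; rewrite inE ltnS => h; exact: hA cA.
apply: contraTT => cA; rewrite -leqNgt -[X in (_ <= X)%N](@card_ord_ltn m c (ltnW (ltn_ord c))).
apply: subset_leq_card; apply/subsetP=> c' hc'; rewrite inE ltnNge.
by apply: contra cA => h; exact: hA hc'.
Qed.

Section Shapes.
Variable n : nat.
Local Open Scope nat_scope.

(** Arbitrary row functions instead of partitions: [hstrip] forces both its arguments to be weakly
    decreasing. There is one row more than a partition of size n can fill, so its last row is empty
    and shifting rows by one loses nothing. *)
Definition yshape := {ffun 'I_n.+1 -> 'I_n.+1}.
Implicit Types la nu ka rho : yshape.

Definition rowlen la (r : nat) : nat := if insub r is Some i then val (la i) else 0.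
Definition ssize la : nat := \sum_(r < n.+1) la r.
Definition hstrip ka la : bool :=
  [forall r : 'I_n.+1, (rowlen ka r <= rowlen la r) && (rowlen la r.+1 <= rowlen ka r)].

Lemma rowlenE la (r : 'I_n.+1) : rowlen la r = la r.
Proof. by rewrite /rowlen valK. Qed.

Lemma rowlen_oob la r : n < r -> rowlen la r = 0.
Proof. by move=> h; rewrite /rowlen insubN // -leqNgt. Qed.

Lemma rowlen_le la r : rowlen la r <= n.
Proof. by rewrite /rowlen; case: insub => // i; rewrite -ltnS ltn_ord. Qed.

Lemma ssizeE la : ssize la = \sum_(0 <= r < n.+1) rowlen la r.
Proof. by rewrite big_mkord; apply: eq_bigr => i _; rewrite rowlenE. Qed.

Lemma rowlen_le_size la r : rowlen la r <= ssize la.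
Proof.
rewrite /rowlen; case: insubP => // i _ _.
by rewrite /ssize (bigD1 i) //= leq_addr.
Qed.

Lemma rowlen_inj la nu : (forall r, rowlen la r = rowlen nu r) -> la = nu.
Proof. by move=> h; apply/ffunP=> i; apply/val_inj; rewrite /= -!rowlenE. Qed.

Definition mkshape (f : nat -> nat) : yshape := [ffun r : 'I_n.+1 => inord (f r)].

Lemma rowlen_mk f r : (forall i, i <= n -> f i <= n) -> r <= n ->
  rowlen (mkshape f) r = f r.
Proof.
move=> hf hr; have hr' : r < n.+1 by [].
by rewrite -[r]/(val (Ordinal hr')) rowlenE ffunE inordK ?ltnS ?hf.
Qed.

Lemma hstripP ka la :
  reflect (forall r, rowlen ka r <= rowlen la r /\ rowlen la r.+1 <= rowlen ka r)
          (hstrip ka la).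
Proof.
apply: (iffP forallP) => [h r|h r]; last by have [-> ->] := h r.
have [hr|hr] := ltnP r n.+1; first by have /andP[] := h (Ordinal hr).
by rewrite !rowlen_oob // ltnW.
Qed.

Lemma hstrip_size ka la : hstrip ka la -> ssize ka <= ssize la.
Proof. by move=> /hstripP h; apply: leq_sum => r _; rewrite -!rowlenE; case: (h r). Qed.

Lemma antitone_last_row la : (forall r, rowlen la r.+1 <= rowlen la r) ->
  ssize la <= n -> rowlen la n = 0.
Proof.
move=> h hs; apply/eqP/contraT; rewrite -lt0n => h0.
have anti r : r <= n -> rowlen la n <= rowlen la r.
  move=> /subnKC <-; elim: (n - r) => [|k IH]; first by rewrite addn0.
  by rewrite addnS; apply: leq_trans (h _) _.
have : \sum_(r < n.+1) 1 <= ssize la.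
  apply: leq_sum => r _; rewrite -rowlenE; apply: leq_trans h0 (anti _ _).
  by rewrite -ltnS.
by rewrite sum1_card card_ord; lia.
Qed.

Lemma hstrip_antil ka la r : hstrip ka la -> rowlen ka r.+1 <= rowlen ka r.
Proof. by move=> /hstripP h; have := h r; have := h r.+1; lia. Qed.

Lemma hstrip_antir ka la r : hstrip ka la -> rowlen la r.+1 <= rowlen la r.
Proof. by move=> /hstripP h; have := h r; have := h r.+1; lia. Qed.

Section Toggle.
Variables (la rho : yshape) (b : nat).
Hypothesis hb : ssize rho + b <= n.

(** These bound row r of a shape lying below both [la] and [rho], and equally row r + 1 of a shape
    lying above both. This coincidence makes the toggle possible. *)
Let lo r := maxn (rowlen la r.+1) (rowlen rho r.+1).
Let hi r := minn (rowlen la r) (rowlen rho r).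

Let up ka : yshape := mkshape (fun r => if r is r'.+1 then lo r' + hi r' - rowlen ka r'
   else maxn (rowlen la 0) (rowlen rho 0) + (ssize ka + b - ssize la)).
Let down nu : yshape := mkshape (fun r => lo r + hi r - rowlen nu r.+1).

(** In each row the maximum and the minimum add up to the two lengths; [lo] lists the maxima shifted
    by one row, so the maximum of the first rows has to be added back. The first row of [up] is
    chosen to match this count. *)
Let sum_lo_hi : \sum_(0 <= r < n.+1) (lo r + hi r) + maxn (rowlen la 0) (rowlen rho 0)
  = ssize la + ssize rho.
Proof.
have e1 : \sum_(0 <= r < n.+1) lo r + maxn (rowlen la 0) (rowlen rho 0)
   = \sum_(0 <= r < n.+1) maxn (rowlen la r) (rowlen rho r).
  rewrite [RHS]big_nat_recl // addnC; congr (_ + _).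
  by rewrite big_nat_recr //= /lo !rowlen_oob // maxn0 addn0.
rewrite big_split /= addnAC e1 -big_split /= !ssizeE -big_split /=.
by apply: eq_bigr => r _; rewrite /hi; lia.
Qed.

Let up_ok ka : hstrip ka rho -> hstrip ka la -> ssize la <= ssize ka + b ->
  [/\ hstrip rho (up ka), hstrip la (up ka), ssize (up ka) = ssize rho + b
    & down (up ka) = ka].
Proof.
move=> h1 h2 hs; have kr := elimT (hstripP _ _) h1; have kl := elimT (hstripP _ _) h2.
(* The reflection of row n would be row n + 1 of [up ka], which does not exist; the size bound [hb]
   makes it empty. *)
have hin : hi n = 0.
  have : rowlen rho n = 0.
    apply: antitone_last_row => [r|]; [exact: hstrip_antir h1 | lia].
  by rewrite /hi; lia.
have kn : rowlen ka n = 0 by have := kr n; have := kl n; move: hin; rewrite /hi; lia.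
have lon : lo n = 0 by rewrite /lo !rowlen_oob.
have klo r : lo r <= rowlen ka r <= hi r.
  by have := kr r; have := kl r; rewrite /lo /hi; lia.
set fu := fun r => if r is r'.+1 then lo r' + hi r' - rowlen ka r'
   else maxn (rowlen la 0) (rowlen rho 0) + (ssize ka + b - ssize la).
have sumfu : \sum_(0 <= r < n.+1) fu r = ssize rho + b.
  rewrite big_nat_recl //=.
  have e : \sum_(0 <= r < n) (lo r + hi r - rowlen ka r) + ssize ka
     = \sum_(0 <= r < n.+1) (lo r + hi r).
    rewrite ssizeE big_nat_recr //= kn addn0 -big_split /= [RHS]big_nat_recr //= hin lon !addn0.
    by apply: eq_bigr => r _; have := klo r; lia.
  by move: e sum_lo_hi; lia.
have fu_le r : r <= n -> fu r <= n.
  move=> hr; apply: leq_trans hb; rewrite -sumfu big_mkord.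
  have hr' : r < n.+1 by [].
  by rewrite (bigD1 (Ordinal hr')) //= leq_addr.
have upE r : r <= n -> rowlen (up ka) r = fu r by move=> hr; rewrite rowlen_mk.
have upS r : rowlen (up ka) r.+1 = lo r + hi r - rowlen ka r.
  have [hr|hr] := ltnP r n; first by rewrite upE.
  rewrite rowlen_oob //; case: (ltngtP r n) hr => // [hr|->] _; last by rewrite lon hin.
  by rewrite /lo /hi !rowlen_oob // ltnW.
have up0 : rowlen (up ka) 0 = fu 0 by rewrite upE.
split.
- apply/hstripP => -[|r]; rewrite upS ?up0 /fu.
    by have := klo 0; rewrite /lo /hi; lia.
  by have := klo r; have := klo r.+1; rewrite upS /lo /hi; lia.
- apply/hstripP => -[|r]; rewrite upS ?up0 /fu.
    by have := klo 0; rewrite /lo /hi; lia.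
  by have := klo r; have := klo r.+1; rewrite upS /lo /hi; lia.
- by rewrite ssizeE -sumfu; apply: eq_big_nat => r /andP[_ hr]; rewrite upE.
- apply: rowlen_inj => r; have [hr|hr] := ltnP r n.+1; last by rewrite !rowlen_oob.
  rewrite rowlen_mk // ?upS; first by have := klo r; lia.
  move=> i hi'; rewrite upS; have := klo i; have := rowlen_le ka i; lia.
Qed.

Let down_ok nu : hstrip rho nu -> hstrip la nu -> ssize nu = ssize rho + b ->
  [/\ hstrip (down nu) rho, hstrip (down nu) la, ssize la <= ssize (down nu) + b
    & up (down nu) = nu].
Proof.
move=> h1 h2 hs; have kr := elimT (hstripP _ _) h1; have kl := elimT (hstripP _ _) h2.
have klo r : lo r <= rowlen nu r.+1 <= hi r.
  by have := kr r; have := kl r; have := kr r.+1; have := kl r.+1; rewrite /lo /hi; lia.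
have hi_le r : hi r <= n by have := rowlen_le la r; rewrite /hi; lia.
have hin : hi n = 0.
  have : rowlen rho n = 0.
    apply: antitone_last_row => [r|]; [exact: hstrip_antil h1 | lia].
  by rewrite /hi; lia.
have lon : lo n = 0 by rewrite /lo !rowlen_oob.
have dE r : rowlen (down nu) r = lo r + hi r - rowlen nu r.+1.
  have [hr|hr] := ltnP r n.+1; last first.
    by rewrite rowlen_oob // /lo /hi !rowlen_oob // ltnW.
  rewrite rowlen_mk // => i _; have := klo i; have := hi_le i; lia.
have sz : ssize (down nu) + ssize nu =
  ssize la + ssize rho + (rowlen nu 0 - maxn (rowlen la 0) (rowlen rho 0)).
  rewrite -sum_lo_hi [ssize nu]ssizeE big_nat_recl //.
  have -> : ssize (down nu) = \sum_(0 <= r < n) (lo r + hi r - rowlen nu r.+1).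
    rewrite ssizeE big_nat_recr //= dE hin lon sub0n addn0.
    by apply: eq_bigr => r _; rewrite dE.
  have e : \sum_(0 <= r < n) (lo r + hi r - rowlen nu r.+1) + \sum_(0 <= r < n) rowlen nu r.+1
     = \sum_(0 <= r < n.+1) (lo r + hi r).
    rewrite -big_split /= [RHS]big_nat_recr //= hin lon !addn0.
    by apply: eq_bigr => r _; have := klo r; lia.
  by move: e; have := kr 0; have := kl 0; lia.
split.
- apply/hstripP => r; rewrite dE.
  by have := klo r; rewrite /lo /hi; lia.
- apply/hstripP => r; rewrite dE.
  by have := klo r; rewrite /lo /hi; lia.
- by move: sz; lia.
- apply: rowlen_inj => r; have [hr|hr] := ltnP r n.+1; last by rewrite !rowlen_oob.
  have kr0 := kr 0; have kl0 := kl 0.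
  have e0 : maxn (rowlen la 0) (rowlen rho 0) + (ssize (down nu) + b - ssize la) = rowlen nu 0.
    by move: sz; lia.
  rewrite rowlen_mk // => [|i hi']; first by case: r {hr} => [|r] //; rewrite dE;
    have := klo r; lia.
  case: i hi' => [|i] _; first by rewrite e0; exact: rowlen_le.
  by rewrite dE; have := klo i; have := hi_le i; lia.
Qed.

(* Local rule of the RSK correspondence: rows r of ka and r + 1 of nu are reflections of each
   other in the interval [lo r, hi r], and the first row of nu absorbs the excess size. *)
Lemma card_hstrip_toggle :
  \sum_(nu | [&& hstrip rho nu, hstrip la nu & ssize nu == ssize rho + b]) 1 =
  \sum_(ka | [&& hstrip ka rho, hstrip ka la & ssize la <= ssize ka + b]) 1.
Proof.
apply: (@big_bij _ _ _ _ _ _ _ down up) => // [nu|ka].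
  by case/and3P=> h1 h2 /eqP h3; have [-> -> -> ->] := down_ok h1 h2 h3.
by case/and3P=> h1 h2 h3; have [-> -> -> ->] := up_ok h1 h2 h3; rewrite eqxx.
Qed.

End Toggle.
End Shapes.

(** * Schur polynomials by branching, the Pieri rule and the Cauchy identity *)

Section SchurRec.
Variables (n : nat) (R : comNzRingType).
Implicit Types (la nu ka rho : yshape n) (x y : R) (xs ys : seq R).

(** The generating product of the complete symmetric functions, with each geometric series cut after
    degree n. It is h_b only for [b <= n], whence the bounds in the lemmas below. *)
Definition complete (b : nat) ys : R := (\prod_(y <- ys) \poly_(k < n.+1) y ^+ k)`_b.

(* The first variable of the list carries the largest letter of the tableaux. *)
Fixpoint schur_rec ys la : R :=
  if ys is y :: ys' then
    \sum_(ka | hstrip ka la) y ^+ (ssize la - ssize ka) * schur_rec ys' ka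
  else (la == [ffun=> ord0])%:R.

Lemma complete_nil b : complete b [::] = (b == 0)%:R.
Proof. by rewrite /complete big_nil coef1. Qed.

Lemma complete_cat b xs ys :
  complete b (xs ++ ys) = \sum_(k < b.+1) complete k xs * complete (b - k) ys.
Proof. by rewrite /complete big_cat coefM. Qed.

Lemma complete1 b y : (b <= n)%N -> complete b [:: y] = y ^+ b.
Proof. by move=> hb; rewrite /complete big_seq1 coef_poly ltnS hb. Qed.

Lemma complete_cons b y ys : (b <= n)%N ->
  complete b (y :: ys) = \sum_(k < b.+1) y ^+ k * complete (b - k) ys.
Proof.
move=> hb; rewrite -cat1s complete_cat; apply: eq_bigr => k _.
by rewrite complete1 //; apply: leq_trans hb; rewrite -ltnS.
Qed.

Lemma complete_scale b x ys : (b <= n)%N ->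
  complete b [seq x * y | y <- ys] = x ^+ b * complete b ys.
Proof.
elim: ys b => [|y ys IH] b hb.
  by rewrite !complete_nil; case: b hb => [|b] _; rewrite ?expr0 ?mul1r ?mulr0.
rewrite !complete_cons // big_distrr; apply: eq_bigr => -[k hk] _ /=.
rewrite IH; last by rewrite (leq_trans (leq_subr _ _)).
have -> : x ^+ b = x ^+ k * x ^+ (b - k) by rewrite -exprD subnKC.
by rewrite exprMn; ring.
Qed.

Lemma ssize0 : ssize ([ffun=> ord0] : yshape n) = 0%N.
Proof. by rewrite /ssize big1 // => r _; rewrite ffunE. Qed.

Lemma ssize_eq0 la : (ssize la == 0%N) = (la == [ffun=> ord0]).
Proof.
apply/idP/eqP => [|->]; last by rewrite ssize0.
rewrite /ssize sum_nat_eq0 => /forallP h; apply/ffunP=> r.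
by apply/val_inj/eqP; rewrite ffunE /=; have := h r.
Qed.

Lemma hstrip0 ka : hstrip ka [ffun=> ord0] = (ka == [ffun=> ord0]).
Proof.
apply/idP/eqP => [h|->].
  by apply/eqP; rewrite -ssize_eq0 -leqn0 -ssize0; exact: hstrip_size.
by apply/hstripP=> r; rewrite /rowlen; case: insub => [?|]; case: insub => [?|]; rewrite ?ffunE.
Qed.

Lemma schur_rec0 ys : schur_rec ys [ffun=> ord0] = 1.
Proof.
elim: ys => [|y ys IH] /=; first by rewrite eqxx.
under eq_bigl do rewrite hstrip0.
by rewrite big_pred1_eq subnn expr0 mul1r.
Qed.

(** Induction on the variables. Removing the largest letter from nu leaves some la, and for fixed la
    the summand depends on nu only through its prescribed size. So only the number of nu matters,
    and the toggle trades them for shapes ka below both rho and la, where the induction hypothesis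
    applies. *)
Lemma pieri ys rho b : (ssize rho + b <= n)%N ->
  \sum_(nu | hstrip rho nu && (ssize nu == ssize rho + b)%N) schur_rec ys nu =
  complete b ys * schur_rec ys rho.
Proof.
elim: ys rho b => [|y ys IH] rho b hb.
  rewrite complete_nil /= big_mkcond (bigD1 [ffun=> ord0]) //= big1 ?addr0; last first.
    by move=> nu /negPf ->; rewrite if_same.
  rewrite hstrip0 ssize0 eqxx -natrM mulnb -(ssize_eq0 rho).
  by case: (ssize rho) => [|m]; case: b {hb} => [|b]; rewrite ?andbF.
have toggle la : \sum_(nu | [&& hstrip rho nu, hstrip la nu & ssize nu == (ssize rho + b)%N])
      y ^+ (ssize rho + b - ssize la) * schur_rec ys la =
    \sum_(ka | [&& hstrip ka rho, hstrip ka la & (ssize la <= ssize ka + b)%N])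
      y ^+ (ssize rho + b - ssize la) * schur_rec ys la.
  by rewrite !sumr_const -!sum1_card card_hstrip_toggle.
transitivity (\sum_la \sum_(nu | [&& hstrip rho nu, hstrip la nu & ssize nu == (ssize rho + b)%N])
      y ^+ (ssize rho + b - ssize la) * schur_rec ys la).
  rewrite [RHS](exchange_big_dep (fun nu => hstrip rho nu && (ssize nu == ssize rho + b)%N))
    //=; last first.
    by move=> la nu _ /and3P[-> _ ->].
  apply: eq_bigr => nu /andP[h1 /eqP h2].
  by apply: eq_big => [la|la _]; rewrite ?h1 ?h2 ?eqxx ?andbT.
under eq_bigr do rewrite toggle.
rewrite (exchange_big_dep (fun ka => hstrip ka rho)) //=; last by move=> la ka _ /and3P[].
rewrite mulr_sumr; apply: eq_bigr => ka hk.
rewrite complete_cons ?mulr_suml; last by apply: leq_trans hb; exact: leq_addl.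
have sk := hstrip_size hk.
(* The index k is the exponent of y left for the complete function once the strip from ka to rho has
   taken its share. *)
rewrite (partition_big (fun la => inord (ssize ka + b - ssize la) : 'I_b.+1) predT) //=.
apply: eq_bigr => -[k /= hkb] _.
have hk' : (ssize ka + (b - k) <= n)%N by lia.
transitivity (y ^+ k * y ^+ (ssize rho - ssize ka) * (complete (b - k) ys * schur_rec ys ka));
  last by ring.
rewrite -IH // mulr_sumr -exprD hk /=.
apply: eq_big => [la|la].
  case hla: (hstrip ka la) => //=; have := hstrip_size hla => sl.
  apply/andP/eqP => [[h1]|h1].
    by rewrite -val_eqE /= inordK; lia.
  by split; [|rewrite -val_eqE /= inordK]; lia.
case/andP=> /andP[hla h1]; rewrite -val_eqE /= inordK; last by have := hstrip_size hla; lia.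
by move=> h2; congr (_ ^+ _ * _); lia.
Qed.

(** Removing the largest letter x from the first tableau leaves ka and a sum over the la above ka,
    which [pieri] evaluates; by homogeneity x^k h_k(ys) is h_k of the products of x with [ys]. *)
Lemma cauchy xs ys m : (m <= n)%N ->
  \sum_(la | ssize la == m) schur_rec xs la * schur_rec ys la =
  complete m [seq x * y | x <- xs, y <- ys].
Proof.
elim: xs m => [|x xs IH] m hm.
  rewrite complete_nil big_mkcond (bigD1 [ffun=> ord0]) //= big1 ?addr0; last first.
    by move=> nu /negPf ->; rewrite mul0r if_same.
  by rewrite ssize0 eqxx mul1r schur_rec0; case: m hm.
rewrite complete_cat /=.
transitivity (\sum_ka \sum_(la | hstrip ka la && (ssize la == m))
   x ^+ (m - ssize ka) * schur_rec xs ka * schur_rec ys la).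
  rewrite [RHS](exchange_big_dep (fun la => ssize la == m)) /=; last by move=> ka la _ /andP[].
  apply: eq_bigr => la hla; rewrite mulr_suml.
  by apply: eq_big => [ka|ka _]; rewrite ?hla ?andbT ?(eqP hla).
rewrite (bigID (fun ka => ssize ka <= m)%N) /= [X in _ + X]big1 ?addr0; last first.
  move=> ka hka; rewrite big_pred0 // => la; apply/negP=> /andP[/hstrip_size h /eqP h'].
  by rewrite -h' h in hka.
rewrite (partition_big (fun ka => inord (m - ssize ka) : 'I_m.+1) predT) //=.
apply: eq_bigr => -[k /= hk] _; have hk' : (k <= n)%N by lia.
rewrite complete_scale // -IH ?mulr_sumr; last by lia.
apply: eq_big => [ka|ka].
  apply/andP/eqP => [[h1]|h1].
    by rewrite -val_eqE /= inordK; lia.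
  by split; [|rewrite -val_eqE /= inordK]; lia.
case/andP=> h1; rewrite -val_eqE /= inordK ?ltnS ?leq_subr // => /eqP <-.
transitivity (x ^+ (m - ssize ka) * schur_rec xs ka * (complete (m - ssize ka) ys * schur_rec
  ys ka)); last by ring.
rewrite -pieri; last by lia.
rewrite mulr_sumr; apply: eq_bigl => la; by rewrite subnKC.
Qed.

End SchurRec.

(** * Semistandard tableaux on a square grid and the branching rule *)

Section Tableaux.
Variables (n M : nat) (R : comNzRingType) (y : nat -> R).
Implicit Types (la ka : yshape n) (T : {ffun 'I_n.+1 * 'I_n.+1 -> 'I_M.+1}).

Definition entry T (r c : 'I_n.+1) : nat := T (r, c).

(* Tableaux with entries in [0, N), extended by the value N outside the diagram. *)
Definition ext_tableau (N : nat) la T : bool :=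
  [&& [forall r : 'I_n.+1, forall c : 'I_n.+1, (entry T r c < N) == (c < la r)],
     [forall r : 'I_n.+1, forall c : 'I_n.+1, entry T r c <= N],
     [forall r : 'I_n.+1, forall c : 'I_n.+1, forall c' : 'I_n.+1,
       (c < c') ==> (entry T r c <= entry T r c')]
   & [forall r : 'I_n.+1, forall r' : 'I_n.+1, forall c : 'I_n.+1,
       (r < r') ==> (entry T r c < entry T r' c) || (entry T r' c == N)]]%N.

Lemma ext_tableauP N la T :
  reflect [/\ forall r c : 'I_n.+1, (entry T r c < N)%N = (c < la r)%N,
     forall r c : 'I_n.+1, (entry T r c <= N)%N,
     forall r c c' : 'I_n.+1, (c < c')%N -> (entry T r c <= entry T r c')%N &
     forall r r' c : 'I_n.+1, (r < r')%N ->
       (entry T r c < entry T r' c)%N \/ entry T r' c = N]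
   (ext_tableau N la T).
Proof.
apply: (iffP and4P) => [[h1 h2 h3 h4]|[h1 h2 h3 h4]]; split.
- by move=> r c; have /forallP/(_ c)/eqP := forallP h1 r.
- by move=> r c; have /forallP/(_ c) := forallP h2 r.
- by move=> r c c'; have /forallP/(_ c)/forallP/(_ c')/implyP := forallP h3 r.
- move=> r r' c h; have /forallP/(_ r')/forallP/(_ c)/implyP/(_ h) := forallP h4 r.
  by case/orP=> [->|/eqP ->]; [left|right].
- by apply/forallP=> r; apply/forallP=> c; rewrite h1.
- by apply/forallP=> r; apply/forallP=> c; rewrite h2.
- by apply/forallP=> r; apply/forallP=> c; apply/forallP=> c'; apply/implyP; exact: h3.
- apply/forallP=> r; apply/forallP=> r'; apply/forallP=> c; apply/implyP=> h.
  by case: (h4 r r' c h) => [->//|->]; rewrite eqxx orbT.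
Qed.

Lemma entry_inj T T' : (forall r c, entry T r c = entry T' r c) -> T = T'.
Proof. by move=> h; apply/ffunP=> -[r c]; apply/val_inj/h. Qed.

Definition below (N : nat) T : yshape n :=
  [ffun r : 'I_n.+1 => inord #|[set c : 'I_n.+1 | entry T r c < N]|%N].

Lemma belowE N la T (r c : 'I_n.+1) : ext_tableau N.+1 la T ->
  (c < below N T r)%N = (entry T r c < N)%N.
Proof.
move=> /ext_tableauP[h1 h2 h3 h4].
set A := [set c : 'I_n.+1 | entry T r c < N]%N.
have hA (d d' : 'I_n.+1) : (d <= d')%N -> d' \in A -> d \in A.
  rewrite leq_eqVlt => /orP[/eqP/val_inj-> //|/(h3 r)]; rewrite /A !inE; lia.
rewrite ffunE inordK -/A; last first.
  (* If all n + 1 columns were counted, column n would lie in the diagram, against [la r <= n]; so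
     [inord] does not overflow. *)
  rewrite ltnS leqNgt; apply/negP => hc.
  have : ord_max \in A by rewrite mem_ord_downset.
  rewrite /A inE => /ltnW; rewrite -ltnS h1 /=; have := ltn_ord (la r); lia.
by rewrite -mem_ord_downset // /A inE.
Qed.

(** The cells removed all carry the largest letter N, and strictness down the columns leaves at most
    one of them per column. *)
Lemma below_hstrip N la T : ext_tableau N.+1 la T -> hstrip (below N T) la.
Proof.
move=> hT; have bE := belowE _ _ hT; move: hT => /ext_tableauP[h1 h2 h3 h4].
apply/forallP=> r; rewrite !rowlenE; apply/andP; split.
  rewrite leqNgt; apply/negP => hlt.
  have : (la r < below N T r)%N by [].
  by rewrite bE => hN; have := h1 r (la r); rewrite ltnn; lia.
rewrite leqNgt; apply/negP; rewrite /rowlen; case: insubP => //= r' _ er hlt.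
have := h1 r' (below N T r); rewrite hlt => hN.
have := bE r (below N T r); rewrite ltnn.
by case: (h4 r r' (below N T r)); [rewrite er| |]; lia.
Qed.

Lemma card_skew ka la : (forall r : 'I_n.+1, ka r <= la r)%N ->
  #|[pred c : 'I_n.+1 * 'I_n.+1 | (c.2 < la c.1) && ~~ (c.2 < ka c.1)]%N| = (ssize la - ssize ka)%N.
Proof.
move=> h; have sz (mu : yshape n) : #|[pred c : 'I_n.+1 * 'I_n.+1 | c.2 < mu c.1]%N| = ssize mu.
  rewrite -sum1_card -(pair_big_dep xpredT (fun r c : 'I_n.+1 => c < mu r)%N (fun _ _ => 1%N)) /=.
  by apply: eq_bigr => r _; rewrite sum1dep_card card_ord_ltn // ltnW.
rewrite -!sz -(cardID [pred c : 'I_n.+1 * 'I_n.+1 | c.2 < ka c.1]%N [pred c :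
  'I_n.+1 * 'I_n.+1 | c.2 < la c.1]%N).
rewrite [X in (X + _ - _)%N](_ : _ = #|[pred c : 'I_n.+1 * 'I_n.+1 | c.2 < ka c.1]%N|).
  by rewrite addKn; apply: eq_card => c; rewrite !inE andbC.
apply: eq_card => c; rewrite !inE /=; apply/andP/idP => [[h1 h2] //|h'].
by split=> //; exact: leq_trans h' (h _).
Qed.

(** Capping at N merges the letter N with the old outside value N + 1 into the new outside value
    N. *)
Definition restrict_tab (N : nat) T : {ffun 'I_n.+1 * 'I_n.+1 -> 'I_M.+1} :=
  [ffun c => inord (minn (entry T c.1 c.2) N)].
Definition extend_tab (N : nat) ka la T : {ffun 'I_n.+1 * 'I_n.+1 -> 'I_M.+1} :=
  [ffun c : 'I_n.+1 * 'I_n.+1 => if (c.2 < ka c.1)%N then T c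
     else if (c.2 < la c.1)%N then inord N else inord N.+1].

Lemma entry_restrict N T r c : (N <= M)%N ->
  entry (restrict_tab N T) r c = minn (entry T r c) N.
Proof. by move=> hN; rewrite /entry ffunE inordK // ltnS geq_min hN orbT. Qed.

Lemma entry_extend N ka la T r c : (N < M)%N ->
  entry (extend_tab N ka la T) r c =
   (if c < ka r then entry T r c else if c < la r then N else N.+1)%N.
Proof.
move=> hN; rewrite /entry ffunE /=; case: ifP => // _.
by case: ifP => _; rewrite inordK // ltnS // ltnW.
Qed.

Lemma restrict_tabP N la T : (N < M)%N -> ext_tableau N.+1 la T ->
  ext_tableau N (below N T) (restrict_tab N T) /\
  extend_tab N (below N T) la (restrict_tab N T) = T.
Proof.
move=> hN hT; have bE := belowE _ _ hT; move: hT => /ext_tableauP[h1 h2 h3 h4].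
have hN' := ltnW hN.
split.
  apply/ext_tableauP; split=> [r c|r c|r c c' /(h3 r)|r r' c /(h4 _ _ c)];
  rewrite ?entry_restrict // ?bE; lia.
apply: entry_inj => r c; rewrite entry_extend // entry_restrict // bE -h1.
by have := h2 r c; case: ltnP => h; [|case: ltnP => h']; lia.
Qed.

Lemma extend_tabP N ka la T : (N < M)%N -> hstrip ka la -> ext_tableau N ka T ->
  [/\ ext_tableau N.+1 la (extend_tab N ka la T), below N (extend_tab N ka la T) = ka
    & restrict_tab N (extend_tab N ka la T) = T].
Proof.
move=> hN hkl /ext_tableauP[h1 h2 h3 h4].
have kl (r : 'I_n.+1) : (ka r <= la r)%N by have /hstripP/(_ r)[] := hkl; rewrite !rowlenE.
have kl' (r r' : 'I_n.+1) : (r < r')%N -> (la r' <= ka r)%N.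
  move=> hr; have /hstripP/(_ r)[_] := hkl; rewrite rowlenE => h; apply: leq_trans h.
  rewrite -rowlenE; move: (hr) => /subnKC <-; elim: (r' - r.+1)%N => [|k IH].
    by rewrite addn0.
  by apply: leq_trans IH; rewrite addnS; exact: hstrip_antir hkl.
have hT : ext_tableau N.+1 la (extend_tab N ka la T).
  apply/ext_tableauP; split=> [r c|r c|r c c' hc|r r' c hr]; rewrite ?entry_extend //.
  - by have := h1 r c; have := kl r; do ! case: ifP; lia.
  - by have := h2 r c; do ! case: ifP; lia.
  - by have := h1 r c; have := h3 r c c' hc; have := kl r; have := h2 r c; do ! case: ifP; lia.
  - by have := h1 r c; have := h4 r r' c hr; have := kl' r r' hr; have := h1 r' c;
    have := kl r; do ! case: ifP; lia.
split=> //.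
  apply/ffunP=> r; apply/val_inj/eqP; rewrite /= eqn_leq.
  have b (c : 'I_n.+1) : (c < below N (extend_tab N ka la T) r)%N = (c < ka r)%N.
    by rewrite (belowE _ _ hT) entry_extend // -h1; do ! case: ifP; lia.
  by rewrite leqNgt b ltnn /= leqNgt -b ltnn.
apply: entry_inj => r c; rewrite entry_restrict 1?ltnW // entry_extend //.
by have := h1 r c; have := h2 r c; do ! case: ifP; lia.
Qed.

(** Induction on N: the cells with the largest letter form the strip between ka and la and
    contribute the power of its variable. The fixed bound M keeps all tableaux in one type while N
    varies. *)
Lemma sum_ext_tableau N la : (N <= M)%N ->
  \sum_(T | ext_tableau N la T) \prod_(c : 'I_n.+1 * 'I_n.+1 | (c.2 < la c.1)%N) y (T c) =
  schur_rec [seq y i | i <- rev (iota 0 N)] la.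
Proof.
elim: N la => [|N IH] la hN.
  rewrite /=; have [->|hla] := eqVneq la [ffun=> ord0].
    rewrite (big_pred1 [ffun=> ord0]) => [|T].
      by rewrite big_pred0 // => c; rewrite ffunE.
    apply/ext_tableauP/eqP => [[_ h _ _]|-> /=].
      by apply: entry_inj => r c; have := h r c; rewrite /entry ffunE /=; lia.
    by split=> *; rewrite /entry ?ffunE //; right.
  rewrite big_pred0 // => T; apply/negP => /ext_tableauP[h _ _ _].
  case/negP: hla; apply/eqP/ffunP=> r; apply/val_inj; have := h r ord0.
  by rewrite ffunE /=; lia.
have -> : rev (iota 0 N.+1) = N :: rev (iota 0 N) by rewrite -[N.+1]addn1 iotaD rev_cat.
rewrite /=.
rewrite (@partition_big _ _ _ _ _ _ _ (below N) (fun ka => hstrip ka la));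
  last by move=> T /below_hstrip.
apply: eq_bigr => ka hk; rewrite -(IH _ (ltnW hN)) mulr_sumr /=.
apply: (@big_bij _ _ _ _ _ _ _ (restrict_tab N) (extend_tab N ka la)).
- by move=> T /andP[hT /eqP <-]; have [-> ->] := restrict_tabP hN hT.
- by move=> T hT; have [-> -> ->] := extend_tabP hN hk hT; rewrite eqxx.
move=> T /andP[hT /eqP eb].
have bE (r c : 'I_n.+1) : (c < ka r)%N = (entry T r c < N)%N by rewrite -eb (belowE _ _ hT).
have kl (r : 'I_n.+1) : (ka r <= la r)%N by have /hstripP/(_ r)[] := hk; rewrite !rowlenE.
rewrite (bigID (fun c : 'I_n.+1 * 'I_n.+1 => c.2 < ka c.1)%N) /= mulrC; congr (_ * _).
  rewrite -card_skew // -prodr_const; apply: eq_bigr => -[r c] /andP[/= h1].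
  rewrite bE; move: hT => /ext_tableauP[h _ _ _]; rewrite -h in h1 => h2.
  by congr y; move: h1 h2; rewrite /entry; lia.
apply: eq_big => [[r c] /=|[r c] /andP[_ /=]]; first by apply: andb_idl => h;
  exact: leq_trans (kl _).
rewrite bE => h; congr y; rewrite -[LHS]/(entry T r c) -[RHS]/(entry (restrict_tab N T) r c).
by rewrite entry_restrict; lia.
Qed.

End Tableaux.

(** * Partitions of n as shapes, and Schur polynomials of their diagrams *)

Section IntPart.
Variable n : nat.
Implicit Types (la : intpart n) (sh : yshape n).

Definition part_shape la : yshape n :=
  mkshape n (fun r => nth 0%N (map val (val la)) r).

Lemma rowlen_part la r : rowlen (part_shape la) r = nth 0%N (map val (val la)) r.
Proof.
have sz : size (map val (val la)) = n by rewrite size_map size_tuple.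
have [hr|hr] := leqP r n; last by rewrite rowlen_oob // nth_default // sz ltnW.
rewrite rowlen_mk // => i _; have [hi|hi] := ltnP i n; last by rewrite nth_default // sz.
by rewrite (nth_map ord0) ?size_tuple // -ltnS ltn_ord.
Qed.

Lemma rowlen_part_tnth la (r : 'I_n) : rowlen (part_shape la) r = tnth (val la) r.
Proof. by rewrite rowlen_part (nth_map ord0) ?size_tuple // -tnth_nth. Qed.

Definition antitone sh := [forall r : 'I_n.+1, rowlen sh r.+1 <= rowlen sh r]%N.

Lemma antitoneP sh : reflect (forall r, rowlen sh r.+1 <= rowlen sh r)%N (antitone sh).
Proof.
apply: (iffP forallP) => h r; last exact: h.
have [hr|hr] := ltnP r n.+1; first by have := h (Ordinal hr).
by rewrite !rowlen_oob // ltnW.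
Qed.

Lemma part_antitone la : antitone (part_shape la).
Proof.
apply/antitoneP => r; rewrite !rowlen_part; have /andP[/(sortedP 0%N) h _] := valP la.
have [hr|hr] := ltnP r.+1 (size (map val (val la))); first exact: h.
by rewrite nth_default.
Qed.

Lemma ssize_part la : ssize (part_shape la) = n.
Proof.
rewrite ssizeE big_nat_recr //= rowlen_part nth_default ?size_map ?size_tuple // addn0.
have /andP[_ /eqP e] := valP la; rewrite -[RHS]e sumnE.
have sz : size (map val (val la)) = n by rewrite size_map size_tuple.
rewrite [RHS](big_nth 0%N) sz.
by apply: eq_bigr => r _; rewrite rowlen_part.
Qed.

Lemma part_shape_inj : injective part_shape.
Proof.
move=> la mu e; apply/val_inj/eq_from_tnth => r; apply: ord_inj.
by rewrite -!rowlen_part_tnth e.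
Qed.

Lemma part_shape_surj sh : antitone sh -> ssize sh = n -> exists la, part_shape la = sh.
Proof.
move=> anti sz; pose t : n.-tuple 'I_n.+1 := [tuple inord (rowlen sh r) | r < n].
have tE : map val (val t) = mkseq (rowlen sh) n.
  rewrite /= -map_comp /mkseq -val_enum_ord -map_comp.
  by apply: eq_map => r /=; rewrite inordK // ltnS rowlen_le.
have last0 : rowlen sh n = 0%N.
  by apply: antitone_last_row => [r|]; [exact/antitoneP|rewrite sz].
have ht : is_partition t.
  rewrite /is_partition tE; apply/andP; split.
    apply/(sortedP 0%N) => r; rewrite size_mkseq => hr.
    by rewrite !nth_mkseq // 1?ltnW //; exact/antitoneP.
  by rewrite sumnE big_map -[X in iota _ X](subn0 n) -/(index_iota 0 n) -[X in _ == X]sz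
       ssizeE big_nat_recr //= last0 addn0.
exists (exist _ t ht); apply: rowlen_inj => r; rewrite rowlen_part [val _]/= tE.
have [hr|hr] := ltnP r n; first by rewrite nth_mkseq.
rewrite nth_default ?size_mkseq //; case: (ltngtP r n) hr => // [h|->] _ //.
by rewrite rowlen_oob.
Qed.

(** Partitions of n are the weakly decreasing shapes of size n. Since [schur_rec] vanishes at all
    other shapes, this turns the sum over shapes in [cauchy] into a sum over partitions. *)
Lemma sum_part_shape (R : nmodType) (F : yshape n -> R) :
  (forall sh, ~~ antitone sh -> F sh = 0) ->
  \sum_la F (part_shape la) = \sum_(sh | ssize sh == n) F sh.
Proof.
move=> F0; rewrite [RHS](bigID antitone) /= [X in _ + X]big1 ?addr0; last by move=> sh /andP[_ /F0].
rewrite -(big_imset F) /=; last by move=> la mu _ _; exact: part_shape_inj.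
apply: eq_bigl => sh; apply/imsetP/andP => [[la _ ->]|[/eqP sz anti]].
  by rewrite ssize_part part_antitone.
by have [la <-] := part_shape_surj anti sz; exists la.
Qed.

Lemma schur_rec_antitone (R : comNzRingType) (ys : seq R) sh :
  ~~ antitone sh -> schur_rec ys sh = 0.
Proof.
case: ys => [|y ys] /= h.
  case: eqP => // e; case/negP: h; apply/antitoneP => r.
  by rewrite e /rowlen; do ! case: insub => [?|]; rewrite ?ffunE.
rewrite big_pred0 // => ka; apply/negP => hk; case/negP: h.
by apply/antitoneP=> r; exact: hstrip_antir hk.
Qed.

Section Cells.
Variable la : intpart n.

Definition cell_pos (k : cell la) : 'I_n.+1 * 'I_n.+1 :=
  (widen_ord (leqnSn n) (val k).1, widen_ord (leqnSn n) (val k).2).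

Definition pos_cell (p : 'I_n.+1 * 'I_n.+1) : option (cell la) :=
  [pick k : cell la | cell_pos k == p].

Lemma cell_pos_inj : injective cell_pos.
Proof.
move=> [[r c] h] [[r' c'] h'] [er ec]; apply: val_inj => /=.
by congr (_, _); apply: val_inj.
Qed.

Lemma cell_posK : pcancel cell_pos pos_cell.
Proof.
move=> k; rewrite /pos_cell; case: pickP => [k' /eqP/cell_pos_inj -> //|/(_ k)].
by rewrite eqxx.
Qed.

Lemma part_shape_cell (k : cell la) :
  ((cell_pos k).2 < part_shape la (cell_pos k).1)%N.
Proof. by rewrite -rowlenE rowlen_part_tnth; exact: (valP k). Qed.

Lemma mem_part_shape (r c : 'I_n.+1) : (c < part_shape la r)%N ->
  exists k : cell la, cell_pos k = (r, c).
Proof.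
rewrite -rowlenE => h.
have hr : (r < n)%N.
  rewrite ltnNge; apply/negP => hr; move: h.
  by rewrite rowlen_part nth_default // size_map size_tuple.
have hc : (c < n)%N.
  by apply: leq_trans h _; rewrite -[X in (_ <= X)%N](ssize_part la); exact: rowlen_le_size.
have hk : (Ordinal hc < tnth (val la) (Ordinal hr))%N.
  by rewrite -rowlen_part_tnth.
exists (exist (fun c : 'I_n * 'I_n => c.2 < tnth (val la) c.1)%N (Ordinal hr, Ordinal hc) hk).
by congr (_, _); apply: val_inj.
Qed.

Lemma pos_cell_out (r c : 'I_n.+1) : (part_shape la r <= c)%N -> pos_cell (r, c) = None.
Proof.
rewrite /pos_cell; case: pickP => [k /eqP e|//].
by rewrite leqNgt; have := part_shape_cell k; rewrite e => ->.
Qed.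

End Cells.

Lemma semistandardP N la (T : {ffun cell la -> 'I_N}) :
  reflect ((forall k k' : cell la, (val k).1 = (val k').1 ->
      ((val k).2 < (val k').2)%N -> (T k <= T k')%N) /\
    (forall k k' : cell la, (val k).2 = (val k').2 ->
      ((val k).1 < (val k').1)%N -> (T k < T k')%N)) (is_semistandard T).
Proof.
apply: (iffP forallP) => [h|[h1 h2] k].
  split=> k k' e lt; have /forallP/(_ k')/andP[] := h k.
    by rewrite e eqxx lt /= => ->.
  by rewrite e eqxx lt /= => _ ->.
apply/forallP=> k'; apply/andP; split; apply/implyP=> /andP[/eqP e lt].
  exact: h1.
exact: h2.
Qed.

Lemma sum_semistandard (R : comNzRingType) N (x : 'I_N -> R) la : (0 < n)%N ->
  \sum_(T : {ffun cell la -> 'I_N} | is_semistandard T) \prod_c x (T c) =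
  schur_rec [seq x i | i <- rev (enum 'I_N)] (part_shape la).
Proof.
move=> n_gt0; pose y i := if insub i is Some j then x j else 0.
have -> : [seq x i | i <- rev (enum 'I_N)] = [seq y i | i <- rev (iota 0 N)].
  rewrite -val_enum_ord -map_rev -map_comp; apply: eq_map => i /=.
  by rewrite /y valK.
rewrite -(@sum_ext_tableau n N R y N) //.
(* Without letters both sums are empty, because a diagram of size n > 0 has a cell to fill; with
   letters, [inord] in [g] has a nonempty target. *)
case: N x @y => [|N] x y.
  rewrite !big_pred0 // => [T|T]; apply/negP.
    move=> /ext_tableauP[h _ _ _].
    have : ssize (part_shape la) = 0%N; last by rewrite ssize_part => e; rewrite e in n_gt0.
    by apply: big1 => r _; have := h r ord0; rewrite ltn0 => /esym/negbT;
      rewrite -leqNgt leqn0 => /eqP.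
  move=> _; have [k|h] := pickP (xpredT : pred (cell la)); first by case: (T k).
  have : ssize (part_shape la) = 0%N; last by rewrite ssize_part => e; rewrite e in n_gt0.
  apply: big1 => r _; apply/eqP; rewrite -leqn0 leqNgt; apply/negP.
  by move=> /(@mem_part_shape la r ord0)[k _]; have := h k.
pose f (T : {ffun cell la -> 'I_N.+1}) : {ffun 'I_n.+1 * 'I_n.+1 -> 'I_N.+2} :=
  [ffun p => if pos_cell la p is Some k then widen_ord (leqnSn N.+1) (T k) else ord_max].
pose g (T : {ffun 'I_n.+1 * 'I_n.+1 -> 'I_N.+2}) : {ffun cell la -> 'I_N.+1} :=
  [ffun k => inord (T (cell_pos k))].
have fk T k : f T (cell_pos k) = T k :> nat by rewrite ffunE cell_posK.
have fout T (r c : 'I_n.+1) : (part_shape la r <= c)%N -> f T (r, c) = N.+1 :> nat.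
  by move=> h; rewrite ffunE pos_cell_out.
apply: (@big_bij _ _ _ _ _ _ _ f g).
- move=> T /semistandardP[h1 h2]; split; last first.
    by apply/ffunP=> k; apply/val_inj; rewrite ffunE fk inord_val.
  apply/ext_tableauP; rewrite /entry; split=> [r c|r c|r c c' lt|r r' c lt].
  + have [h|h] := ltnP c (part_shape la r); last by rewrite fout // ltnn.
    by have [k <-] := mem_part_shape h; rewrite fk ltn_ord.
  + by rewrite -ltnS ltn_ord.
  + have [h|h] := ltnP c' (part_shape la r); last by rewrite (fout _ _ _ h) -ltnS ltn_ord.
    have [k' e'] := mem_part_shape h.
    have [k e] := mem_part_shape (ltn_trans lt h).
    rewrite -e' -e !fk; apply: h1; move: e e' => [er ec] [er' ec'].
      by apply/val_inj; rewrite -[RHS]/(val (widen_ord (leqnSn n) (val k').1)) er' -er.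
    by move: lt; rewrite -ec -ec'.
  + have [h|h] := ltnP c (part_shape la r'); last by right; exact: fout.
    have [k' e'] := mem_part_shape h.
    have h0 : (c < part_shape la r)%N.
      apply: leq_trans h _; rewrite -!rowlenE; move: (ltnW lt) => /subnKC <-.
      elim: (r' - r)%N => [|d IH]; first by rewrite addn0.
      by apply: leq_trans IH; rewrite addnS; apply/antitoneP/part_antitone.
    have [k e] := mem_part_shape h0; left.
    rewrite -e' -e !fk; apply: h2; move: e e' => [er ec] [er' ec'].
      by apply/val_inj; rewrite -[RHS]/(val (widen_ord (leqnSn n) (val k').2)) ec' -ec.
    by move: lt; rewrite -er -er'.
- move=> T /ext_tableauP; rewrite /entry => -[h1 h2 h3 h4].
  have gk k : g T k = T (cell_pos k) :> nat.
    by rewrite ffunE inordK // (h1 (cell_pos k).1) part_shape_cell.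
  split; last first.
    apply/ffunP=> -[r c]; apply/val_inj => /=.
    have [h|h] := ltnP c (part_shape la r); first by have [k <-] := mem_part_shape h; rewrite fk gk.
    by rewrite fout //; apply/eqP; rewrite eqn_leq h2 andbT leqNgt h1 -leqNgt.
  apply/semistandardP; split=> k k' e lt; rewrite !gk.
    have := h3 (cell_pos k).1 (cell_pos k).2 (cell_pos k').2 lt.
    by rewrite -surjective_pairing /cell_pos e.
  have := h4 (cell_pos k).1 (cell_pos k').1 (cell_pos k).2 lt.
  have := h1 (cell_pos k').1 (cell_pos k').2; rewrite part_shape_cell.
  by rewrite /cell_pos e /= => hlt [//|e']; rewrite e' ltnn in hlt.
move=> T _; rewrite (reindex_omap (@cell_pos la) (pos_cell la)) => [|[r c] /= h].
  apply: eq_big => [k|k _]; first by rewrite part_shape_cell cell_posK eqxx.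
  by rewrite fk /y valK.
by have [k <-] := mem_part_shape h; rewrite cell_posK.
Qed.

End IntPart.

(** * Colourings and power sums *)

Section Colourings.
Variables (n : nat) (Q : finType).
Implicit Types (h : {ffun 'I_n -> Q}) (s p : 'S_n).

Definition fixes s h := [forall i, h (s i) == h i].
Definition count_colour h q : nat := #|[set i | h i == q]|.

Lemma fixesP s h : reflect (forall i, h (s i) = h i) (fixes s h).
Proof. by apply: (iffP forallP) => H i; apply/eqP. Qed.

Lemma count_colour_lt h q : (count_colour h q < n.+1)%N.
Proof. by rewrite ltnS -[X in (_ <= X)%N](card_ord n) max_card. Qed.

Definition content h : {ffun Q -> 'I_n.+1} := [ffun q => Ordinal (count_colour_lt h q)].

Lemma contentE h q : content h q = count_colour h q :> nat.
Proof. by rewrite ffunE. Qed.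

Lemma sum_count_colour h : (\sum_q count_colour h q)%N = n.
Proof.
rewrite -[RHS](card_ord n) -sum1_card (partition_big h xpredT) //=.
by apply: eq_bigr => q _; rewrite sum1dep_card.
Qed.

Lemma prod_count_colour (R : comNzRingType) (y : Q -> R) h :
  \prod_i y (h i) = \prod_q y q ^+ count_colour h q.
Proof.
rewrite (partition_big h xpredT) //=; apply: eq_bigr => q _.
rewrite -prodr_const; apply: eq_big => [i|i /eqP -> //].
by rewrite inE.
Qed.

Lemma count_colour_perm h p q : count_colour [ffun i => h (p i)] q = count_colour h q.
Proof.
rewrite /count_colour -[RHS](card_imset _ (@perm_inj _ p^-1%g)).
apply: eq_card => i; rewrite inE ffunE; apply/idP/imsetP => [e|[j]].
  by exists (p i); rewrite ?inE // permK.
by rewrite inE => e ->; rewrite permKV.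
Qed.

Lemma count_mem_codom h q : count_mem q (codom h) = count_colour h q.
Proof.
rewrite codomE count_map -sum1_count big_enum_cond /count_colour -sum1dep_card.
by apply: eq_bigl => i.
Qed.

Lemma same_count_colour h h' : (forall q, count_colour h q = count_colour h' q) ->
  exists p : 'S_n, h' = [ffun i => h (p i)].
Proof.
move=> e; pose t h := [tuple h i | i < n].
have tE (g : {ffun 'I_n -> Q}) : t g = codom g :> seq Q by rewrite codomE /t /= enumT.
have : perm_eq (t h') (t h).
  by apply/allP => q _ /=; rewrite !tE !count_mem_codom e.
case/tuple_permP => p ep; exists p; apply/ffunP=> i; rewrite ffunE.
have /(congr1 (fun u : n.-tuple Q => tnth u i)) : t h' =
  [tuple tnth (t h) (p i) | i < n] by apply: val_inj.
by rewrite !tnth_mktuple.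
Qed.

Lemma exists_content (c : Q -> nat) : (\sum_q c q)%N = n ->
  exists h : {ffun 'I_n -> Q}, forall q, count_colour h q = c q.
Proof.
move=> hc; pose l := flatten [seq nseq (c q) q | q <- enum Q].
have sz : size l == n.
  rewrite size_flatten /shape -map_comp sumnE big_map big_enum /= -[X in _ == X]hc.
  by apply/eqP/eq_bigr => q _; rewrite size_nseq.
exists [ffun i => tnth (Tuple sz) i] => q.
rewrite -count_mem_codom.
have -> : codom [ffun i => tnth (Tuple sz) i] = l.
  rewrite codomE -[RHS]/(val (Tuple sz)) -[RHS]map_tnth_enum.
  by apply: eq_map => i; rewrite ffunE.
rewrite count_flatten -map_comp sumnE big_map big_enum /= (bigD1 q) //= count_nseq /= eqxx mul1n.
by rewrite big1 ?addn0 // => q' /negPf e; rewrite count_nseq /= e.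
Qed.

(* Burnside's lemma: two colourings are in the same orbit iff they have the same content. *)
Lemma sum_fixes_content (R : pzSemiRingType) (F : {ffun Q -> 'I_n.+1} -> R) :
  \sum_s \sum_(h | fixes s h) F (content h) =
  n`!%:R * \sum_(c : {ffun Q -> 'I_n.+1} | (\sum_q c q)%N == n) F c.
Proof.
rewrite (exchange_big_dep xpredT) //= mulr_sumr.
rewrite (partition_big content (fun c => (\sum_q c q)%N == n)) /=; last first.
  by move=> h _; rewrite -[X in _ == X](sum_count_colour h); apply/eqP/eq_bigr=> q _;
    rewrite contentE.
apply: eq_bigr => c /eqP hc; have [h0 e0] := exists_content hc.
have c0 : content h0 = c by apply/ffunP=> q; apply/val_inj; rewrite /= contentE e0.
(* The stabiliser of h is replaced by the permutations that carry h0 to h, a coset of the same size.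
   After exchanging the sums, each s carries h0 to exactly one h. *)
transitivity (\sum_(h | content h == c) \sum_(s : 'S_n | h == [ffun i => h0 (s i)]) F c).
  apply: eq_bigr => h /eqP hch; rewrite hch.
  have [p ->] : exists p : 'S_n, h = [ffun i => h0 (p i)].
    by apply: same_count_colour => q; rewrite -!contentE c0 hch.
  rewrite [RHS](reindex_inj (mulIg p)) /=; apply: eq_bigl => s.
  apply/fixesP/eqP => [hs|es i].
    by apply/ffunP=> i; have := hs i; rewrite !ffunE permM.
  by move: (congr1 (fun h : {ffun 'I_n -> Q} => h i) es); rewrite !ffunE permM.
rewrite (exchange_big_dep xpredT) //= -[X in X%:R](card_Sn n) -sum1_card natr_sum mulr_suml.
apply: eq_bigr => s _; rewrite mul1r (big_pred1 [ffun i => h0 (s i)]) // => h.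
rewrite andbC /=; apply: andb_idr => /eqP ->; apply/eqP/ffunP=> q; apply/val_inj.
by rewrite /= contentE count_colour_perm -contentE c0.
Qed.

Lemma complete_content (R : comNzRingType) (y : Q -> R) b :
  complete n b [seq y q | q <- enum Q] =
  \sum_(c : {ffun Q -> 'I_n.+1} | (\sum_q c q)%N == b) \prod_q y q ^+ c q.
Proof.
rewrite /complete big_map big_enum /=.
under eq_bigr => q _ do rewrite poly_def.
rewrite bigA_distr_bigA /= coef_sum [RHS]big_mkcond; apply: eq_bigr => c _.
rewrite scaler_prod prodrXr coefZ coefXn eq_sym.
by case: eqP; rewrite ?mulr1 ?mulr0.
Qed.

End Colourings.

(** * Power sums averaged over the symmetric group *)

Section PowerSum.
Variable n : nat.

Section Ring.
Variable R : comNzRingType.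

(* The power sum symmetric function of the cycle type of s. *)
Definition powersum N (x : 'I_N -> R) (s : 'S_n) : R :=
  \sum_(f : {ffun 'I_n -> 'I_N} | fixes s f) \prod_i x (f i).

(** Two colourings fixed by s are one colouring by pairs fixed by s, so Burnside's lemma turns the
    sum into h_n of the products x_i y_j. *)
Lemma sum_powersum2 N N' (x : 'I_N -> R) (y : 'I_N' -> R) :
  \sum_s powersum x s * powersum y s =
  n`!%:R * complete n n [seq x q.1 * y q.2 | q <- enum {: 'I_N * 'I_N'}].
Proof.
rewrite complete_content -sum_fixes_content; apply: eq_bigr => s _.
rewrite mulr_suml; under eq_bigr do rewrite mulr_sumr.
rewrite pair_big /=.
apply: (@big_bij _ _ _ _ _ _ _
  (fun fg : {ffun 'I_n -> 'I_N} * {ffun 'I_n -> 'I_N'} => [ffun i => (fg.1 i, fg.2 i)])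
  (fun h : {ffun 'I_n -> 'I_N * 'I_N'} => ([ffun i => (h i).1], [ffun i => (h i).2]))).
- move=> [f g] /andP[/fixesP hf /fixesP hg]; split; last by congr (_, _); apply/ffunP=> i;
  rewrite !ffunE.
  by apply/fixesP=> i; rewrite !ffunE hf hg.
- move=> h /fixesP hh; split; last by apply/ffunP=> i; rewrite !ffunE -surjective_pairing.
  by apply/andP; split; apply/fixesP=> i; rewrite !ffunE hh.
move=> [f g] _ /=; rewrite -big_split /=.
under [RHS]eq_bigr do rewrite contentE.
rewrite -(prod_count_colour (fun q => x q.1 * y q.2)).
by apply: eq_bigr => i _; rewrite ffunE.
Qed.

Lemma sum_powersum2_schur N N' (x : 'I_N -> R) (y : 'I_N' -> R) : (0 < n)%N ->
  \sum_s powersum x s * powersum y s =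
  n`!%:R * \sum_(la : intpart n)
    (\sum_(T : {ffun cell la -> 'I_N} | is_semistandard T) \prod_c x (T c)) *
    (\sum_(T : {ffun cell la -> 'I_N'} | is_semistandard T) \prod_c y (T c)).
Proof.
move=> n_gt0; rewrite sum_powersum2; congr (_ * _).
under [RHS]eq_bigr do rewrite !sum_semistandard //.
rewrite (@sum_part_shape n _ (fun sh => schur_rec [seq x i | i <- rev (enum 'I_N)] sh *
   schur_rec [seq y i | i <- rev (enum 'I_N')] sh)); last first.
  by move=> sh hsh; rewrite schur_rec_antitone // mul0r.
rewrite cauchy // /complete big_allpairs_dep !big_map; congr ((polyseq _)`__).
rewrite [RHS]big_rev [RHS]big_enum /= -(pair_bigA _ (fun i j => \poly_(k < n.+1) (x i * y j) ^+
  k)) /=.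
by apply: eq_bigr => i _; rewrite big_map [RHS]big_rev [RHS]big_enum.
Qed.

(** Again a colouring by pairs: its content is a matrix whose row i must sum to [m i]. The rows are
    then independent, and row i contributes the complete function of degree [m i]. *)
Lemma sum_count_powersum N N' (m : 'I_N -> nat) (y : 'I_N' -> R) :
  (\sum_i m i)%N = n ->
  \sum_(s : 'S_n) (\sum_(f : {ffun 'I_n -> 'I_N} | fixes s f)
      [forall i, count_colour f i == m i]%:R) * powersum y s =
  n`!%:R * \prod_i complete n (m i) [seq y k | k <- enum 'I_N'].
Proof.
move=> hm.
pose F (c : {ffun 'I_N * 'I_N' -> 'I_n.+1}) : R :=
  [forall i, (\sum_k c (i, k))%N == m i]%:R * \prod_q y q.2 ^+ c q.
transitivity (\sum_s \sum_(h : {ffun 'I_n -> 'I_N * 'I_N'} | fixes s h) F (content h)).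
  apply: eq_bigr => s _; rewrite mulr_suml; under eq_bigr do rewrite mulr_sumr.
  rewrite pair_big /=.
  apply: (@big_bij _ _ _ _ _ _ _
    (fun fg : {ffun 'I_n -> 'I_N} * {ffun 'I_n -> 'I_N'} => [ffun i => (fg.1 i, fg.2 i)])
    (fun h : {ffun 'I_n -> 'I_N * 'I_N'} => ([ffun i => (h i).1], [ffun i => (h i).2]))).
  - move=> [f g] /andP[/fixesP hf /fixesP hg]; split; last by congr (_, _); apply/ffunP=> i;
    rewrite !ffunE.
    by apply/fixesP=> i; rewrite !ffunE hf hg.
  - move=> h /fixesP hh; split; last by apply/ffunP=> i; rewrite !ffunE -surjective_pairing.
    by apply/andP; split; apply/fixesP=> i; rewrite !ffunE hh.
  move=> [f g] _ /=; rewrite /F; congr (_%:R * _).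
    congr (nat_of_bool _); apply: eq_forallb => i; congr (_ == _).
    under eq_bigr do rewrite contentE /count_colour -sum1dep_card.
    rewrite /count_colour -sum1dep_card (partition_big g xpredT) //=.
    apply: eq_bigr => k _; apply: eq_bigl => j.
    by rewrite ffunE xpair_eqE.
  under [RHS]eq_bigr do rewrite contentE.
  rewrite -(prod_count_colour (fun q => y q.2)).
  by apply: eq_bigr => i _; rewrite ffunE.
rewrite sum_fixes_content; congr (_ * _).
under [RHS]eq_bigr do rewrite complete_content.
rewrite bigA_distr_big_dep /=.
pose G (c : {ffun 'I_N * 'I_N' -> 'I_n.+1}) := [forall i, (\sum_k c (i, k))%N == m i].
transitivity (\sum_(c | G c) \prod_q y q.2 ^+ c q).
  rewrite [RHS]big_mkcond [LHS]big_mkcond; apply: eq_bigr => c _; rewrite /F -/(G c).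
  case: (boolP (G c)) => [/forallP hG|_]; last by rewrite mul0r if_same.
  rewrite mul1r; case: eqP => // -[]; rewrite -[RHS]hm.
  transitivity (\sum_i \sum_k c (i, k))%N; first by rewrite pair_bigA; apply: eq_bigr => -[].
  by apply: eq_bigr => i _; apply/eqP.
apply: (@big_bij _ _ _ _ _ _ _
  (fun c : {ffun 'I_N * 'I_N' -> 'I_n.+1} => [ffun i => [ffun k => c (i, k)]])
  (fun d : {ffun 'I_N -> {ffun 'I_N' -> 'I_n.+1}} => [ffun q => d q.1 q.2])).
- move=> c /forallP hG; split; last by apply/ffunP=> -[i k]; rewrite !ffunE.
  apply/familyP=> i; rewrite unfold_in -(eqP (hG i)).
  by apply/eqP/eq_bigr => k _; rewrite !ffunE.
- move=> d /familyP hd; split; last by apply/ffunP=> i; apply/ffunP=> k; rewrite !ffunE.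
  apply/forallP=> i; have := hd i; rewrite unfold_in => /eqP <-.
  by apply/eqP/eq_bigr => k _; rewrite !ffunE.
move=> c _; transitivity (\prod_i \prod_k y k ^+ c (i, k)).
  by rewrite pair_bigA; apply: eq_bigr => -[].
by apply: eq_bigr => i _; apply: eq_bigr => k _; rewrite !ffunE.
Qed.

End Ring.
End PowerSum.

Section PermChar.
Variable n : nat.

Definition power_poly N (s : 'S_n) : {mpoly rat[N]} := powersum (fun i => 'X_i) s.

(* The character of the permutation module on the colourings of content m. *)
Definition perm_char N (m : 'X_{1..N}) (s : 'S_n) : rat := (power_poly N s)@_m.

Lemma colour_monomial N (f : {ffun 'I_n -> 'I_N}) (m : 'X_{1..N}) :
  ((\sum_i U_(f i))%MM == m) = [forall k, count_colour f k == m k].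
Proof.
have e k : (\sum_i U_(f i))%MM k = count_colour f k.
  rewrite mnm_sumE /count_colour -sum1dep_card [RHS]big_mkcond.
  by apply: eq_bigr => i _; rewrite mnm1E; case: eqP.
apply/eqP/forallP => [<- k|h]; first by rewrite e.
by apply/mnmP=> k; rewrite e; apply/eqP.
Qed.

Lemma perm_charE N (m : 'X_{1..N}) s : perm_char m s =
  \sum_(f : {ffun 'I_n -> 'I_N} | fixes s f) [forall k, count_colour f k == m k]%:R.
Proof.
rewrite /perm_char /power_poly /powersum raddf_sum; apply: eq_bigr => f _ /=.
by rewrite mprodXE mcoeffX colour_monomial.
Qed.

Lemma sum_perm_char2 N N' (m : 'X_{1..N}) (m' : 'X_{1..N'}) : (0 < n)%N ->
  \sum_s perm_char m s * perm_char m' s =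
  n`!%:R * \sum_(la : intpart n) (schur_poly N la)@_m * (schur_poly N' la)@_m'.
Proof.
move=> n_gt0.
(* The first alphabet consists of variables and the second sits in the coefficient ring, so the
   coefficients of the two monomials can be taken one after the other. *)
pose x (i : 'I_N) : {mpoly {mpoly rat[N']}[N]} := 'X_i;
  pose y (j : 'I_N') : {mpoly {mpoly rat[N']}[N]} := ('X_j)%:MP.
have ex (s : 'S_n) : powersum x s = map_mpoly (@mpolyC N' rat) (power_poly N s).
  rewrite /power_poly /powersum rmorph_sum; apply: eq_bigr => f _.
  by rewrite rmorph_prod; apply: eq_bigr => i _; rewrite /= map_mpolyX.
have ey (s : 'S_n) : powersum y s = (power_poly N' s)%:MP.
  rewrite /power_poly /powersum rmorph_sum; apply: eq_bigr => f _.
  by rewrite rmorph_prod.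
have := sum_powersum2_schur x y n_gt0.
move/(congr1 (fun p : {mpoly {mpoly rat[N']}[N]} => (p@_m)@_m')).
have -> : ((\sum_(s : 'S_n) powersum x s * powersum y s)@_m)@_m' =
  \sum_s perm_char m s * perm_char m' s.
  rewrite !raddf_sum; apply: eq_bigr => s _ /=.
  by rewrite ex ey mulrC mcoeffCM mcoeff_map_mpoly mulrC /= mcoeffCM.
move->; rewrite -mpolyC_nat mcoeffCM -mpolyC_nat mcoeffCM !raddf_sum; congr (_ * _).
apply: eq_bigr => la _ /=.
have -> : \sum_(T : {ffun cell la -> 'I_N} | is_semistandard T) \prod_c x (T c)
    = map_mpoly (@mpolyC N' rat) (schur_poly N la).
  rewrite /schur_poly rmorph_sum; apply: eq_bigr => f _.
  by rewrite rmorph_prod; apply: eq_bigr => i _; rewrite /= map_mpolyX.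
have -> : \sum_(T : {ffun cell la -> 'I_N'} | is_semistandard T) \prod_c y (T c)
    = (schur_poly N' la)%:MP.
  rewrite /schur_poly rmorph_sum; apply: eq_bigr => f _.
  by rewrite rmorph_prod.
by rewrite mulrC mcoeffCM mcoeff_map_mpoly mulrC /= mcoeffCM.
Qed.

Lemma complete_polyE N b : (b <= n)%N ->
  complete n b [seq ('X_k : {mpoly rat[N]}) | k <- enum 'I_N] = complete_poly N b.
Proof.
move=> hb; rewrite complete_content /complete_poly.
pose f (c : {ffun 'I_N -> 'I_n.+1}) : 'X_{1..N < b.+1} :=
  insubd bm0 [multinom (c k : nat) | k < N].
pose g (e : 'X_{1..N < b.+1}) : {ffun 'I_N -> 'I_n.+1} := [ffun k => inord (e k)].
have deg (c : {ffun 'I_N -> 'I_n.+1}) :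
    mdeg [multinom (c k : nat) | k < N] = (\sum_k c k)%N.
  by rewrite mdegE; apply: eq_bigr => k _; rewrite mnmE.
have fE (c : {ffun 'I_N -> 'I_n.+1}) : (\sum_k c k)%N == b ->
  f c = [multinom (c k : nat) | k < N] :> 'X_{1..N}.
  by move=> /eqP e; rewrite insubdK // -topredE /= deg e.
apply: (@big_bij _ _ _ _ _ _ _ f g).
- move=> c hc; rewrite fE // deg; split=> //.
  by apply/ffunP=> k; rewrite ffunE fE // mnmE inord_val.
- move=> e /eqP he.
  have le k : (e k < n.+1)%N.
    rewrite ltnS; apply: leq_trans hb; rewrite -[X in (_ <= X)%N]he mdegE (bigD1 k) //=;
      exact: leq_addr.
  have sg : (\sum_k g e k)%N == b.
    by rewrite -[X in _ == X]he mdegE; apply/eqP/eq_bigr => k _; rewrite ffunE inordK.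
  split=> //; apply/val_inj; rewrite /= fE //; apply/mnmP=> k.
  by rewrite mnmE ffunE inordK.
by move=> c hc; rewrite fE // mpolyXE_id; apply: eq_bigr => k _; rewrite mnmE.
Qed.

Lemma sum_perm_char_power N N' (m : 'X_{1..N}) : mdeg m = n ->
  \sum_s perm_char m s *: power_poly N' s =
  n`!%:R *: \prod_i complete_poly N' (m i).
Proof.
move=> hm; have hm' : (\sum_i m i)%N = n by rewrite -[RHS]hm mdegE.
have := sum_count_powersum (fun k : 'I_N' => 'X_k : {mpoly rat[N']}) hm'.
under [X in _ = _ * X -> _]eq_bigr => i _.
  rewrite complete_polyE; last by rewrite -hm' (bigD1 i) //= leq_addr.
  over.
rewrite scaler_nat mulr_natl => <-; apply: eq_bigr => s _.
rewrite perm_charE -mul_mpolyC rmorph_sum; congr (_ * _).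
by apply: eq_bigr => f _; rewrite rmorph_nat.
Qed.

End PermChar.

(** * Specht modules *)

Section Intertwiner.
Variables (F : fieldType) (gT : finGroupType) (d m : nat).
Variables (rho : gT -> 'M[F]_d) (A : gT -> 'M[F]_m).
Hypothesis rhoM : forall g h, rho (g * h)%g = rho g *m rho h.
Hypothesis AM : forall g h, A (g * h)%g = A g *m A h.

(** Averaging makes an intertwiner of any matrix. The trace of this operator on d x m matrices,
    computed on the elementary matrices, is the sum of products of traces wanted. *)
Let avg (X : 'M_(d, m)) := \sum_g rho g^-1%g *m X *m A g.

Let avg_intertwines X h : rho h *m avg X = avg X *m A h.
Proof.
rewrite /avg mulmx_sumr mulmx_suml [RHS](reindex_inj (mulIg h^-1%g)) /=.
apply: eq_bigr => g _.
by rewrite invMg invgK rhoM -!mulmxA -AM mulgKV.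
Qed.

Let trace_avg : \sum_g \tr (rho g^-1%g) * \tr (A g) =
  \sum_i \sum_j avg (delta_mx i j) i j.
Proof.
under [RHS]eq_bigr => i _ do under eq_bigr => j _ do rewrite summxE.
under [RHS]eq_bigr => i _ do rewrite exchange_big.
rewrite exchange_big /=; apply: eq_bigr => g _.
rewrite /mxtrace mulr_suml; apply: eq_bigr => i _; rewrite mulr_sumr; apply: eq_bigr => j _.
rewrite mxE (bigD1 j) //= big1 ?addr0 => [|k kj];
  rewrite mxE (bigD1 i) //= big1 ?addr0 ?mxE ?eqxx ?mulr1 //.
- by move=> l li; rewrite mxE (negPf li) mulr0.
- by rewrite (negPf kj) andbF mulr0 mul0r.
- by move=> l li; rewrite mxE (negPf li) mulr0.
Qed.

Lemma trace_intertwiner0 :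
  (forall Y : 'M_(d, m), (forall g, rho g *m Y = Y *m A g) -> Y = 0) ->
  \sum_g \tr (rho g^-1%g) * \tr (A g) = 0.
Proof.
move=> h; rewrite trace_avg big1 // => i _; rewrite big1 // => j _.
rewrite (h (avg (delta_mx i j))) ?mxE // => g; exact: avg_intertwines.
Qed.

(** Every average is a multiple of J, so the trace of the averaging operator is the scalar by which
    it acts on J; as J is itself an intertwiner, that scalar is the order of the group. *)
Lemma trace_intertwiner1 (J : 'M_(d, m)) : J != 0 -> rho 1%g = 1%:M ->
  (forall g, rho g *m J = J *m A g) ->
  (forall Y : 'M_(d, m), (forall g, rho g *m Y = Y *m A g) -> exists c, Y = c *: J) ->
  \sum_g \tr (rho g^-1%g) * \tr (A g) = #|gT|%:R.
Proof.
move=> J0 rho1 hJ hY.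
have /fin_all_exists[c hc] (ij : 'I_d * 'I_m) : exists c, avg (delta_mx ij.1 ij.2) = c *: J.
  by apply: hY => g; exact: avg_intertwines.
have -> : \sum_g \tr (rho g^-1%g) * \tr (A g) = \sum_ij c ij * J ij.1 ij.2.
  rewrite trace_avg pair_bigA; apply: eq_bigr => ij _.
  by rewrite hc mxE.
have e1 : avg J = #|gT|%:R *: J.
  rewrite /avg (eq_bigr (fun=> J)) => [|g _]; first by rewrite sumr_const scaler_nat.
  by rewrite -mulmxA -hJ mulmxA -rhoM mulVg rho1 mul1mx.
have e2 : avg J = (\sum_ij c ij * J ij.1 ij.2) *: J.
  have lin (a : 'I_d * 'I_m -> F) : avg (\sum_ij a ij *: delta_mx ij.1 ij.2) =
      \sum_ij a ij *: avg (delta_mx ij.1 ij.2).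
    under [RHS]eq_bigr => ij _ do rewrite scaler_sumr.
    rewrite exchange_big /=; apply: eq_bigr => g _.
    rewrite mulmx_sumr mulmx_suml; apply: eq_bigr => ij _.
    by rewrite -scalemxAr -scalemxAl.
  have -> : avg J = avg (\sum_ij J ij.1 ij.2 *: delta_mx ij.1 ij.2).
    by congr avg; rewrite {1}[J]matrix_sum_delta pair_bigA.
  rewrite (lin (fun ij => J ij.1 ij.2)) scaler_suml; apply: eq_bigr => ij _.
  by rewrite hc scalerA mulrC.
have /eqP : (\sum_ij c ij * J ij.1 ij.2 - #|gT|%:R) *: J = 0.
  by rewrite scalerBl -e1 -e2 subrr.
by rewrite scaler_eq0 (negPf J0) orbF subr_eq0 => /eqP.
Qed.

End Intertwiner.

(** * Matrices of maps between basis vectors *)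

Section FunctionMatrix.
Variables (F : fieldType).

Definition delta_row (T : finType) (x : T) : 'rV[F]_#|T| := delta_mx 0 (enum_rank x).

(** Basis vectors outside [P] go to 0. A permutation module spanned by part of the basis thus stays
    inside the full space, where the identity of the group acts as a projection. *)
Definition fun_mx (T : finType) (P : pred T) (f : T -> T) : 'M[F]_#|T| :=
  \matrix_(i, j) (P (enum_val i) && (f (enum_val i) == enum_val j))%:R.

Lemma delta_row_fun_mx (T : finType) (P : pred T) f (x : T) :
  delta_row x *m fun_mx P f = (P x)%:R *: delta_row (f x).
Proof.
rewrite -rowE; apply/rowP=> j; rewrite !mxE eqxx enum_rankK /=.
case: (P x); rewrite ?mul0r //= mul1r; congr (_%:R); congr (nat_of_bool _).
by apply/eqP/eqP => [->|->]; rewrite ?enum_valK ?enum_rankK.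
Qed.

Lemma delta_row_mxP (T : finType) m (X Y : 'M[F]_(#|T|, m)) :
  (forall x : T, delta_row x *m X = delta_row x *m Y) -> X = Y.
Proof. by move=> h; apply/row_matrixP=> i; rewrite !rowE; have := h (enum_val i);
  rewrite /delta_row enum_valK. Qed.

Lemma fun_mxM (T : finType) (P : pred T) f g :
  (forall x, P (f x) = P x) -> fun_mx P f *m fun_mx P g = fun_mx P (g \o f).
Proof.
move=> h; apply: delta_row_mxP => x; rewrite mulmxA !delta_row_fun_mx.
rewrite -scalemxAl delta_row_fun_mx scalerA h /=.
by case: (P x); rewrite ?mulr1 ?mul0r.
Qed.

Lemma trace_fun_mx (T : finType) (P : pred T) f :
  \tr (fun_mx P f) = \sum_(x | f x == x) (P x)%:R.
Proof.
rewrite /mxtrace (reindex_onto enum_rank enum_val) => [|i _]; last by rewrite enum_valK.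
rewrite [RHS]big_mkcond; apply: eq_big => [x|x _]; first by rewrite enum_rankK eqxx.
by rewrite mxE enum_rankK; case: eqP => // _; rewrite ?andbT ?andbF.
Qed.

Lemma row_fun_mx (T : finType) (P : pred T) f g (y : 'rV[F]_#|T|) (x : T) :
  cancel g f -> cancel f g ->
  (y *m fun_mx P f) 0 (enum_rank x) = (P (g x))%:R * y 0 (enum_rank (g x)).
Proof.
move=> fK gK; rewrite mxE (bigD1 (enum_rank (g x))) //= big1 ?addr0 => [|i hi].
  by rewrite mxE !enum_rankK fK eqxx andbT mulrC.
rewrite mxE enum_rankK; case: eqP => [e|]; last by rewrite andbF mulr0.
by case/eqP: hi; rewrite -e gK enum_valK.
Qed.

End FunctionMatrix.

(** * Fillings, row colourings and dominance *)

Section Filling.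
Variable n : nat.
Implicit Types (f : {ffun 'I_n -> 'I_n}) (s p g : 'S_n) (la al : intpart n).

Definition col_act s f : {ffun 'I_n -> 'I_n} := [ffun v => f (s^-1%g v)].
Definition has_content al f := [forall r, count_colour f r == tnth (val al) r].
(** A tabloid, recorded by its rows, amounts to the colouring that gives each entry its row. This
    relates the colouring model of M^la to the space in which [specht] lives. *)
Definition colour_classes f : {ffun 'I_n -> {set 'I_n}} := [ffun r => [set v | f v == r]].

Lemma colour_classes_inj : injective colour_classes.
Proof.
move=> f f' /ffunP e; apply/ffunP=> v; have /setP/(_ v) := e (f' v).
by rewrite !ffunE !inE eqxx => /eqP.
Qed.

Lemma tabloid_perm_classes s f :
  tabloid_perm s (colour_classes f) = colour_classes (col_act s f).
Proof.
apply/ffunP=> r; rewrite !ffunE; apply/setP=> v; rewrite inE ffunE.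
apply/imsetP/eqP => [[w]|e]; first by rewrite inE => /eqP <- ->; rewrite permK.
by exists (s^-1%g v); rewrite ?inE ?e // permKV.
Qed.

Lemma col_actM s p f : col_act (s * p)%g f = col_act p (col_act s f).
Proof. by apply/ffunP=> v; rewrite !ffunE invMg permM. Qed.

Lemma col_act1 f : col_act 1%g f = f.
Proof. by apply/ffunP=> v; rewrite !ffunE invg1 perm1. Qed.

Lemma col_actK s : cancel (col_act s) (col_act s^-1%g).
Proof. by move=> f; rewrite -col_actM mulgV col_act1. Qed.

Lemma col_actKV s : cancel (col_act s^-1%g) (col_act s).
Proof. by move=> f; rewrite -col_actM mulVg col_act1. Qed.

Lemma has_content_act al s f : has_content al (col_act s f) = has_content al f.
Proof. by apply: eq_forallb => r; rewrite count_colour_perm. Qed.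

Lemma tnth_part_antitone la (r r' : 'I_n) : (r <= r')%N -> (tnth (val la) r' <= tnth (val la) r)%N.
Proof.
rewrite -!rowlen_part_tnth => /subnKC <-; elim: (r' - r)%N => [|k IH].
  by rewrite addn0.
by apply: leq_trans IH; rewrite addnS; exact/antitoneP/part_antitone.
Qed.

Lemma sum_tnth_part la : (\sum_(r < n) tnth (val la) r)%N = n.
Proof.
have := ssize_part la; rewrite ssizeE big_mkord big_ord_recr /= [rowlen _ n]rowlen_part
  nth_default ?size_map ?size_tuple //.
by rewrite addn0 => e; rewrite -[RHS]e; apply: eq_bigr => r _; rewrite rowlen_part_tnth.
Qed.

Lemma card_cell la : #|{: cell la}| = n.
Proof.
rewrite card_sig -sum1_card -[RHS](sum_tnth_part la).
rewrite -(pair_big_dep xpredT (fun r c : 'I_n => c < tnth (val la) r)%N (fun _ _ => 1%N)) /=.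
apply: eq_bigr => r _; rewrite sum1dep_card card_ord_ltn //.
rewrite -rowlen_part_tnth -[X in (_ <= X)%N](ssize_part la); exact: rowlen_le_size.
Qed.

Definition mkcell la (r c : 'I_n) (h : (c < tnth (val la) r)%N) : cell la :=
  exist (fun c : 'I_n * 'I_n => c.2 < tnth (val la) c.1)%N (r, c) h.

Lemma filling_bij la (T : {ffun cell la -> 'I_n}) : injectiveb T ->
  exists2 tinv, cancel T tinv & cancel tinv T.
Proof.
move=> /injectiveP h; have [] := inj_card_bij h; first by rewrite card_cell card_ord.
by move=> tinv; exists tinv.
Qed.

Lemma exists_filling la : exists T : {ffun cell la -> 'I_n}, injectiveb T.
Proof.
exists [ffun k => cast_ord (card_cell la) (enum_rank k)]; apply/injectiveP => k k'.
by rewrite !ffunE => /cast_ord_inj/enum_rank_inj.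
Qed.

Section Bijective.
Variables (la : intpart n) (T : {ffun cell la -> 'I_n}) (tinv : 'I_n -> cell la).
Hypotheses (TK : cancel T tinv) (KT : cancel tinv T).

Definition frow v : 'I_n := (val (tinv v)).1.
Definition fcol v : 'I_n := (val (tinv v)).2.
Definition row_colouring : {ffun 'I_n -> 'I_n} := [ffun v => frow v].

Lemma frow_fcol_inj v w : frow v = frow w -> fcol v = fcol w -> v = w.
Proof.
move=> e1 e2; apply: (can_inj KT); apply: val_inj.
by rewrite [val (tinv v)]surjective_pairing -/(frow v) -/(fcol v) e1 e2 -surjective_pairing.
Qed.

Lemma mkcellE r c h : frow (T (@mkcell la r c h)) = r /\ fcol (T (@mkcell la r c h)) = c.
Proof. by rewrite /frow /fcol TK. Qed.

Lemma fcol_lt v : (fcol v < tnth (val la) (frow v))%N.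
Proof. exact: (valP (tinv v)). Qed.

Lemma mem_column_stabilizer p :
  reflect (forall v, fcol (p v) = fcol v) (p \in column_stabilizer T).
Proof.
rewrite inE; apply: (iffP forallP) => h.
  move=> v; have /forallP/(_ (tinv (p v)))/implyP := h (tinv v).
  by rewrite !KT eqxx => /(_ isT)/eqP.
move=> k; apply/forallP=> k'; apply/implyP=> /eqP e.
by have := h (T k); rewrite e /fcol !TK => ->.
Qed.

Lemma tabloid_colouring g :
  tabloid [ffun k => g (T k)] = colour_classes (col_act g row_colouring).
Proof.
apply/ffunP=> r; rewrite !ffunE; apply/setP=> v; rewrite inE !ffunE.
apply/imsetP/eqP => [[k]|e].
  by rewrite inE => /eqP <- ->; rewrite ffunE permK /frow TK.
by exists (tinv (g^-1%g v)); rewrite ?inE -?e //= ffunE KT permKV.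
Qed.

Lemma polytabloidE : polytabloid T = \sum_(p in column_stabilizer T)
   (-1) ^+ odd_perm p *: delta_row rat (colour_classes (col_act p row_colouring)).
Proof. by apply: eq_bigr => p _; rewrite tabloid_colouring. Qed.

Lemma row_colouring_content : has_content la row_colouring.
Proof.
apply/forallP=> r; apply/eqP; rewrite /count_colour.
have lt : (tnth (val la) r <= n)%N.
  by rewrite -rowlen_part_tnth -[X in (_ <= X)%N](ssize_part la); exact: rowlen_le_size.
rewrite -[RHS](card_ord_ltn lt) -(card_in_imset (f := fcol)).
  apply: eq_card => c; rewrite inE; apply/imsetP/idP => [[v]|h].
    by rewrite inE ffunE => /eqP <- ->; exact: fcol_lt.
  have [e1 e2] := mkcellE h; exists (T (mkcell h)) => //.
  by rewrite inE ffunE e1.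
move=> v w; rewrite !inE !ffunE => /eqP e1 /eqP e2.
by apply: frow_fcol_inj; rewrite e1 e2.
Qed.

Section ColumnInjective.
Variable f : {ffun 'I_n -> 'I_n}.
Hypothesis finj : forall v w, fcol v = fcol w -> f v = f w -> v = w.

(** If column c reaches row i, it has a cell in each of the first i rows, and an injective f takes
    at most i values below i. Otherwise the whole column lies above row i and the right side counts
    all of it. *)
Lemma column_count (i : nat) (c : 'I_n) :
  (#|[set v | (fcol v == c) && (f v < i)]| <= #|[set v | (fcol v == c) && (frow v < i)]|)%N.
Proof.
have [/existsP[v0 /andP[/eqP ec hi]]|hall] := boolP [exists v, (fcol v == c) && (i <= frow v)%N].
  have hin : (i <= n)%N by apply: leq_trans hi _; exact: ltnW.
  apply: (@leq_trans i).
    rewrite -[X in (_ <= X)%N](card_ord_ltn hin) -(card_in_imset (f := f)) => [|v w].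
      by apply: subset_leq_card; apply/subsetP=> k /imsetP[v]; rewrite !inE => /andP[_ h] ->.
    by rewrite !inE => /andP[/eqP e1 _] /andP[/eqP e2 _]; apply: finj; rewrite e1 e2.
  rewrite -[X in (X <= _)%N](card_ord_ltn hin).
  rewrite -[X in (_ <= X)%N](card_in_imset (f := frow)) => [|v w].
    apply: subset_leq_card; apply/subsetP=> r; rewrite inE => hr.
    have hk : (c < tnth (val la) r)%N.
      rewrite -ec; apply: leq_trans (fcol_lt v0) (tnth_part_antitone _ _).
      by apply: leq_trans hi; exact: ltnW.
    have [e1 e2] := mkcellE hk; apply/imsetP; exists (T (mkcell hk)) => //.
    by rewrite inE e1 e2 eqxx.
  by rewrite !inE => /andP[/eqP e1 _] /andP[/eqP e2 _] e; apply: frow_fcol_inj; rewrite ?e1 ?e2.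
apply: subset_leq_card; apply/subsetP=> v; rewrite !inE => /andP[ec _]; rewrite ec /=.
by move: hall; rewrite negb_exists => /forallP/(_ v); rewrite ec /= -ltnNge.
Qed.

Lemma sum_column_count (h : 'I_n -> 'I_n) i :
  #|[set v | h v < i]%N| = (\sum_c #|[set v | (fcol v == c) && (h v < i)%N]|)%N.
Proof.
rewrite -sum1dep_card (partition_big fcol xpredT) //=; apply: eq_bigr => c _.
by rewrite sum1dep_card; apply: eq_card => v; rewrite !inE andbC.
Qed.

Lemma column_injective_count i : (#|[set v | f v < i]%N| <= #|[set v | frow v < i]%N|)%N.
Proof.
rewrite (sum_column_count f) (sum_column_count frow).
by apply: leq_sum => c _; exact: column_count.
Qed.

(** Equality of the totals forces equality in each column. Then every entry v may move, within its
    column, to the row [f v], and this motion is the permutation q. *)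
Lemma column_injective_sort :
  (forall i, #|[set v | f v < i]%N| = #|[set v | frow v < i]%N|) ->
  exists2 q, q \in column_stabilizer T & f = col_act q^-1%g row_colouring.
Proof.
move=> eqc.
have eqcol i c : #|[set v | (fcol v == c) && (f v < i)%N]| =
  #|[set v | (fcol v == c) && (frow v < i)%N]|.
  apply/eqP; have := eqc i; rewrite (sum_column_count f) (sum_column_count frow) => /eqP.
  have := @leqif_sum _ xpredT _ _ _ (fun c _ => leqif_eq (column_count i c)).
  by move=> [_ ->] /forallP/(_ c).
(* If the column of v had no row [f v], all its entries would stand in earlier rows, whereas v
   itself is missing from the entries of colour below [f v]. *)
have hcell v : (fcol v < tnth (val la) (f v))%N.
  rewrite ltnNge; apply/negP => hv; have := eqcol (f v) (fcol v).
  have -> : [set w | (fcol w == fcol v) && (frow w < f v)%N] = [set w | fcol w == fcol v].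
    apply/setP=> w; rewrite !inE; apply: andb_idr => /eqP ew; rewrite ltnNge; apply/negP => hw.
    by have := leq_trans (fcol_lt w) (tnth_part_antitone la hw); rewrite ew ltnNge hv.
  apply/eqP; rewrite neq_ltn; apply/orP; left; apply: proper_card; apply/properP; split.
    by apply/subsetP=> w; rewrite !inE => /andP[].
  by exists v; rewrite !inE ?eqxx // ltnn.
pose q0 v := T (mkcell (hcell v)).
have q0E v : frow (q0 v) = f v /\ fcol (q0 v) = fcol v by exact: mkcellE.
have q0inj : injective q0.
  move=> v w e; have [e1 e2] := q0E v; have [e3 e4] := q0E w.
  by apply: finj; rewrite -?e2 -?e1 e.
exists (perm q0inj).
  by apply/mem_column_stabilizer => v; rewrite permE; case: (q0E v).
by apply/ffunP=> v; rewrite !ffunE invgK permE; case: (q0E v).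
Qed.

End ColumnInjective.
End Bijective.
End Filling.

(** * Specht modules and their equivariant maps to permutation modules *)

Section SpechtRep.
Variables (n : nat) (la : intpart n).
Implicit Types (s p g : 'S_n) (al : intpart n) (T : {ffun cell la -> 'I_n}).
Local Notation W := {ffun 'I_n -> {set 'I_n}}.
Local Notation E := {ffun 'I_n -> 'I_n}.

Definition perm_filling g T : {ffun cell la -> 'I_n} := [ffun k => g (T k)].

Lemma tabloid_actE s : tabloid_act s = fun_mx rat xpredT (tabloid_perm s).
Proof. by apply/matrixP=> i j; rewrite !mxE. Qed.

Lemma tabloid_permM s p (R : W) : tabloid_perm (s * p)%g R = tabloid_perm p (tabloid_perm s R).
Proof.
apply/ffunP=> r; rewrite !ffunE -imset_comp; apply: eq_imset => v /=.
by rewrite permM.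
Qed.

Lemma tabloid_actM s p : tabloid_act (s * p)%g = tabloid_act s *m tabloid_act p.
Proof.
rewrite !tabloid_actE fun_mxM //; apply/matrixP=> i j; rewrite !mxE /=.
by rewrite tabloid_permM.
Qed.

Lemma tabloid_act1 : tabloid_act 1%g = 1%:M :> 'M_#|{: W}|.
Proof.
apply: (@delta_row_mxP _ {: W}) => R; rewrite tabloid_actE delta_row_fun_mx scale1r mulmx1.
by congr delta_row; apply/ffunP=> r; rewrite ffunE -[RHS]imset_id; apply: eq_imset => v;
  rewrite perm1.
Qed.

Lemma perm_fillingK T tinv g : cancel T tinv -> cancel tinv T ->
  cancel (perm_filling g T) (fun v => tinv (g^-1%g v)) /\
  cancel (fun v => tinv (g^-1%g v)) (perm_filling g T).
Proof. by move=> TK KT; split=> [k|v]; rewrite ffunE ?permK ?TK // KT permKV. Qed.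

Lemma perm_filling_inj T g : injectiveb T -> injectiveb (perm_filling g T).
Proof. by move=> /injectiveP h; apply/injectiveP => k k'; rewrite !ffunE => /perm_inj/h. Qed.

Lemma polytabloid_act T g : injectiveb T ->
  polytabloid T *m tabloid_act g = polytabloid (perm_filling g T).
Proof.
move=> hT; have [tinv TK KT] := filling_bij hT.
have [TK' KT'] := perm_fillingK g TK KT.
rewrite (polytabloidE TK KT) (polytabloidE TK' KT') mulmx_suml tabloid_actE.
rewrite [RHS](reindex_inj (conjg_inj g)) /=; apply: eq_big => [p|p _].
  apply/(mem_column_stabilizer TK KT)/(mem_column_stabilizer TK' KT') => h v.
    by rewrite /fcol conjgE !permM permK -/(fcol tinv _) h.
  by have := h (g v); rewrite /fcol conjgE !permM !permK.
rewrite -scalemxAl delta_row_fun_mx scale1r odd_permJ; congr (_ *: delta_row _ _).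
rewrite tabloid_perm_classes; congr colour_classes; rewrite -col_actM.
by apply/ffunP=> v; rewrite !ffunE /frow conjgE !invMg invgK !permM permK.
Qed.

Lemma polytabloid_sign T p : injectiveb T -> p \in column_stabilizer T ->
  polytabloid T *m tabloid_act p = (-1) ^+ odd_perm p *: polytabloid T.
Proof.
move=> hT; have [tinv TK KT] := filling_bij hT => /(mem_column_stabilizer TK KT) hp.
rewrite (polytabloidE TK KT) mulmx_suml tabloid_actE scaler_sumr.
rewrite [RHS](reindex_inj (mulIg p)) /=; apply: eq_big => [q|q _].
  apply/(mem_column_stabilizer TK KT)/(mem_column_stabilizer TK KT) => h v.
    by rewrite permM hp h.
  by have := h v; rewrite permM hp.
rewrite -scalemxAl delta_row_fun_mx scale1r scalerA odd_permM; congr (_ *: delta_row _ _).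
  by rewrite signr_addb mulrCA -signr_addb addbb mulr1.
by rewrite tabloid_perm_classes -col_actM.
Qed.

Local Notation B := (row_base (specht la)).
Definition specht_mx s : 'M_(\rank (specht la)) := restrictmx (specht la) (tabloid_act s).

Lemma polytabloid_sub T : injectiveb T -> (polytabloid T <= specht la)%MS.
Proof.
move=> hT; rewrite /specht; apply: submx_trans (sumsmx_sup T hT (submx_refl _)).
by rewrite genmxE.
Qed.

Lemma specht_stable s : stablemx (specht la) (tabloid_act s).
Proof.
rewrite {1}/specht sumsmxMr; apply/sumsmx_subP => T hT.
rewrite (eqmxMr _ (genmxE _)).
by rewrite polytabloid_act // polytabloid_sub // perm_filling_inj.
Qed.

Lemma base_stable s : stablemx B (tabloid_act s).
Proof. by have := specht_stable s; rewrite (eqmxMr _ (eq_row_base _)) eq_row_base. Qed.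

Lemma specht_mxB s : specht_mx s *m B = B *m tabloid_act s.
Proof. by rewrite /specht_mx /conjmx mulmxKpV //; exact: base_stable. Qed.

Lemma specht_mxM s p : specht_mx (s * p)%g = specht_mx s *m specht_mx p.
Proof. by rewrite /specht_mx tabloid_actM conjmxM // inE; exact: base_stable. Qed.

Lemma specht_mx1 : specht_mx 1%g = 1%:M.
Proof. by rewrite /specht_mx tabloid_act1 conjmx_scalar // row_base_free. Qed.

Definition spoly T : 'rV_(\rank (specht la)) := polytabloid T *m pinvmx B.

Lemma spolyB T : injectiveb T -> spoly T *m B = polytabloid T.
Proof. by move=> hT; rewrite /spoly mulmxKpV // eq_row_base polytabloid_sub. Qed.

Lemma spoly_act T g : injectiveb T -> spoly T *m specht_mx g = spoly (perm_filling g T).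
Proof.
move=> hT; rewrite /specht_mx /conjmx (mulmxA (spoly T) _ (pinvmx B)) (mulmxA (spoly T) B)
  spolyB // /spoly.
by rewrite polytabloid_act.
Qed.

Lemma spoly_sign T p : injectiveb T -> p \in column_stabilizer T ->
  spoly T *m specht_mx p = (-1) ^+ odd_perm p *: spoly T.
Proof.
move=> hT hp; rewrite /specht_mx /conjmx (mulmxA (spoly T) _ (pinvmx B)) (mulmxA (spoly T) B)
  spolyB // /spoly.
by rewrite polytabloid_sign // scalemxAl.
Qed.

Lemma spoly_eq m (X Y : 'M_(\rank (specht la), m)) :
  (forall T, injectiveb T -> spoly T *m X = spoly T *m Y) -> X = Y.
Proof.
move=> h; apply/eqP; rewrite -subr_eq0; apply/eqP; set D := X - Y.
have hD : (specht la <= kermx (pinvmx B *m D))%MS.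
  rewrite /specht; apply/sumsmx_subP => T hT; rewrite genmxE; apply/sub_kermxP.
  by rewrite mulmxA -/(spoly T) mulmxBr h // subrr.
have : (B <= kermx (pinvmx B *m D))%MS by rewrite eq_row_base.
by move/sub_kermxP; rewrite mulmxA mulmxVp ?row_base_free // mul1mx.
Qed.

Definition colour_mx al s : 'M[rat]_#|{: E}| := fun_mx rat (has_content al) (col_act s).

Lemma colour_mxM al s p : colour_mx al (s * p)%g = colour_mx al s *m colour_mx al p.
Proof.
rewrite /colour_mx fun_mxM => [|f]; last exact: has_content_act.
by apply/matrixP=> i j; rewrite !mxE /= col_actM.
Qed.

Section Equivariant.
Variables (al : intpart n) (Y : 'M[rat]_(\rank (specht la), #|{: E}|)).
Hypothesis hY : forall g, specht_mx g *m Y = Y *m colour_mx al g.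

Let y T (f : E) : rat := (spoly T *m Y) 0 (enum_rank f).

Let y_act T g f : injectiveb T ->
  y (perm_filling g T) f = (has_content al f)%:R * y T (col_act g^-1%g f).
Proof.
move=> hT; rewrite /y -spoly_act // -mulmxA hY mulmxA.
rewrite (row_fun_mx _ _ _ (@col_actKV n g) (@col_actK n g)).
by rewrite has_content_act.
Qed.

Let y_sign T p f : injectiveb T -> p \in column_stabilizer T ->
  (-1) ^+ odd_perm p * y T f = (has_content al f)%:R * y T (col_act p^-1%g f).
Proof.
move=> hT hp; rewrite -y_act // /y -spoly_act // spoly_sign //.
by rewrite -scalemxAl [RHS]mxE.
Qed.

(** The identity of the group acts on the target as the projection onto the colourings of content
    [al], so the image of an equivariant map is supported there. *)
Lemma equivariant_content T f : injectiveb T -> ~~ has_content al f -> y T f = 0.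
Proof.
move=> hT /negPf hf; have := @y_sign T 1%g f hT; rewrite hf mul0r odd_perm1 mul1r.
by apply; rewrite inE; apply/forallP=> k; apply/forallP=> k'; rewrite perm1;
  apply/implyP => /eqP/(injectiveP _ hT) ->.
Qed.

(* The transposition of two entries of a column with the same colour fixes f and changes the
   sign of the polytabloid. *)
Lemma equivariant_column T tinv f : injectiveb T -> cancel T tinv -> cancel tinv T -> y T f != 0 ->
  forall v w, fcol tinv v = fcol tinv w -> f v = f w -> v = w.
Proof.
move=> hT TK KT y0 v w ec ef; apply/eqP/contraT => vw.
have hc : has_content al f by apply: contraNT y0 => h; rewrite equivariant_content.
have hp : tperm v w \in column_stabilizer T.
  apply/(mem_column_stabilizer TK KT) => x.
  by case: tpermP => [->|->|//]; rewrite ec.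
have := @y_sign T _ f hT hp; rewrite hc mul1r odd_tperm vw.
have -> : col_act (tperm v w)^-1%g f = f.
  by apply/ffunP=> x; rewrite ffunE invgK; case: tpermP => [->|->|//]; rewrite ef.
by rewrite expr1 mulN1r => e; case/eqP: y0; lra.
Qed.

Lemma equivariant_sort T tinv : injectiveb T -> cancel T tinv -> cancel tinv T ->
  forall q, q \in column_stabilizer T -> has_content al (row_colouring tinv) ->
  y T (col_act q^-1%g (row_colouring tinv)) = (-1) ^+ odd_perm q * y T (row_colouring tinv).
Proof. by move=> hT TK KT q hq hc; rewrite y_sign // hc mul1r. Qed.

(** Two bijective fillings differ by a permutation of the entries, which carries the one row
    colouring to the other. *)
Lemma equivariant_const T T' tinv tinv' : injectiveb T -> injectiveb T' ->
  cancel T tinv -> cancel tinv T -> cancel T' tinv' -> cancel tinv' T' ->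
  has_content al (row_colouring tinv) ->
  y T' (row_colouring tinv') = y T (row_colouring tinv).
Proof.
move=> hT hT' TK KT TK' KT' hc.
pose g := perm (can_inj (g := fun v => T (tinv' v)) (fun v => etrans (congr1 T (TK' (tinv v)))
  (KT v))).
have eT : T' = perm_filling g T by apply/ffunP=> k; rewrite ffunE permE TK.
have er : col_act g^-1%g (row_colouring tinv') = row_colouring tinv.
  by apply/ffunP=> v; rewrite !ffunE invgK permE /frow TK'.
by rewrite {1}eT y_act // er -(has_content_act al g^-1%g) er hc mul1r.
Qed.

End Equivariant.

Definition dominates al : bool := [forall i : 'I_n.+1,
  \sum_(r < n | r < i) tnth (val al) r <= \sum_(r < n | r < i) tnth (val la) r]%N.

Lemma count_lt al (f : E) i : has_content al f ->
  #|[set v | f v < i]%N| = (\sum_(r < n | r < i) tnth (val al) r)%N.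
Proof.
move=> /forallP h; rewrite -sum1dep_card (partition_big f (fun r : 'I_n => r < i)%N) //=.
apply: eq_bigr => r hr; rewrite -(eqP (h r)) /count_colour -sum1dep_card.
by apply: eq_bigl => v; apply: andb_idl => /eqP ->.
Qed.

Lemma frow_content T tinv : cancel T tinv -> cancel tinv T ->
  forall i, #|[set v | frow tinv v < i]%N| = (\sum_(r < n | r < i) tnth (val la) r)%N.
Proof.
move=> TK KT i; rewrite -(count_lt _ (row_colouring_content TK KT)).
by apply: eq_card => v; rewrite !inE ffunE.
Qed.

(** A nonzero coefficient at f makes f injective on the columns of T; counting entries of colour
    below i column by column then gives dominance. *)
Lemma sum_specht_perm0 al : ~~ dominates al ->
  \sum_(g : 'S_n) specht_char la g^-1%g * \tr (colour_mx al g) = 0.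
Proof.
move=> nd; apply: (trace_intertwiner0 specht_mxM (colour_mxM al)) => Y hY.
apply: spoly_eq => T hT; rewrite mulmx0; apply/rowP=> j; rewrite [RHS]mxE.
have [tinv TK KT] := filling_bij hT.
rewrite -[j]enum_valK; set f := enum_val j; apply/eqP/contraT => y0; case/negP: nd;
  apply/forallP=> i.
have hc : has_content al f by apply: contraNT y0 => h; rewrite (equivariant_content hY).
rewrite -(count_lt i hc) -(frow_content TK KT); apply: (column_injective_count TK KT).
exact: (equivariant_column hY hT TK KT y0).
Qed.

Definition embed_mx : 'M[rat]_(#|{: W}|, #|{: E}|) :=
  \matrix_(i, j) (has_content la (enum_val j) && (enum_val i == colour_classes (enum_val j)))%:R.

Lemma delta_embed f : delta_row rat (colour_classes f) *m embed_mx =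
  (has_content la f)%:R *: delta_row rat f.
Proof.
rewrite -rowE; apply/rowP=> j; rewrite !mxE eqxx enum_rankK /= (inj_eq (@colour_classes_inj n)).
have -> : (f == enum_val j) = (j == enum_rank f).
  by apply/eqP/eqP => [->|->]; rewrite ?enum_valK ?enum_rankK.
case: eqP => [->|_]; last by rewrite andbF mulr0.
by rewrite enum_rankK andbT mulr1.
Qed.

Lemma delta_embedT f : delta_row rat f *m embed_mx^T =
  (has_content la f)%:R *: delta_row rat (colour_classes f).
Proof.
rewrite -rowE; apply/rowP=> j; rewrite !mxE eqxx enum_rankK /=.
have -> : (enum_val j == colour_classes f) = (j == enum_rank (colour_classes f)).
  by apply/eqP/eqP => [<-|->]; rewrite ?enum_valK ?enum_rankK.
by case: (has_content la f); case: eqP; rewrite ?mulr0 ?mulr1.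
Qed.

Lemma polytabloid_embed T tinv : cancel T tinv -> cancel tinv T ->
  polytabloid T *m embed_mx =
  \sum_(p in column_stabilizer T) (-1) ^+ odd_perm p *: delta_row rat (col_act p (row_colouring
    tinv)).
Proof.
move=> TK KT; rewrite (polytabloidE TK KT) mulmx_suml; apply: eq_bigr => p _.
rewrite -scalemxAl delta_embed has_content_act (row_colouring_content TK KT).
by rewrite scale1r.
Qed.

Lemma polytabloid_embedK T : injectiveb T ->
  polytabloid T *m embed_mx *m embed_mx^T = polytabloid T.
Proof.
move=> hT; have [tinv TK KT] := filling_bij hT.
rewrite (polytabloid_embed TK KT) (polytabloidE TK KT) mulmx_suml; apply: eq_bigr => p _.
rewrite -scalemxAl delta_embedT has_content_act (row_colouring_content TK KT).
by rewrite scale1r.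
Qed.

Definition inclusion_mx := B *m embed_mx.

Lemma spoly_inclusion T : injectiveb T -> spoly T *m inclusion_mx = polytabloid T *m embed_mx.
Proof. by move=> hT; rewrite mulmxA spolyB. Qed.

Lemma inclusion_mxK : inclusion_mx *m embed_mx^T = B.
Proof.
apply: spoly_eq => T hT; rewrite mulmxA spoly_inclusion // polytabloid_embedK //.
by rewrite spolyB.
Qed.

Lemma inclusion_equivariant g : specht_mx g *m inclusion_mx = inclusion_mx *m colour_mx la g.
Proof.
apply: spoly_eq => T hT; rewrite (mulmxA (spoly T) (specht_mx g)) (mulmxA (spoly T)
  inclusion_mx) spoly_act // !spoly_inclusion //; last exact: perm_filling_inj.
rewrite -polytabloid_act //; have [tinv TK KT] := filling_bij hT.
rewrite (polytabloidE TK KT) !mulmx_suml tabloid_actE; apply: eq_bigr => p _.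
rewrite -!scalemxAl; congr (_ *: _).
rewrite delta_row_fun_mx scale1r tabloid_perm_classes !delta_embed -scalemxAl delta_row_fun_mx.
by rewrite !has_content_act (row_colouring_content TK KT) !scale1r.
Qed.

(** Only the identity preserves both the columns and the row colouring, so a single term of the
    polytabloid contributes. *)
Lemma inclusion_peak T tinv : injectiveb T -> cancel T tinv -> cancel tinv T ->
  (spoly T *m inclusion_mx) 0 (enum_rank (row_colouring tinv)) = 1.
Proof.
move=> hT TK KT; rewrite spoly_inclusion // (polytabloid_embed TK KT) summxE.
have h1 : 1%g \in column_stabilizer T by apply/(mem_column_stabilizer TK KT) => v; rewrite perm1.
rewrite (bigD1 1%g) //= big1 ?addr0 => [|p /andP[/(mem_column_stabilizer TK KT) hp p1]].
  by rewrite !mxE odd_perm1 expr0 mul1r col_act1 !eqxx.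
rewrite !mxE eqxx /=; case: eqP => [/enum_rank_inj e|_]; last by rewrite mulr0.
case/eqP: p1; apply/permP=> v; rewrite perm1; apply: (frow_fcol_inj KT); last exact: hp.
by have /ffunP/(_ (p v)) := e; rewrite !ffunE permK.
Qed.

(** By antisymmetry the image of a polytabloid lives on colourings injective on columns. Those of
    content [la] are column rearrangements of the row colouring, so its coefficient, the same for
    every T, determines the map; for the inclusion this coefficient is 1. *)
Lemma equivariant_scalar (Y : 'M_(\rank (specht la), #|{: E}|)) :
  (forall g, specht_mx g *m Y = Y *m colour_mx la g) -> exists c, Y = c *: inclusion_mx.
Proof.
move=> hY; have hJ := inclusion_equivariant.
have [T0 hT0] := exists_filling la; have [t0 TK0 KT0] := filling_bij hT0.
exists ((spoly T0 *m Y) 0 (enum_rank (row_colouring t0))).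
apply: spoly_eq => T hT; apply/rowP=> j; rewrite -[j]enum_valK; set f := enum_val j.
have [tinv TK KT] := filling_bij hT.
rewrite (equivariant_const hY hT hT0 TK KT TK0 KT0 (row_colouring_content TK KT)).
rewrite -scalemxAr [RHS]mxE.
have [hc|hc] := boolP (has_content la f); last first.
  by rewrite (equivariant_content hY) // (equivariant_content hJ) // mulr0.
have [/forallP hinj|hinj] := boolP [forall v, forall w,
    (fcol tinv v == fcol tinv w) && (f v == f w) ==> (v == w)].
  have finj v w : fcol tinv v = fcol tinv w -> f v = f w -> v = w.
    move=> e1 e2; have /forallP/(_ w)/implyP := hinj v.
    by rewrite e1 e2 !eqxx => /(_ isT)/eqP.
  have [i|q hq ->] := column_injective_sort TK KT finj.
    by rewrite (frow_content TK KT) (count_lt _ hc).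
  have rc := row_colouring_content TK KT.
  rewrite (equivariant_sort hY hT TK KT hq rc) (equivariant_sort hJ hT TK KT hq rc).
  by rewrite (inclusion_peak hT TK KT) mulr1 mulrC.
have z X : (forall g, specht_mx g *m X = X *m colour_mx la g) -> (spoly T *m X) 0 (enum_rank f) = 0.
  move=> hX; apply/eqP/contraT => y0; case/negP: hinj.
  apply/forallP=> v; apply/forallP=> w; apply/implyP=> /andP[/eqP e1 /eqP e2]; apply/eqP.
  exact: (equivariant_column hX hT TK KT y0).
by rewrite !z // mulr0.
Qed.

Lemma inclusion_neq0 : inclusion_mx != 0.
Proof.
have [T hT] := exists_filling la; have [tinv TK KT] := filling_bij hT.
apply/eqP => e; have := inclusion_peak hT TK KT.
by rewrite e mulmx0 mxE => /eqP; rewrite eq_sym oner_eq0.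
Qed.

Lemma sum_specht_perm1 :
  \sum_(g : 'S_n) specht_char la g^-1%g * \tr (colour_mx la g) = n`!%:R.
Proof.
rewrite -card_Sn; apply: (trace_intertwiner1 specht_mxM (colour_mxM la) inclusion_neq0).
- exact: specht_mx1.
- exact: inclusion_equivariant.
- exact: equivariant_scalar.
Qed.

(** The inclusion into M^la can be cancelled on the right, so an endomorphism of S^la is a scalar as
    soon as its composite with the inclusion is a multiple of the inclusion. *)
Lemma sum_specht_specht :
  \sum_(g : 'S_n) specht_char la g^-1%g * specht_char la g = n`!%:R.
Proof.
rewrite -card_Sn; apply: (trace_intertwiner1 (J := 1%:M) specht_mxM specht_mxM) => [||g|Y hY].
- apply: contraNneq inclusion_neq0 => e; rewrite -[inclusion_mx]mul1mx e mul0mx //.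
- exact: specht_mx1.
- by rewrite mulmx1 mul1mx.
have [|c hc] := @equivariant_scalar (Y *m inclusion_mx).
  by move=> g; rewrite mulmxA hY -mulmxA inclusion_equivariant mulmxA.
exists c; have := congr1 (fun X => X *m embed_mx^T *m pinvmx B) hc => /=.
rewrite -!scalemxAl -[Y *m _ *m _]mulmxA inclusion_mxK mulmxVp ?row_base_free //.
by rewrite -mulmxA mulmxVp ?row_base_free // mulmx1.
Qed.

(* S inherits an invariant positive definite form from the permutation module;
   specht_mx g^-1 is the adjoint of specht_mx g. *)
Lemma specht_charV g : specht_char la g^-1%g = specht_char la g.
Proof.
pose Q := B *m B^T.
have Qfree : row_free Q.
  rewrite -kermx_eq0; apply/rowV0P => u /sub_kermxP; rewrite /Q mulmxA => e.
  have e2 : (u *m B) *m (u *m B)^T = 0 by rewrite trmx_mul mulmxA e mul0mx.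
  have uB0 : u *m B = 0.
    apply/rowP=> j; rewrite [RHS]mxE; move: e2 => /matrixP/(_ 0 0); rewrite [LHS]mxE [RHS]mxE.
    move/eqP; rewrite Num.Theory.psumr_eq0 => [/allP/(_ j (mem_index_enum _))|k _].
      by rewrite /= [(_^T) _ _]mxE -expr2 sqrf_eq0 => /eqP.
    by rewrite [(_^T) _ _]mxE -expr2 Num.Theory.sqr_ge0.
  by rewrite -[u]mulmx1 -(mulmxVp (row_base_free _)) mulmxA uB0 mul0mx.
have Qu : Q \in unitmx by rewrite -row_free_unit.
have AT s : (tabloid_act s)^T = tabloid_act s^-1%g.
  apply/matrixP=> i j; rewrite !mxE; congr (_%:R); congr (nat_of_bool _).
  apply/eqP/eqP => <-; rewrite -tabloid_permM ?mulgV ?mulVg.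
    by apply/ffunP=> r; rewrite ffunE -[RHS]imset_id; apply: eq_imset => v; rewrite perm1.
  by apply/ffunP=> r; rewrite ffunE -[RHS]imset_id; apply: eq_imset => v; rewrite perm1.
have e : specht_mx g *m Q = Q *m (specht_mx g^-1%g)^T.
  rewrite /Q mulmxA specht_mxB -[in RHS]mulmxA -trmx_mul specht_mxB (trmx_mul B (tabloid_act
    _)) AT invgK.
  by rewrite mulmxA.
have -> : specht_char la g = \tr (specht_mx g *m Q *m invmx Q) by rewrite mulmxK.
by rewrite e mxtrace_mulC mulmxA mulVmx // mul1mx mxtrace_tr.
Qed.

End SpechtRep.

(** * The Frobenius characteristic of a Specht module *)

Section Kostka.
Variable n : nat.
Implicit Types (la al rho : intpart n).

Definition part_monom al : 'X_{1..n} := [multinom (tnth (val al) i : nat) | i < n].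

Definition psum la i := (\sum_(r < n | r < i) tnth (val la) r)%N.

Lemma psumS la (r : 'I_n) : psum la r.+1 = (psum la r + tnth (val la) r)%N.
Proof.
rewrite /psum (bigD1 r) //= addnC; congr (_ + _)%N; apply: eq_bigl => i.
by rewrite ltnS -val_eqE [RHS]ltn_neqAle andbC.
Qed.

(** A numerical rank that is strictly monotone for dominance; maximal choices for it replace a
    linear extension of the order in the triangularity arguments. *)
Definition dom_rank la := (\sum_(i < n.+1) psum la i)%N.

Lemma dominates_rank la al : dominates la al -> (dom_rank al <= dom_rank la)%N.
Proof. by move=> /forallP h; apply: leq_sum => i _; exact: h. Qed.

Lemma dominates_eq la al : dominates la al -> (dom_rank la <= dom_rank al)%N -> la = al.
Proof.
move=> /forallP h le.
have e (i : nat) : (i <= n)%N -> psum al i = psum la i.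
  move=> hi; have := @leqif_sum _ xpredT _ _ _ (fun (i : 'I_n.+1) _ => leqif_eq (h i)).
  move=> hs; have : dom_rank al == dom_rank la.
    by rewrite eqn_leq le andbT; apply: leq_sum => k _; exact: h.
  have hi' : (i < n.+1)%N by [].
  by rewrite /dom_rank /psum hs.2 => /forallP/(_ (Ordinal hi'))/eqP.
apply/val_inj/eq_from_tnth => r; apply: ord_inj.
have := e r.+1 (ltn_ord r); rewrite !psumS (e r (ltnW (ltn_ord r))).
by move/addnI.
Qed.

Lemma dominates_trans la rho al : dominates la rho -> dominates rho al -> dominates la al.
Proof.
move=> /forallP h1 /forallP h2; apply/forallP=> i; exact: leq_trans (h2 i) (h1 i).
Qed.

Lemma dominates_antisym la al : dominates la al -> dominates al la -> la = al.
Proof. by move=> h1 /dominates_rank h2; exact: dominates_eq. Qed.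

Definition tab_count la (T : {ffun cell la -> 'I_n}) (k : 'I_n) := #|[set c | T c == k]|.

Lemma schur_coef la (m : 'X_{1..n}) : (schur_poly n la)@_m =
  \sum_(T : {ffun cell la -> 'I_n} | is_semistandard T) [forall k, tab_count T k == m k]%:R.
Proof.
rewrite /schur_poly raddf_sum; apply: eq_bigr => T _ /=.
rewrite mprodXE mcoeffX; congr (_%:R); congr (nat_of_bool _).
have e k : (\sum_i U_(T i))%MM k = tab_count T k.
  rewrite mnm_sumE /tab_count -sum1dep_card [RHS]big_mkcond.
  by apply: eq_bigr => i _; rewrite mnm1E; case: eqP.
apply/eqP/forallP => [<- k|h]; first by rewrite e.
by apply/mnmP=> k; rewrite e; apply/eqP.
Qed.

Lemma card_cells la (P : pred (cell la)) (T : {ffun cell la -> 'I_n}) tinv :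
  cancel T tinv -> cancel tinv T -> #|[set c | P c]| = #|[set v | P (tinv v)]|.
Proof.
move=> TK KT; rewrite -!sum1dep_card (reindex tinv) //.
by exists T => i _; rewrite ?TK ?KT.
Qed.

Lemma card_cells_lt la (i : nat) : #|[set c : cell la | (val c).1 < i]%N| = psum la i.
Proof.
have [T hT] := exists_filling la; have [tinv TK KT] := filling_bij hT.
by rewrite /psum (card_cells _ TK KT) -(frow_content TK KT).
Qed.

Lemma card_cells_row la (k : 'I_n) : #|[set c : cell la | (val c).1 == k]| = tnth (val la) k.
Proof.
have [T hT] := exists_filling la; have [tinv TK KT] := filling_bij hT.
rewrite (card_cells _ TK KT); have /forallP/(_ k)/eqP <- := row_colouring_content TK KT.
by apply: eq_card => v; rewrite !inE ffunE.
Qed.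

Lemma tableau_row_le la (T : {ffun cell la -> 'I_n}) (c : cell la) : is_semistandard T ->
  ((val c).1 <= T c)%N.
Proof.
move=> /semistandardP[_ h]; move: {2}(val (val c).1) (erefl (val (val c).1)) => r.
elim: r c => [|r IH] c er; first by rewrite er.
have hr : (r < n)%N by apply: ltn_trans (ltn_ord (val c).1); rewrite er.
have hc : ((val c).2 < tnth (val la) (Ordinal hr))%N.
  by apply: leq_trans (valP c) (tnth_part_antitone _ _); rewrite er.
have lt := h (mkcell hc) c erefl; rewrite er /= in lt.
rewrite er; apply: leq_ltn_trans (lt _) => //.
by have := IH (mkcell hc) erefl.
Qed.

Lemma tableau_count_lt la al (T : {ffun cell la -> 'I_n}) i :
  [forall k, tab_count T k == part_monom al k] -> #|[set c | T c < i]%N| = psum al i.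
Proof.
move=> /forallP h; rewrite -sum1dep_card (partition_big T (fun r : 'I_n => r < i)%N) //=.
apply: eq_bigr => r hr; have := h r; rewrite mnmE => /eqP <-.
rewrite /tab_count -sum1dep_card.
by apply: eq_bigl => v; apply: andb_idl => /eqP ->.
Qed.

(** Letters increase strictly down a column, so the letters below i all stand in the first i
    rows. *)
Lemma kostka_dominates la al : (schur_poly n la)@_(part_monom al) != 0 -> dominates la al.
Proof.
rewrite schur_coef => h0.
have [T hT hc] : exists2 T : {ffun cell la ->
  'I_n}, is_semistandard T & [forall k, tab_count T k == part_monom al k].
  have [/existsP[T /andP[h1 h2]]|hn] := boolP [exists T : {ffun cell la -> 'I_n},
      is_semistandard T && [forall k, tab_count T k == part_monom al k]]; first by exists T.
  case/eqP: h0; apply: big1 => T hT; move: hn; rewrite negb_exists => /forallP/(_ T).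
  by rewrite hT /= => /negPf ->.
apply/forallP=> i; rewrite -[X in (X <= _)%N](tableau_count_lt i hc) -[X in (_ <=
  X)%N](card_cells_lt la i).
apply: subset_leq_card; apply/subsetP=> c; rewrite !inE; exact: leq_ltn_trans (tableau_row_le c hT).
Qed.

(** When content and shape agree, the letters below i fill the first i rows completely for each i,
    so row r contains only the letter r. *)
Lemma kostka_diag la : (schur_poly n la)@_(part_monom la) = 1.
Proof.
rewrite schur_coef; pose T0 : {ffun cell la -> 'I_n} := [ffun c => (val c).1].
have s0 : is_semistandard T0.
  apply/semistandardP; split=> k k' e lt; rewrite !ffunE //.
  by rewrite e.
rewrite (bigD1 T0) //= big1 ?addr0 => [|T /andP[hT T0T]].
  rewrite (_ : [forall k, _] = true) //; apply/forallP=> k; rewrite mnmE -card_cells_row.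
  by apply/eqP/eq_card => c; rewrite !inE ffunE.
case: (boolP [forall k, _]) => // hc; case/eqP: T0T; apply/ffunP=> c; rewrite ffunE.
apply: ord_inj; apply/eqP; rewrite eqn_leq tableau_row_le // andbT -ltnS.
set i := (val c).1.+1.
have sub : [set c | T c < i]%N \subset [set c : cell la | (val c).1 < i]%N.
  by apply/subsetP=> k; rewrite !inE; exact: leq_ltn_trans (tableau_row_le k hT).
have /eqP es : [set c | T c < i]%N == [set c : cell la | (val c).1 < i]%N.
  by rewrite eqEcard sub (tableau_count_lt i hc) card_cells_lt leqnn.
by have /setP/(_ c) := es; rewrite !inE ltnSn.
Qed.

Lemma colour_mx_trace al (s : 'S_n) : \tr (colour_mx al s) = perm_char (part_monom al) s.
Proof.
rewrite /colour_mx trace_fun_mx perm_charE; apply: eq_big => [f|f _].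
  apply/eqP/fixesP => [/ffunP h i|h].
    by have := h (s i); rewrite ffunE permK.
  by apply/ffunP=> v; rewrite ffunE -[in RHS](permKV s v) h.
by congr (_%:R); congr (nat_of_bool _); apply: eq_forallb => k; rewrite mnmE.
Qed.

End Kostka.

(** * Specht characters as the orthonormal family behind Schur polynomials *)

Section Frobenius.
Variable n : nat.
Hypothesis n_gt0 : (0 < n)%N.
Implicit Types (la al rho : intpart n).
Local Notation I := {: intpart n}.
Local Notation q := (n`!%:R : rat).
Local Notation perm_part al := (perm_char (n := n) (part_monom al)).

Definition kostka_mx : 'M[rat]_#|I| :=
  \matrix_(i, j) (schur_poly n (enum_val j))@_(part_monom (enum_val i)).

Lemma kostka_mx_unit : kostka_mx \in unitmx.
Proof.
rewrite -unitmx_tr -row_free_unit -kermx_eq0; apply/rowV0P => u /sub_kermxP e.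
apply/eqP/contraT => u0.
have [j0 hj0] : exists j, u 0 j != 0.
  by apply/rV0Pn.
pose w la := u 0 (enum_rank la).
have hw : w (enum_val j0) != 0 by rewrite /w enum_valK.
(* In the coordinate whose content is la, any other contributing shape dominates la and would have
   larger rank; only the diagonal term survives. *)
have [la hla hmax] := @arg_maxnP _ (enum_val j0) (fun la => w la != 0) (@dom_rank n) hw.
have := congr1 (fun M : 'rV_#|I| => M 0 (enum_rank la)) e; rewrite [LHS]mxE [RHS]mxE.
rewrite (bigD1 (enum_rank la)) //= big1 => [|j jl].
  by rewrite !mxE enum_rankK kostka_diag mulr1 addr0 => w0; move: hla; rewrite /w w0 eqxx.
rewrite !mxE enum_rankK; have [->|uj] := eqVneq (u 0 j) 0; first by rewrite mul0r.
have [->|kj] := eqVneq (schur_poly n (enum_val j))@_(part_monom la) 0; first by rewrite mulr0.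
case/eqP: jl; rewrite -[j]enum_valK; congr enum_rank.
by apply: dominates_eq; [exact: kostka_dominates|apply: hmax; rewrite /w enum_valK].
Qed.

(* psi is orthonormal and M = K psi; specht_char la = psi la because both have norm q and
   their inner product is q. *)
Let psi la (s : 'S_n) := \sum_(al :
  intpart n) invmx kostka_mx (enum_rank la) (enum_rank al) * perm_part al s.

Let sum_enum (F : I -> I -> rat) la rho :
  \sum_(al : intpart n) F la al * (schur_poly n rho)@_(part_monom al) = 
  \sum_(i < #|I|) F la (enum_val i) * kostka_mx i (enum_rank rho).
Proof.
rewrite (reindex_onto enum_val enum_rank) => [|al _]; last by rewrite enum_rankK.
by apply: eq_big => [i|i _]; rewrite ?enum_valK ?eqxx // mxE enum_rankK.
Qed.

Let inv_kostka la rho :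
  \sum_(al : intpart n) invmx kostka_mx (enum_rank la) (enum_rank al) * (schur_poly n
    rho)@_(part_monom al)
  = (la == rho)%:R.
Proof.
rewrite (sum_enum (fun la al => invmx kostka_mx (enum_rank la) (enum_rank al))).
have := congr1 (fun M : 'M_#|I| => M (enum_rank la) (enum_rank rho)) (mulVmx kostka_mx_unit).
rewrite [LHS]mxE [RHS]mxE (inj_eq enum_rank_inj) => <-.
by apply: eq_bigr => i _; rewrite enum_valK.
Qed.

Let perm_psi N (m : 'X_{1..N}) la :
  \sum_(s : 'S_n) perm_char m s * psi la s = q * (schur_poly N la)@_m.
Proof.
transitivity (\sum_(al : intpart n) invmx kostka_mx (enum_rank la) (enum_rank al) *
   \sum_(s : 'S_n) perm_char m s * perm_part al s).
  under [RHS]eq_bigr do rewrite mulr_sumr.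
  rewrite exchange_big; apply: eq_bigr => s _; rewrite mulr_sumr.
  by apply: eq_bigr => al _; rewrite mulrCA.
under eq_bigr do rewrite sum_perm_char2 // mulrCA mulr_sumr.
rewrite -mulr_sumr exchange_big /=; congr (_ * _).
under eq_bigr => rho _.
  under eq_bigr do rewrite mulrCA.
  rewrite -mulr_sumr inv_kostka; over.
by rewrite (bigD1 la) //= eqxx mulr1 big1 ?addr0 // => rho /negPf; rewrite eq_sym => ->;
  rewrite mulr0.
Qed.

Let psi_psi la rho : \sum_(s : 'S_n) psi la s * psi rho s = q * (la == rho)%:R.
Proof.
transitivity (\sum_(al : intpart n) invmx kostka_mx (enum_rank la) (enum_rank al) *
   \sum_(s : 'S_n) perm_part al s * psi rho s).
  under [RHS]eq_bigr do rewrite mulr_sumr.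
  rewrite exchange_big; apply: eq_bigr => s _; rewrite mulr_suml.
  by apply: eq_bigr => al _; rewrite mulrA.
under eq_bigr do rewrite perm_psi mulrCA.
by rewrite -mulr_sumr inv_kostka.
Qed.

Let sum_sqr_eq0 (v : 'S_n -> rat) : \sum_(s : 'S_n) v s * v s = 0 -> forall s, v s = 0.
Proof.
move/eqP; rewrite Num.Theory.psumr_eq0 => [/allP h s|s _];
  last by rewrite -expr2 Num.Theory.sqr_ge0.
by have := h s (mem_index_enum _); rewrite /= mulf_eq0 orbb => /eqP.
Qed.

(** The pairings of M^m with [psi] are its Kostka numbers, and by [sum_perm_char2] the norm of M^m
    is the sum of their squares. So the difference from the orthogonal expansion has norm 0. *)
Let perm_char_psi N (m : 'X_{1..N}) s :
  perm_char m s = \sum_(la : intpart n) (schur_poly N la)@_m * psi la s.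
Proof.
pose t (s : 'S_n) := \sum_(la : intpart n) (schur_poly N la)@_m * psi la s.
apply/eqP; rewrite -subr_eq0 -/(t s); apply/eqP.
apply: (@sum_sqr_eq0 (fun s : 'S_n => perm_char m s - t s)) => {s}.
have pt : \sum_(s : 'S_n) perm_char m s * t s =
  q * \sum_(la : intpart n) (schur_poly N la)@_m * (schur_poly N la)@_m.
  under eq_bigr do rewrite /t mulr_sumr.
  rewrite exchange_big mulr_sumr; apply: eq_bigr => la _ /=.
  under eq_bigr do rewrite mulrCA.
  by rewrite -mulr_sumr perm_psi; ring.
have tt : \sum_(s : 'S_n) t s * t s =
  q * \sum_(la : intpart n) (schur_poly N la)@_m * (schur_poly N la)@_m.
  transitivity (\sum_(la : intpart n) \sum_(rho :
    intpart n) (schur_poly N la)@_m * (schur_poly N rho)@_m *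
      \sum_(s : 'S_n) psi la s * psi rho s).
    under [RHS]eq_bigr => la _ do under eq_bigr => rho _ do rewrite mulr_sumr.
    under [RHS]eq_bigr => la _ do rewrite exchange_big /=.
    rewrite [RHS]exchange_big; apply: eq_bigr => s _ /=; rewrite /t mulr_suml.
    apply: eq_bigr => la _; rewrite mulr_sumr; apply: eq_bigr => rho _; ring.
  rewrite mulr_sumr; apply: eq_bigr => la _; rewrite (bigD1 la) //= psi_psi eqxx mulr1.
  rewrite big1 ?addr0 => [|rho rl]; first by ring.
  by rewrite psi_psi eq_sym (negPf rl) !mulr0.
transitivity (\sum_(s : 'S_n) perm_char m s * perm_char m s - 2 * (\sum_(s :
  'S_n) perm_char m s * t s) + \sum_(s : 'S_n) t s * t s).
  rewrite mulr_sumr -sumrB -big_split /=; apply: eq_bigr => s _; ring.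
rewrite pt tt sum_perm_char2 //; ring.
Qed.

(** Expanding permutation characters in [psi] gives a unitriangular system for the pairings [b] with
    the Specht character. The vanishing for non-dominated contents makes all pairings but those
    dominated by [la] zero, and the content [la] then isolates the diagonal one. *)
Let chi_psi la : \sum_(s : 'S_n) specht_char la s * psi la s = q.
Proof.
pose b rho := \sum_(s : 'S_n) specht_char la s * psi rho s.
have hb al : \sum_(rho : intpart n) (schur_poly n rho)@_(part_monom al) * b rho =
    \sum_(s : 'S_n) specht_char la s * perm_part al s.
  under [RHS]eq_bigr do rewrite perm_char_psi mulr_sumr.
  rewrite exchange_big /=; apply: eq_bigr => rho _; rewrite mulr_sumr.
  by apply: eq_bigr => s _; rewrite mulrCA.
have hV al : \sum_(s : 'S_n) specht_char la s * perm_part al s =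
    \sum_(g : 'S_n) specht_char la g^-1%g * \tr (colour_mx al g).
  by apply: eq_bigr => s _; rewrite specht_charV colour_mx_trace.
(* For a counterexample al of maximal rank, another term in the expansion at content al has a shape
   dominating al; that shape is again not dominated by la, so a nonzero pairing would contradict
   maximality. *)
have b0 rho : ~~ dominates la rho -> b rho = 0.
  move=> h0; apply/eqP/contraT => hr.
  have h1 : ~~ dominates la rho && (b rho != 0) by rewrite h0.
  have [al /andP[nd hal] hmax] := @arg_maxnP _ rho (fun al => ~~ dominates la al && (b al !=
    0)) (@dom_rank n) h1.
  have := hb al; rewrite hV sum_specht_perm0 // (bigD1 al) //= kostka_diag mul1r big1 ?addr0.
    by move=> e; rewrite e eqxx in hal.
  move=> si sial; have [->|ksi] := eqVneq (schur_poly n si)@_(part_monom al) 0;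
    first by rewrite mul0r.
  have [->|bsi] := eqVneq (b si) 0; first by rewrite mulr0.
  have dsi := kostka_dominates ksi; case/eqP: sial; apply: (dominates_eq dsi).
  apply: hmax; rewrite bsi andbT; apply: contra nd => h; exact: dominates_trans h dsi.
have := hb la; rewrite hV sum_specht_perm1 (bigD1 la) //= kostka_diag mul1r big1 ?addr0 //.
move=> si sila; have [->|ksi] := eqVneq (schur_poly n si)@_(part_monom la) 0;
  first by rewrite mul0r.
rewrite b0 ?mulr0 //; apply: contra sila => h; apply/eqP;
  exact: dominates_antisym (kostka_dominates ksi) h.
Qed.

Let specht_psi la s : specht_char la s = psi la s.
Proof.
apply/eqP; rewrite -subr_eq0; apply/eqP.
apply: (@sum_sqr_eq0 (fun s => specht_char la s - psi la s)) => {s}.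
transitivity (\sum_(s : 'S_n) specht_char la s * specht_char la s - 2 * (\sum_(s :
  'S_n) specht_char la s * psi la s) + \sum_(s : 'S_n) psi la s * psi la s).
  rewrite mulr_sumr -sumrB -big_split /=; apply: eq_bigr => s _; ring.
rewrite chi_psi psi_psi eqxx mulr1.
have -> : \sum_(s : 'S_n) specht_char la s * specht_char la s = q.
  by rewrite -(sum_specht_specht la); apply: eq_bigr => s _; rewrite specht_charV.
ring.
Qed.

Lemma specht_orthonormal la rho :
  \sum_(s : 'S_n) specht_char la s * specht_char rho s = n`!%:R * (la == rho)%:R.
Proof. by rewrite -psi_psi; apply: eq_bigr => s _; rewrite !specht_psi. Qed.

Lemma perm_char_specht N (m : 'X_{1..N}) s :
  perm_char m s = \sum_(la : intpart n) (schur_poly N la)@_m * specht_char la s.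
Proof. by rewrite perm_char_psi; apply: eq_bigr => la _; rewrite specht_psi. Qed.

Lemma power_poly_specht N (s : 'S_n) :
  power_poly N s = \sum_(la : intpart n) specht_char la s *: schur_poly N la.
Proof.
apply/mpolyP=> m; rewrite -/(perm_char m s) perm_char_specht raddf_sum.
by apply: eq_bigr => la _ /=; rewrite mcoeffZ mulrC.
Qed.

Lemma frobenius_specht N la :
  \sum_(s : 'S_n) specht_char la s *: power_poly N s = n`!%:R *: schur_poly N la.
Proof.
under eq_bigr do rewrite power_poly_specht scaler_sumr.
rewrite exchange_big (bigD1 la) //= [X in _ + X]big1 ?addr0 => [|rho rl].
  under eq_bigr do rewrite scalerA.
  by rewrite -scaler_suml specht_orthonormal eqxx mulr1.
under eq_bigr do rewrite scalerA.
by rewrite -scaler_suml specht_orthonormal eq_sym (negPf rl) mulr0 scale0r.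
Qed.

End Frobenius.

(** * Descents and the adapted basis *)

Section Descents.
Variable k : nat.
Local Notation n := k.+1.
Implicit Types (w u s : 'S_n) (R : {set 'I_k}) (i : 'I_k) (p q a b : 'I_n).

Definition descent w i : bool := (w (lift ord0 i) < w (widen_ord (leqnSn k) i))%N.
Definition descents w : {set 'I_k} := [set i | descent w i].

(* Positions p < q are in the same block iff all the i with p <= i < q are in R. *)
Definition block_index R p : nat := #|[set i : 'I_k | (i < p)%N && (i \notin R)]|.
Definition block R : {ffun 'I_n -> 'I_n} := [ffun p => inord (block_index R p)].

Lemma blockE R p : block R p = block_index R p :> nat.
Proof. by rewrite ffunE inordK // ltnS -[X in (_ <= X)%N](card_ord k) max_card. Qed.

Lemma block_mono R p q : (p <= q)%N -> (block R p <= block R q)%N.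
Proof.
move=> pq; rewrite !blockE; apply: subset_leq_card; apply/subsetP=> i; rewrite !inE.
by case/andP=> h ->; rewrite (leq_trans h pq).
Qed.

Lemma block_lt_mono R p q : (block R p < block R q)%N -> (p < q)%N.
Proof. by rewrite !ltnNge; apply: contra; exact: block_mono. Qed.

Lemma block_separator R i p : i \notin R ->
  (i < p)%N = (block R (widen_ord (leqnSn k) i) < block R p)%N.
Proof.
move=> iR; apply/idP/idP => [ip|/block_lt_mono //].
rewrite !blockE; apply: proper_card; apply/properP; split.
  apply/subsetP=> j; rewrite !inE => /andP[h ->]; rewrite andbT.
  exact: ltn_trans h ip.
by exists i; rewrite !inE ?ip ?iR //= ltnn.
Qed.

Lemma block_same R p q i : block R p = block R q -> (p <= i)%N -> (i < q)%N -> i \in R.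
Proof.
move=> e pi iq; apply/contraT => iR; have := iq; rewrite (block_separator _ iR) -e.
by rewrite -(block_separator _ iR) ltnNge pi.
Qed.

Lemma block_in R i : i \in R -> block R (lift ord0 i) = block R (widen_ord (leqnSn k) i).
Proof.
move=> iR; apply: ord_inj; rewrite !blockE; apply: eq_card => j; rewrite !inE.
rewrite lift0 ltnS leq_eqVlt andb_orl /=; case: eqP => //= /ord_inj ->.
by rewrite iR ltnn.
Qed.

(** Two positions of one block are joined by steps in R. Used with increasing and with decreasing
    values. *)
Lemma block_step (P : rel 'I_n) R p q : transitive P ->
  (forall i, i \in R -> P (widen_ord (leqnSn k) i) (lift ord0 i)) ->
  block R p = block R q -> (p < q)%N -> P p q.
Proof.
move=> tr hP; move: {2}(val q) (erefl (val q)) => m.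
elim: m q => [|m IH] q eq e pq; first by rewrite eq in pq.
have hm : (m < k)%N by have := ltn_ord q; rewrite eq.
have eq' : q = lift ord0 (Ordinal hm) by apply: ord_inj; rewrite eq lift0.
have pm : (p <= Ordinal hm)%N by move: pq; rewrite eq.
have mR : Ordinal hm \in R by apply: (block_same e) => //; rewrite eq.
rewrite eq'; move: pm; rewrite leq_eqVlt => /orP[/eqP ep|pm].
  have -> : p = widen_ord (leqnSn k) (Ordinal hm) by exact: ord_inj.
  exact: hP.
apply: tr (hP _ mR); apply: IH => //.
by rewrite e eq' block_in.
Qed.

Lemma block_increasing R w p q : [disjoint descents w & R] ->
  block R p = block R q -> (p < q)%N -> (w p < w q)%N.
Proof.
move=> dis; apply: (@block_step (fun p q => w p < w q)%N) => [x y z|i iR]; first exact: ltn_trans.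
have : ~~ descent w i by apply: contraL iR => h; rewrite (disjointFr dis) // inE.
rewrite /descent -leqNgt leq_eqVlt => /orP[/eqP/ord_inj/perm_inj|//].
by move/(congr1 val) => /= /eqP; rewrite /bump leq0n add1n (ltn_eqF (ltnSn i)).
Qed.

Lemma block_decreasing R w p q : R \subset descents w ->
  block R p = block R q -> (p < q)%N -> (w q < w p)%N.
Proof.
move=> /subsetP sub; apply: (@block_step (fun p q => w q < w p)%N) => [x y z h1 h2|i /sub].
  exact: ltn_trans h2 h1.
by rewrite inE.
Qed.

(** Pairs are recorded by values, so inclusion of these sets is a weak order, for which the
    permutations with given contents of the blocks have a least and a greatest element. *)
Definition inversions w : {set 'I_n * 'I_n} :=
  [set ab : 'I_n * 'I_n | (ab.2 < ab.1)%N && (w^-1%g ab.1 < w^-1%g ab.2)%N].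

Lemma inversions_inj : injective inversions.
Proof.
move=> w u e.
have lt a b : (w^-1%g a < w^-1%g b)%N = (u^-1%g a < u^-1%g b)%N.
  have [ab|ba|/ord_inj ->] := ltngtP a b; last by rewrite !ltnn.
    have := congr1 (fun A : {set _} => (b, a) \in A) e; rewrite !inE /= ab /= => h.
    have ne s : s^-1%g a != s^-1%g b :> nat.
      by apply/eqP => /ord_inj/perm_inj e'; rewrite e' ltnn in ab.
    by rewrite ltn_neqAle ne /= leqNgt h -leqNgt [RHS]ltn_neqAle ne.
  by have := congr1 (fun A : {set _} => (a, b) \in A) e; rewrite !inE /= ba.
have rk (s : 'S_n) a : #|[set b | s^-1%g b < s^-1%g a]%N| = s^-1%g a.
  rewrite -[RHS](@card_ord_ltn n) 1?ltnW // -[RHS](card_imset _ (@perm_inj _ s)).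
  apply: eq_card => b; rewrite inE; apply/idP/imsetP => [h|[c]].
    by exists (s^-1%g b); rewrite ?inE // permKV.
  by rewrite inE => h ->; rewrite permK.
apply: invg_inj; apply/permP=> a; apply: ord_inj; rewrite -[LHS](rk w a) -[RHS](rk u a).
by apply: eq_card => b; rewrite !inE lt.
Qed.

(** The blocks of w are increasing, so an inversion of w involves two different blocks and is shared
    by every u with the same block contents. *)
Lemma inversions_min R w u : [disjoint descents w & R] ->
  col_act u (block R) = col_act w (block R) -> inversions w \subset inversions u.
Proof.
move=> dis /ffunP e; apply/subsetP=> -[a b]; rewrite !inE /= => /andP[ba lt]; rewrite ba /=.
have ea : block R (u^-1%g a) = block R (w^-1%g a) by have := e a; rewrite !ffunE.
have eb : block R (u^-1%g b) = block R (w^-1%g b) by have := e b; rewrite !ffunE.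
apply: (@block_lt_mono R); rewrite ea eb ltn_neqAle block_mono 1?ltnW // andbT.
apply/eqP => /ord_inj eab; have := block_increasing dis eab lt.
by rewrite !permKV ltnNge ltnW.
Qed.

(** Dually, the blocks of w are decreasing and contain every inversion possible inside a block. *)
Lemma inversions_max R w u : R \subset descents w ->
  col_act u (block R) = col_act w (block R) -> inversions u \subset inversions w.
Proof.
move=> sub /ffunP e; apply/subsetP=> -[a b]; rewrite !inE /= => /andP[ba lt]; rewrite ba /=.
have ea : block R (u^-1%g a) = block R (w^-1%g a) by have := e a; rewrite !ffunE.
have eb : block R (u^-1%g b) = block R (w^-1%g b) by have := e b; rewrite !ffunE.
have := block_mono R (ltnW lt); rewrite ea eb leq_eqVlt => /orP[/eqP/ord_inj eab|];
  last exact: block_lt_mono.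
rewrite ltnNge; apply/negP; rewrite leq_eqVlt => /orP[/eqP/ord_inj/perm_inj eb'|h].
  by rewrite eb' ltnn in ba.
by have := block_decreasing sub (esym eab) h; rewrite !permKV ltnNge ltnW.
Qed.

(** [col_act u (block R)] gives each value the block of positions in which it stands, so the
    equality puts u in the coset of w. The sign of w normalises the coefficient at w to 1. *)
Definition desc_basis w u : rat :=
  (col_act u (block (descents w)) == col_act w (block (descents w)))%:R *
  (-1) ^+ (odd_perm w (+) odd_perm u).

Lemma desc_basis_id w : desc_basis w w = 1.
Proof. by rewrite /desc_basis eqxx addbb mul1r. Qed.

Lemma desc_basis_inv w u : desc_basis w u != 0 -> inversions u \subset inversions w.
Proof.
move=> h; apply: (inversions_max (subxx _)); apply/eqP; apply: contraNT h => /negPf e.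
by rewrite /desc_basis e mul0r.
Qed.

(** Exchanging the values at positions i and i + 1 preserves both the fibre and the support of the
    basis vector and reverses the sign. *)
Lemma desc_basis_sum0 R w i x : i \in R -> i \in descents w ->
  \sum_(u | col_act u (block R) == x) desc_basis w u = 0.
Proof.
move=> iR iw; pose tp := tperm (widen_ord (leqnSn k) i) (lift ord0 i).
have tpB (R' : {set 'I_k}) u : i \in R' -> col_act (tp * u)%g (block R') = col_act u (block R').
  move=> iR'; rewrite col_actM; congr col_act; apply/ffunP=> p; rewrite [LHS]ffunE tpermV.
  by case: tpermP => [->|->|//]; rewrite block_in.
suff : \sum_(u | col_act u (block R) == x) desc_basis w u =
   - \sum_(u | col_act u (block R) == x) desc_basis w u by lra.
rewrite [LHS](reindex_inj (mulgI tp)) /= -sumrN; apply: eq_big => [u|u _]; first by rewrite tpB.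
rewrite /desc_basis tpB // odd_permM odd_tperm.
have -> : (widen_ord (leqnSn k) i != lift ord0 i).
  by rewrite -val_eqE /= /bump /= add1n neq_ltn ltnSn.
by rewrite addbA addbT -mulrN addNb signrN.
Qed.

End Descents.

(** Applied to two projections onto one stable space: the trace of the restriction does not depend
    on the complement. *)
Lemma trace_projection (F : fieldType) m (E1 E2 X : 'M[F]_m) :
  E1 *m X *m E2 = E1 *m X -> E2 *m E1 = E2 -> \tr (E1 *m X) = \tr (E2 *m X).
Proof. by move=> h1 h2; rewrite -h1 mxtrace_mulC mulmxA h2. Qed.

Lemma trace_restrictmx (F : fieldType) m (Z P X : 'M[F]_m) :
  (P <= Z)%MS -> Z *m P = Z -> (Z *m X <= Z)%MS ->
  \tr (restrictmx Z X) = \tr (P *m X).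
Proof.
move=> PZ ZP ZX; set V := row_base Z.
have VP : V *m P = V.
  have /submxP[D ->] : (V <= Z)%MS by rewrite eq_row_base.
  by rewrite -mulmxA ZP.
have VX : (V *m X <= V)%MS.
  by rewrite eq_row_base; apply: submx_trans ZX; apply: submxMr; rewrite eq_row_base.
rewrite /conjmx -/V mxtrace_mulC mulmxA; apply: trace_projection.
  rewrite -mulmxA -(mulmxA (pinvmx V)) (mulmxA V) -[in RHS]mulmxA; congr (_ *m _).
  by have /submxP[D ->] := VX; rewrite -mulmxA VP.
by rewrite mulmxA mulmxKpV // eq_row_base.
Qed.

(** For [B = 0] the matrix [cokermx B] is invertible, so passing to the quotient is a change of
    basis. *)
Lemma quotient_trace_sub0 m (Z B P X : 'M[rat]_m) : B = 0 ->
  (P <= Z)%MS -> Z *m P = Z -> (Z *m X <= Z)%MS ->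
  quotient_trace Z B X = \tr (P *m X).
Proof.
move=> B0 PZ ZP ZX; rewrite /quotient_trace; set K := cokermx B.
have Ku : K \in unitmx.
  by rewrite /K /cokermx B0 mxrank0 /copid_mx pid_mx_0 subr0 mulmx1 unitmx_inv row_ebase_unit.
have -> : pinvmx K = invmx K.
  by rewrite -[pinvmx K]mul1mx -(mulVmx Ku) -mulmxA mulmxVp ?mulmx1 // row_free_unit.
clearbody K; rewrite (@trace_restrictmx _ _ (Z *m K) (invmx K *m P *m K)).
- by rewrite !mulmxA mulmxK // mxtrace_mulC !mulmxA mulmxV // mul1mx.
- have /submxP[D ->] := PZ; rewrite !mulmxA -(mulmxA _ Z K); exact: submxMl.
- by rewrite !mulmxA mulmxK // ZP.
- by rewrite !mulmxA mulmxK //; exact: submxMr.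
Qed.

(** * The adapted basis for tuples of permutations *)

Section TensorBasis.
Variables (t k : nat).
Local Notation n := k.+1.
Local Notation X := {ffun 'I_t -> 'S_n}.
Local Notation Y := {ffun 'I_t -> {ffun 'I_n -> 'I_n}}.
Implicit Types (w u v : X) (R : {set 'I_k}) (y : Y) (s : X).

Definition descentsX w : {set 'I_k} := [set i | [exists j, i \in descents (w j)]].
Definition colourX R w : Y := [ffun j => col_act (w j) (block R)].
Definition basisX w u : rat := \prod_j desc_basis (w j) (u j).

Lemma disjoint_descentsX w R : [disjoint descentsX w & R] ->
  forall j, [disjoint descents (w j) & R].
Proof.
move=> dis j; apply: disjointWl dis; apply/subsetP=> i iw.
by rewrite inE; apply/existsP; exists j.
Qed.

(** The sum over a fibre factors over the coordinates, and a coordinate with a descent in R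
    contributes 0. *)
Lemma basisX_sum0 R w y : ~~ [disjoint descentsX w & R] ->
  \sum_(u | colourX R u == y) basisX w u = 0.
Proof.
rewrite -setI_eq0 => /set0Pn[i]; rewrite !inE => /andP[/existsP[j iw] iR].
transitivity (\prod_j \sum_(u | col_act u (block R) == y j) desc_basis (w j) u); last first.
  by rewrite (bigD1 j) //= (desc_basis_sum0 _ iR iw) mul0r.
rewrite bigA_distr_big_dep; apply: eq_bigl => u; apply/eqP/familyP => [<- j'|h].
  by rewrite unfold_in ffunE.
by apply/ffunP=> j'; rewrite ffunE; apply/eqP; have := h j'; rewrite unfold_in.
Qed.

Definition invX w : nat := \sum_j #|inversions (w j)|.

Lemma invX_sub w u : (forall j, inversions (w j) \subset inversions (u j)) ->
  (invX u <= invX w)%N -> w = u.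
Proof.
move=> sub le; apply/ffunP=> j; apply: inversions_inj; apply/eqP.
rewrite eqEcard sub /=; have := @leqif_sum _ xpredT _ _ _ (fun j _ => leqif_eq (subset_leq_card
  (sub j))).
case=> le' e; move: e; have -> : (invX w == invX u) by rewrite eqn_leq le le'.
by move=> /esym/forallP/(_ j)/eqP ->.
Qed.

(* Triangularity: basisX v u <> 0 forces inversions u <= inversions v, and w has the fewest
   inversions in its fibre of colourX R when it has no descent in R. *)
Lemma basisX_free R (z : X -> rat) :
  (forall y, \sum_(u | colourX R u == y) \sum_w z w * basisX w u = 0) ->
  forall w, [disjoint descentsX w & R] -> z w = 0.
Proof.
move=> hz w0 dis0; apply/eqP/contraT => z0.
have h0 : [disjoint descentsX w0 & R] && (z w0 != 0) by rewrite dis0.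
have [w /andP[dis zw] hmax] := @arg_maxnP _ w0 (fun w => [disjoint descentsX w & R] && (z w !=
  0)) invX h0.
have := hz (colourX R w); rewrite exchange_big /=.
under eq_bigr do rewrite -mulr_sumr.
have key v u : [disjoint descentsX v & R] -> z v != 0 -> colourX R u = colourX R w ->
    basisX v u != 0 -> u = w /\ v = w.
  move=> disv zv ec bvu.
  have wu j : inversions (w j) \subset inversions (u j).
    apply: (inversions_min (disjoint_descentsX dis j)).
    by have /ffunP/(_ j) := ec; rewrite !ffunE.
  have uv j : inversions (u j) \subset inversions (v j).
    apply: desc_basis_inv; apply: contraNneq bvu => e.
    by rewrite /basisX (bigD1 j) //= e mul0r.
  have le : (invX v <= invX w)%N by apply: hmax; rewrite disv zv.
  have luv : (invX u <= invX v)%N by apply: leq_sum => j _; exact: subset_leq_card.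
  have lwu : (invX w <= invX u)%N by apply: leq_sum => j _; exact: subset_leq_card.
  split; first by apply/esym/invX_sub => //; exact: leq_trans le.
  by apply/esym/invX_sub => // j; exact: subset_trans (wu j) (uv j).
rewrite (bigD1 w) //= [X in _ + X]big1 ?addr0 => [|v vw].
  rewrite (bigD1 w) //= big1 ?addr0 => [|u /andP[/eqP ec uw]].
    by rewrite /basisX big1 ?mulr1 => [/eqP|j _]; [rewrite (negPf zw)|rewrite desc_basis_id].
  have [//|b0] := eqVneq (basisX w u) 0; have [e _] := key w u dis zw ec b0.
  by rewrite e eqxx in uw.
have [disv|disv] := boolP [disjoint descentsX v & R]; last by rewrite basisX_sum0 // mulr0.
have [->|zv] := eqVneq (z v) 0; first by rewrite mul0r.
rewrite big1 ?mulr0 // => u /eqP ec.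
have [//|b0] := eqVneq (basisX v u) 0; have [_ e] := key v u disv zv ec b0.
by rewrite e eqxx in vw.
Qed.

Definition basis_mx : 'M[rat]_#|{: X}| := \matrix_(i, j) basisX (enum_val i) (enum_val j).
Definition colour_map R : 'M[rat]_(#|{: X}|, #|{: Y}|) :=
  \matrix_(i, j) (colourX R (enum_val i) == enum_val j)%:R.

Lemma row_colour_map (z : 'rV[rat]_#|{: X}|) R y :
  (z *m colour_map R) 0 (enum_rank y) = \sum_(u | colourX R u == y) z 0 (enum_rank u).
Proof.
rewrite mxE (reindex_onto enum_rank enum_val) => [|i _]; last by rewrite enum_valK.
rewrite [RHS]big_mkcond; apply: eq_big => [u|u _]; first by rewrite enum_rankK eqxx.
by rewrite mxE !enum_rankK; case: eqP; rewrite ?mulr1 ?mulr0.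
Qed.

Lemma row_basis_mx (z : 'rV[rat]_#|{: X}|) u :
  (z *m basis_mx) 0 (enum_rank u) = \sum_w z 0 (enum_rank w) * basisX w u.
Proof.
rewrite mxE (reindex_onto enum_rank enum_val) => [|i _]; last by rewrite enum_valK.
by apply: eq_big => [w|w _]; rewrite ?enum_rankK ?eqxx // mxE !enum_rankK.
Qed.

Lemma basis_mx_kernel (z : 'rV[rat]_#|{: X}|) R : z *m basis_mx *m colour_map R = 0 ->
  forall w, [disjoint descentsX w & R] -> z 0 (enum_rank w) = 0.
Proof.
move=> h; apply: (@basisX_free R (fun w => z 0 (enum_rank w))) => y.
have /rowP/(_ (enum_rank y)) := h; rewrite row_colour_map [RHS]mxE => e; rewrite -[RHS]e.
by apply: eq_bigr => u _; rewrite row_basis_mx.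
Qed.

Lemma basis_mx_unit : basis_mx \in unitmx.
Proof.
rewrite -row_free_unit -kermx_eq0; apply/rowV0P => z /sub_kermxP h.
apply/rowP=> i; rewrite -[i]enum_valK [RHS]mxE; apply: (@basis_mx_kernel _ set0).
  by rewrite h mul0mx.
by rewrite -setI_eq0 setI0.
Qed.

Definition select_mx (P : pred X) : 'M[rat]_#|{: X}| :=
  diag_mx (\row_i (P (enum_val i))%:R).

Lemma row_select_mx (z : 'rV[rat]_#|{: X}|) P w :
  (z *m select_mx P) 0 (enum_rank w) = z 0 (enum_rank w) * (P w)%:R.
Proof. by rewrite mul_mx_diag !mxE enum_rankK. Qed.

(** The projection onto the span of the basis vectors selected by [P], along the other basis
    vectors. *)
Definition span_proj P := invmx basis_mx *m select_mx P *m basis_mx.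

Definition perm_act s w : X := [ffun j => w j * s j]%g.
Definition translate_mx s := fun_mx rat xpredT (perm_act s).

Definition diag_coef s w : rat :=
  (basis_mx *m translate_mx s *m invmx basis_mx) (enum_rank w) (enum_rank w).

Lemma trace_span_proj P s : \tr (span_proj P *m translate_mx s) = \sum_(w | P w) diag_coef s w.
Proof.
transitivity (\tr (select_mx P *m (basis_mx *m translate_mx s *m invmx basis_mx))).
  by rewrite /span_proj -!(mulmxA (invmx basis_mx)) mxtrace_mulC !mulmxA.
rewrite /mxtrace (reindex_onto enum_rank enum_val) => [|i _]; last by rewrite enum_valK.
rewrite [RHS]big_mkcond; apply: eq_big => [w|w _]; first by rewrite enum_rankK eqxx.
by rewrite mul_diag_mx [LHS]mxE [X in X * _]mxE enum_rankK; case: (P w); rewrite ?mul1r ?mul0r.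
Qed.

Definition colour_act s y : Y := [ffun j => col_act (s j) (y j)].

Lemma colourX_act R s w : colourX R (perm_act s w) = colour_act s (colourX R w).
Proof. by apply/ffunP=> j; rewrite !ffunE col_actM. Qed.

Lemma delta_colour_map R w : delta_row rat w *m colour_map R = delta_row rat (colourX R w).
Proof.
rewrite -rowE; apply/rowP=> j; rewrite !mxE eqxx enum_rankK /=.
congr (_%:R); congr (nat_of_bool _).
by apply/eqP/eqP => [->|->]; rewrite ?enum_valK ?enum_rankK.
Qed.

Lemma translate_mx_colour R s :
  translate_mx s *m colour_map R = colour_map R *m fun_mx rat xpredT (colour_act s).
Proof.
apply: delta_row_mxP => w; rewrite !mulmxA delta_row_fun_mx scale1r !delta_colour_map.
by rewrite delta_row_fun_mx scale1r colourX_act.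
Qed.

Lemma basis_colour0 R i j : ~~ [disjoint descentsX (enum_val i) & R] ->
  (basis_mx *m colour_map R) i j = 0.
Proof.
move=> dis; rewrite -[RHS](basisX_sum0 (enum_val j) dis).
rewrite mxE (reindex_onto enum_rank enum_val) => [|l _]; last by rewrite enum_valK.
rewrite [RHS]big_mkcond; apply: eq_big => [u|u _]; first by rewrite enum_rankK eqxx.
by rewrite !mxE !enum_rankK; case: eqP; rewrite ?mulr1 ?mulr0.
Qed.

Lemma span_proj_colour R :
  span_proj (fun w => [disjoint descentsX w & R]) *m colour_map R = colour_map R.
Proof.
have h : select_mx (fun w => [disjoint descentsX w & R]) *m (basis_mx *m colour_map R) =
  basis_mx *m colour_map R.
  apply/matrixP=> i j; rewrite mul_diag_mx [LHS]mxE [X in X * _]mxE.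
  have [dis|dis] := boolP [disjoint descentsX (enum_val i) & R]; first by rewrite mul1r.
  by rewrite mul0r basis_colour0.
by rewrite /span_proj -!mulmxA h mulKmx // basis_mx_unit.
Qed.

Lemma span_proj_colour0 R (P : pred X) : (forall w, P w -> ~~ [disjoint descentsX w & R]) ->
  span_proj P *m colour_map R = 0.
Proof.
move=> hP; have h : select_mx P *m (basis_mx *m colour_map R) = 0.
  apply/matrixP=> i j; rewrite mul_diag_mx [LHS]mxE [X in X * _]mxE [RHS]mxE.
  have [dis|_] := boolP (P (enum_val i)); last by rewrite mul0r.
  by rewrite mul1r basis_colour0 // hP.
by rewrite /span_proj -!mulmxA h mulmx0.
Qed.

Lemma span_proj_kernel R m (z : 'M_(m, _)) : z *m colour_map R = 0 ->
  z *m span_proj (fun w => [disjoint descentsX w & R]) = 0.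
Proof.
move=> h; apply/row_matrixP => l; rewrite row_mul row0; set r := row l z.
have hr : r *m colour_map R = 0 by rewrite -row_mul h row0.
rewrite /span_proj !mulmxA; set y := r *m invmx basis_mx.
suff -> : y *m select_mx (fun w => [disjoint descentsX w & R]) = 0 by rewrite mul0mx.
apply/rowP=> i; rewrite -[i]enum_valK row_select_mx [RHS]mxE.
have [dis|dis] := boolP [disjoint _ & R]; last by rewrite mulr0.
rewrite mulr1; apply: basis_mx_kernel dis.
by rewrite /y mulmxKV ?basis_mx_unit.
Qed.

(** Modulo the kernel of [colour_map R], the basis vectors without descent in R form a basis of the
    image. Their diagonal entries add up to the trace on that image, a permutation module, where it
    counts fixed points. *)
Lemma sum_diag_coef R s :
  \sum_(w | [disjoint descentsX w & R]) diag_coef s w =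
  \sum_(y | colour_act s y == y) (y \in codom (colourX R))%:R.
Proof.
rewrite -trace_span_proj -trace_fun_mx.
set P := span_proj _; set f := translate_mx s; set Q := colour_map R.
set g := fun_mx rat xpredT (colour_act s).
have fQ : f *m Q = Q *m g by exact: translate_mx_colour.
have PQ : P *m Q = Q by exact: span_proj_colour.
have QK : Q *m pinvmx Q *m Q = Q by rewrite mulmxKpV.
have e1 : Q *m pinvmx Q *m P = P.
  apply/eqP; rewrite -subr_eq0 -[X in _ - X]mul1mx -mulmxBl; apply/eqP.
  by apply: span_proj_kernel; rewrite mulmxBl QK mul1mx subrr.
(* Both [pinvmx Q *m Q] and this coordinate projection have as row space the span of the colourings
   that occur; the second has a trace that can be counted. *)
pose E2 := fun_mx rat (fun y => y \in codom (colourX R)) id.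
have QE2 : Q *m E2 = Q.
  apply: delta_row_mxP => w; rewrite mulmxA delta_colour_map delta_row_fun_mx /=.
  by rewrite codom_f scale1r.
have E2Q : E2 *m (pinvmx Q *m Q) = E2.
  apply: delta_row_mxP => y; rewrite mulmxA delta_row_fun_mx -scalemxAl.
  have [/codomP[w ->]|_] := boolP (y \in codom (colourX R)); last by rewrite !scale0r.
  by rewrite !scale1r -delta_colour_map -/Q -(mulmxA (delta_row rat w)) (mulmxA Q (pinvmx Q)) QK.
transitivity (\tr ((pinvmx Q *m Q) *m g)).
  rewrite -[in LHS]e1 -(mulmxA _ P) -(mulmxA Q) mxtrace_mulC -(mulmxA _ _ Q) -(mulmxA P) fQ
    (mulmxA P) PQ.
  by rewrite mulmxA.
rewrite (trace_projection (E2 := E2)).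
- congr (\tr _); apply: delta_row_mxP => y; rewrite mulmxA !delta_row_fun_mx -scalemxAl.
  by rewrite delta_row_fun_mx scale1r.
- by rewrite -(mulmxA _ Q) -fQ -!mulmxA QE2.
- exact: E2Q.
Qed.

End TensorBasis.

(** * Maximal chains and top cycles *)

Section MaximalChains.
Variables (t k : nat).
Hypothesis t_gt0 : (0 < t)%N.
Local Notation n := k.+1.
Local Notation X := {ffun 'I_t -> 'S_n}.
Local Notation V := (segre_proper t n).
Local Notation le := (@segre_le t n).
Local Notation elem := {ffun 'I_t -> {set 'I_n}}.
Implicit Types (w u : X) (i : 'I_k).

Let j0 : 'I_t := Ordinal t_gt0.

Definition level (w : 'S_n) (i : nat) : {set 'I_n} := [set v | (w^-1%g v <= i)%N].
(** Index i stands for rank i + 1, so ['I_k] runs over the proper ranks 1, ..., n - 1. *)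
Definition chain_elem w i : elem := [ffun j => level (w j) i].
Definition chain w : {set elem} := [set chain_elem w i | i : 'I_k].

Lemma card_level (w : 'S_n) i : #|level w i| = i.+1.
Proof.
have hi : (i.+1 <= n)%N by rewrite ltnS ltnW.
rewrite -[RHS](card_ord_ltn hi) -[RHS](card_imset _ (@perm_inj _ w)).
apply: eq_card => v; rewrite inE; apply/idP/imsetP => [h|[p]].
  by exists (w^-1%g v); rewrite ?inE // permKV.
by rewrite inE ltnS => h ->; rewrite permK.
Qed.

Lemma chain_elem_card w i j : #|chain_elem w i j| = i.+1.
Proof. by rewrite ffunE card_level. Qed.

Lemma chain_elem_inj w u i i' : chain_elem w i = chain_elem u i' -> i = i'.
Proof.
move=> /ffunP/(_ j0)/(congr1 (fun A : {set _} => #|A|)).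
by rewrite !chain_elem_card => -[/ord_inj].
Qed.

Lemma chain_elem_le w i i' : le (chain_elem w i) (chain_elem w i') = (i <= i')%N.
Proof.
apply/forallP/idP => [/(_ j0)/subset_leq_card|h j]; first by rewrite !chain_elem_card.
by rewrite !ffunE; apply/subsetP=> v; rewrite !inE => hv; exact: leq_trans hv h.
Qed.

Lemma chain_is_simplex w : is_simplex le V k (chain w).
Proof.
apply/and3P; split.
- apply/subsetP=> x /imsetP[i _ ->]; rewrite !inE; apply/and3P; split.
  + apply/eqP => /ffunP/(_ j0)/(congr1 (fun A : {set _} => #|A|)).
    by rewrite chain_elem_card ffunE cardsT card_ord => -[e]; have := ltn_ord i; rewrite e ltnn.
  + apply/eqP => /ffunP/(_ j0)/(congr1 (fun A : {set _} => #|A|)).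
    by rewrite chain_elem_card ffunE cards0.
  + by apply/forallP=> j; apply/forallP=> j'; rewrite !chain_elem_card.
- apply/forallP=> x; apply/implyP=> /imsetP[i _ ->].
  apply/forallP=> y; apply/implyP=> /imsetP[i' _ ->].
  by rewrite !chain_elem_le leq_total.
- by rewrite card_imset ?card_ord // => i i' /chain_elem_inj.
Qed.

Definition chain_simplex w : simplex le V k := exist _ (chain w) (chain_is_simplex w).

(** The block index of a value counts the levels outside R that miss it, so the levels kept and the
    blocks determine each other. *)
Lemma chain_elemP (R : {set 'I_k}) w u : (forall i, i \notin R ->
  chain_elem w i = chain_elem u i) <->
  colourX R w = colourX R u.
Proof.
split=> [h|/ffunP h i iR].
  apply/ffunP=> j; apply/ffunP=> v; rewrite !ffunE; congr inord.
  apply: eq_card => i; rewrite !inE andbC [RHS]andbC; case: (boolP (i \in R)) => //= iR.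
  have /ffunP/(_ j)/setP/(_ v) := h i iR; rewrite !ffunE !inE !ltnNge => ->.
  by [].
apply/ffunP=> j; apply/setP=> v; rewrite !ffunE !inE [LHS]leqNgt [RHS]leqNgt; congr (~~ _).
have /ffunP/(_ v) := h j; rewrite !ffunE => e.
have {}e : block R ((w j)^-1%g v) = block R ((u j)^-1%g v) by rewrite !ffunE.
by rewrite !(block_separator _ iR) e.
Qed.

(** A facet reveals the rank it lacks, so facets lacking different ranks never coincide. *)
Lemma chainD1_eq w u i i' :
  (chain w :\ chain_elem w i == chain u :\ chain_elem u i') =
  (i == i') && (colourX [set i] w == colourX [set i] u).
Proof.
apply/eqP/andP => [e|[/eqP <- /eqP/chain_elemP h]].
  have ii' : i = i'.
    apply/eqP/contraT => ne.
    have : chain_elem w i' \in chain w :\ chain_elem w i.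
      by rewrite !inE imset_f // andbT; apply: contra ne => /eqP/chain_elem_inj ->.
    rewrite e !inE => /andP[ne' /imsetP[l _ el]]; case/eqP: ne'.
    by rewrite el; congr chain_elem; rewrite (chain_elem_inj el).
  split; first by rewrite ii'.
  apply/eqP/chain_elemP => l; rewrite inE => li.
  have : chain_elem w l \in chain w :\ chain_elem w i.
    by rewrite !inE imset_f // andbT; apply: contra li => /eqP/chain_elem_inj ->.
  by rewrite e !inE => /andP[_ /imsetP[l' _ el]]; rewrite el (chain_elem_inj el).
apply/setP=> x; rewrite !inE; apply/andP/andP => -[xi /imsetP[l _ ex]]; subst x.
  have li : l \notin [set i] by rewrite inE; apply: contra xi => /eqP ->.
  rewrite (h l li); split; last exact: imset_f.
  by apply: contra li => /eqP/chain_elem_inj ->; rewrite inE.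
have li : l \notin [set i] by rewrite inE; apply: contra xi => /eqP ->.
rewrite -(h l li); split; last exact: imset_f.
by apply: contra li => /eqP/chain_elem_inj ->; rewrite inE.
Qed.

Lemma boundary_coef_chain u (D : {set elem}) :
  boundary_coef le (chain u) D = \sum_i (D == chain u :\ chain_elem u i)%:R * (-1) ^+ i.
Proof.
rewrite /boundary_coef big_mkcondr big_imset /=; last by move=> i i' _ _ /chain_elem_inj.
apply: eq_bigr => i _; case: eqP; rewrite ?mul0r // mul1r => _; congr (_ ^+ _).
rewrite -[RHS](@card_ord_ltn k i) 1?ltnW //.
rewrite -[RHS](@card_imset _ _ (chain_elem u)); last by move=> a b /chain_elem_inj.
apply: eq_card => x; rewrite !inE; apply/and3P/imsetP => [[/imsetP[l _ ->] ne]|[l]].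
  rewrite chain_elem_le => li; exists l => //; rewrite inE ltn_neqAle li andbT.
  by apply: contra ne => /eqP/ord_inj ->.
rewrite inE => li ->; rewrite imset_f // chain_elem_le ltnW //; split=> //.
by apply: contraTneq li => /chain_elem_inj ->; rewrite ltnn.
Qed.

Lemma chain_inj : injective chain.
Proof.
move=> w u e.
have h i : i \notin set0 -> chain_elem w i = chain_elem u i.
  move=> _; have : chain_elem w i \in chain u by rewrite -e imset_f.
  by move=> /imsetP[l _ el]; rewrite el (chain_elem_inj el).
have /ffunP hc := (chain_elemP set0 w u).1 h.
apply/ffunP=> j; apply: invg_inj; apply/permP=> v; apply: ord_inj.
have /ffunP/(_ v) := hc j; rewrite !ffunE => e'.
have {}e' : block set0 ((w j)^-1%g v) = block set0 ((u j)^-1%g v) by rewrite !ffunE.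
apply/eqP; rewrite eqn_leq; apply/andP; split; rewrite leqNgt; apply/negP => lt.
  have hi : ((u j)^-1%g v < k)%N by rewrite -ltnS; apply: leq_trans lt _; rewrite -ltnS ltn_ord.
  by have := @block_same _ _ _ _ (Ordinal hi) (esym e') (leqnn _) lt; rewrite inE.
have hi : ((w j)^-1%g v < k)%N by rewrite -ltnS; apply: leq_trans lt _; rewrite -ltnS ltn_ord.
by have := @block_same _ _ _ _ (Ordinal hi) e' (leqnn _) lt; rewrite inE.
Qed.

Lemma simplex_rank m (C : {set elem}) : is_simplex le V m C ->
  [/\ forall (x : elem) j j', x \in C -> #|x j| = #|x j'|,
     forall x y : elem, x \in C -> y \in C -> le x y \/ le y x,
     forall x y : elem, x \in C -> y \in C -> #|x j0| = #|y j0| -> x = y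
   & forall x : elem, x \in C -> (0 < #|x j0| <= k)%N].
Proof.
case/and3P=> /subsetP CV /forallP hcomp _.
have ranks x j j' : x \in C -> #|x j| = #|x j'|.
  by move=> /CV; rewrite !inE => /and3P[_ _ /forallP/(_ j)/forallP/(_ j')/eqP].
have comp x y : x \in C -> y \in C -> le x y \/ le y x.
  move=> xC yC; have /implyP/(_ xC)/forallP/(_ y)/implyP/(_ yC)/orP := hcomp x; exact.
have le_eq x y : x \in C -> y \in C -> le x y -> #|x j0| = #|y j0| -> x = y.
  move=> xC yC /forallP xy e; apply/ffunP=> j; apply/eqP; rewrite eqEcard xy /=.
  by rewrite (ranks x j j0) // (ranks y j j0) // e.
split=> // [x y xC yC e|x xC].
  case: (comp x y xC yC) => h; first exact: le_eq.
  by apply/esym/le_eq.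
have := CV x xC; rewrite !inE => /and3P[nT n0 _]; apply/andP; split.
  rewrite lt0n; apply: contra n0 => /eqP e; apply/eqP/ffunP=> j; rewrite ffunE.
  by apply/eqP; rewrite -cards_eq0 (ranks x j j0) // e.
rewrite -ltnS ltn_neqAle -[X in (_ <= X)%N](card_ord n) max_card andbT.
apply: contra nT => /eqP e; apply/eqP/ffunP=> j; rewrite ffunE; apply/eqP.
by rewrite eqEcard subsetT cardsT (ranks x j j0) // e ?card_ord leqnn.
Qed.

Lemma simplex_card m (C : {set elem}) : is_simplex le V m C -> (m <= k)%N.
Proof.
move=> hC; have [_ _ inj rng] := simplex_rank hC; have /and3P[_ _ /eqP <-] := hC.
have rk_lt (x : elem) : (#|x j0| < n.+1)%N by rewrite ltnS -[X in (_ <= X)%N](card_ord n) max_card.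
rewrite -(card_in_imset (f := fun x : elem => Ordinal (rk_lt x))) => [|x y xC yC [e]];
  last exact: inj.
rewrite -[X in (_ <= X)%N]/(n.-1) -[X in (_ <= X.-1)%N](@card_ord_ltn n.+1 n) //.
have o0 : ord0 \in [set i : 'I_n.+1 | i < n]%N by rewrite inE.
rewrite [X in (_ <= X.-1)%N](cardsD1 ord0) o0 /=; apply: subset_leq_card.
apply/subsetP=> p /imsetP[x /rng/andP[h1 h2] ->]; rewrite !inE -val_eqE /= -lt0n h1.
by rewrite ltnS.
Qed.

(** The k elements have distinct ranks among 1, ..., k and so take each once. In each coordinate the
    position of a value is the number of elements that miss it; the sets grow by one value at a
    time, so positions are distinct. *)
Lemma chain_surj (C : simplex le V k) : exists w, chain w = val C.
Proof.
case: C => C /= hC; have [ranks comp rk_inj rk_range] := simplex_rank hC.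
have /and3P[_ _ /eqP cardC] := hC.
pose rk (x : elem) : 'I_n := inord #|x j0|.
have rkE x : x \in C -> rk x = #|x j0| :> nat.
  by move=> /rk_range /andP[_ h]; rewrite inordK.
have rk_image : rk @: C = [set p : 'I_n | p != ord0].
  apply/eqP; rewrite eqEcard; apply/andP; split.
    apply/subsetP=> p /imsetP[x xC ->]; rewrite inE -val_eqE /= rkE // -lt0n.
    by case/andP: (rk_range x xC).
  rewrite card_in_imset ?cardC => [|x y xC yC /(congr1 val) /=]; last by rewrite !rkE //;
    apply: rk_inj.
  have -> : [set p : 'I_n | p != ord0] = ~: [set ord0] by apply/setP=> p; rewrite !inE.
  by rewrite cardsC1 card_ord.
have ex i : exists x, (x \in C) && (#|x j0| == i.+1).
  have : lift ord0 i \in rk @: C by rewrite rk_image inE -val_eqE.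
  by case/imsetP=> x xC e; exists x; rewrite xC -rkE // -e lift0 eqxx.
pose c i := xchoose (ex i).
have cC i : c i \in C by case/andP: (xchooseP (ex i)).
have crk i j : #|c i j| = i.+1 by rewrite (ranks _ j j0) //; case/andP: (xchooseP (ex i)) => _ /eqP.
have cle (i i' : 'I_k) j : (i <= i')%N -> c i j \subset c i' j.
  move=> ii'; case: (comp (c i) (c i') (cC i) (cC i')) => [/forallP//|/forallP h].
  have := subset_leq_card (h j); rewrite !crk ltnS => ii.
  by have -> : i = i' by apply: ord_inj; apply/eqP; rewrite eqn_leq ii' ii.
pose A j v := [set i : 'I_k | v \notin c i j].
have posP j v i : (v \in c i j) = (#|A j v| <= i)%N.
  rewrite leqNgt -mem_ord_downset ?inE ?negbK // => a b ab; rewrite !inE.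
  by apply: contra; apply/subsetP/cle.
have pos_lt j v : (#|A j v| < n)%N by rewrite ltnS -[X in (_ <= X)%N](card_ord k) max_card.
pose pos j v : 'I_n := Ordinal (pos_lt j v).
have cnt j (m : nat) : (m <= k)%N -> #|[set v | pos j v <= m]%N| = m.+1.
  rewrite leq_eqVlt => /orP[/eqP ->|hm].
    rewrite (_ : [set v | _] = setT) ?cardsT ?card_ord //; apply/setP=> v; rewrite !inE.
    by rewrite -ltnS ltn_ord.
  by rewrite -(crk (Ordinal hm) j); apply: eq_card => v; rewrite inE posP.
have cnt_lt j (m : nat) : (m <= k)%N -> #|[set v | pos j v < m]%N| = m.
  case: m => [|m] hm; first by apply: eq_card0 => v; rewrite inE ltn0.
  by rewrite -[RHS](cnt j m (ltnW hm)); apply: eq_card => v; rewrite !inE ltnS.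
have pos_inj j : injective (pos j).
  move=> v v' e; apply/eqP/contraT => ne.
  have hm : (pos j v <= k)%N by rewrite -ltnS ltn_ord.
  have sub : v |: (v' |: [set x | pos j x < pos j v]%N) \subset [set x | pos j x <= pos j v]%N.
    apply/subsetP=> x; rewrite !inE => /or3P[/eqP ->|/eqP ->|/ltnW //]; first exact: leqnn.
    by rewrite e leqnn.
  have := subset_leq_card sub; rewrite cnt // !cardsU1 cnt_lt //.
  have -> : v \notin v' |: [set x | pos j x < pos j v]%N by rewrite !inE negb_or ne ltnn.
  have -> : v' \notin [set x | pos j x < pos j v]%N by rewrite e inE ltnn.
  by rewrite !add1n ltnn.
exists [ffun j => (perm (@pos_inj j))^-1%g].
have ce i : chain_elem [ffun j => (perm (@pos_inj j))^-1%g] i = c i.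
  apply/ffunP=> j; rewrite !ffunE; apply/setP=> v; rewrite inE invgK permE.
  by rewrite posP.
have imC : chain [ffun j => (perm (@pos_inj j))^-1%g] \subset C.
  by apply/subsetP=> x /imsetP[i _ ->]; rewrite ce cC.
apply/eqP; rewrite eqEcard imC cardC.
by have /and3P[_ _ /eqP ->] := chain_is_simplex [ffun j => (perm (@pos_inj j))^-1%g];
  rewrite /= leqnn.
Qed.

Lemma segre_act_chain (s w : X) : segre_act s @: chain w = chain (perm_act s w).
Proof.
rewrite -imset_comp; apply: eq_imset => i /=; apply/ffunP=> j; rewrite !ffunE.
apply/setP=> v; rewrite inE invMg permM; apply/imsetP/idP => [[p]|h].
  by rewrite inE => h ->; rewrite permK.
by exists ((s j)^-1%g v); rewrite ?inE // permKV.
Qed.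

Lemma simplex_chain : exists2 tau : simplex le V k -> X,
  cancel chain_simplex tau & cancel tau chain_simplex.
Proof.
have /fin_all_exists[tau htau] (C : simplex le V k) := chain_surj C.
exists tau => [w|C]; first by apply: chain_inj; rewrite htau.
by apply: val_inj; rewrite /= htau.
Qed.

Section TopHomology.
Variable tau : simplex le V k -> X.
Hypotheses (chainK : cancel chain_simplex tau) (tauK : cancel tau chain_simplex).
Local Notation S := {: simplex le V k}.
Local Notation bd := (boundary le V k).
Implicit Types z : 'rV[rat]_#|S|.

Definition chain_mx : 'M[rat]_(#|S|, #|{: X}|) :=
  \matrix_(i, j) (tau (enum_val i) == enum_val j)%:R.

Lemma delta_chain_mx C : delta_row rat C *m chain_mx = delta_row rat (tau C).
Proof.
rewrite -rowE; apply/rowP=> j; rewrite !mxE eqxx enum_rankK /=.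
congr (_%:R); congr (nat_of_bool _).
by apply/eqP/eqP => [->|->]; rewrite ?enum_valK ?enum_rankK.
Qed.

Lemma delta_chain_mxT w : delta_row rat w *m chain_mx^T = delta_row rat (chain_simplex w).
Proof.
rewrite -rowE; apply/rowP=> j; rewrite !mxE eqxx enum_rankK /=.
congr (_%:R); congr (nat_of_bool _).
by apply/eqP/eqP => [<-|->]; rewrite ?tauK ?enum_valK ?enum_rankK ?chainK.
Qed.

Lemma chain_mxK : chain_mx *m chain_mx^T = 1%:M.
Proof. by apply: delta_row_mxP => C; rewrite mulmxA delta_chain_mx delta_chain_mxT tauK mulmx1. Qed.

Lemma chain_mxTK : chain_mx^T *m chain_mx = 1%:M.
Proof. by apply: delta_row_mxP => w;
  rewrite mulmxA delta_chain_mxT delta_chain_mx chainK mulmx1. Qed.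

Lemma row_chain_mx z w : (z *m chain_mx) 0 (enum_rank w) = z 0 (enum_rank (chain_simplex w)).
Proof.
rewrite mxE (bigD1 (enum_rank (chain_simplex w))) //= big1 ?addr0 => [|i hi].
  by rewrite mxE !enum_rankK chainK eqxx mulr1.
rewrite mxE enum_rankK; case: eqP => [e|]; last by rewrite mulr0.
by case/eqP: hi; rewrite -e tauK enum_valK.
Qed.

Lemma row_boundary z (D : simplex le V k.-1) : (z *m bd) 0 (enum_rank D) =
  \sum_(i < k) (-1) ^+ i * \sum_(u | val D == chain u :\ chain_elem u i) z 0 (enum_rank
    (chain_simplex u)).
Proof.
rewrite mxE (reindex (fun u => enum_rank (chain_simplex u))); last first.
  exists (fun l : 'I_#|S| => tau (enum_val l)) => l _; first by rewrite enum_rankK chainK.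
  by rewrite tauK enum_valK.
under eq_bigr do rewrite mxE !enum_rankK boundary_coef_chain mulr_sumr.
rewrite exchange_big /=; apply: eq_bigr => i _.
rewrite [in RHS]big_mkcond mulr_sumr; apply: eq_bigr => u _.
by case: eqP; rewrite ?mul1r ?mul0r ?mulr0 // mulrC.
Qed.

(** Each facet lacks a definite rank i, so its coefficient in the boundary is, up to the sign
    (-1)^i, one fibre sum of the map forgetting i, and different ranks cannot cancel. *)
Lemma boundary_kernel z : z *m bd = 0 <-> forall i, z *m chain_mx *m colour_map t [set i] = 0.
Proof.
have sumE w i : \sum_(u | chain w :\ chain_elem w i == chain u :\ chain_elem u i)
     z 0 (enum_rank (chain_simplex u)) =
   (z *m chain_mx *m colour_map t [set i]) 0 (enum_rank (colourX [set i] w)).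
  rewrite row_colour_map; apply: eq_big => [u|u _]; last by rewrite row_chain_mx.
  by rewrite chainD1_eq eqxx /= eq_sym.
split=> [h i|h].
  apply/rowP=> l; rewrite -[l]enum_valK [RHS]mxE; set y := enum_val l.
  have [/codomP[w ->]|hy] := boolP (y \in codom (colourX [set i])); last first.
    rewrite row_colour_map big1 // => u /eqP e; case/negP: hy; rewrite -e; exact: codom_f.
  have hD : is_simplex le V k.-1 (chain w :\ chain_elem w i).
    have /and3P[h1 h2 /eqP h3] := chain_is_simplex w; apply/and3P; split.
    - by apply: subset_trans h1; exact: subsetDl.
    - apply/forallP=> x; apply/implyP; rewrite inE => /andP[_ xC].
      apply/forallP=> x'; apply/implyP; rewrite inE => /andP[_ xC'].
      by have /forallP/(_ x)/implyP/(_ xC)/forallP/(_ x')/implyP := h2; exact.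
    - by move: h3; rewrite (cardsD1 (chain_elem w i)) imset_f // => e; rewrite -[X in _ == X.-1]e.
  pose D : simplex le V k.-1 := exist (fun C => is_simplex le V k.-1 C) _ hD.
  have := congr1 (fun M : 'rV_#|{: simplex le V k.-1}| => M 0 (enum_rank D)) h.
  rewrite row_boundary [RHS]mxE /= (bigD1 i) //= [X in _ + X]big1 ?addr0 => [|i' i'i].
    rewrite sumE => /eqP; rewrite mulf_eq0 signr_eq0 => /eqP; exact.
  by rewrite big_pred0 ?mulr0 // => u; rewrite chainD1_eq eq_sym (negPf i'i).
apply/rowP=> l; rewrite -[l]enum_valK row_boundary [RHS]mxE big1 // => i _.
have [/existsP[w /eqP ->]|hn] := boolP [exists w, val (enum_val l) == chain w :\ chain_elem w i].
  by rewrite sumE h mxE mulr0.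
rewrite big_pred0 ?mulr0 // => u; apply/negP => e; case/negP: hn.
by apply/existsP; exists u.
Qed.

Lemma simplex_act_chain s : simplex_act le V k (segre_act s) *m chain_mx =
  chain_mx *m translate_mx s.
Proof.
apply: delta_row_mxP => C; rewrite !mulmxA delta_chain_mx delta_row_fun_mx scale1r.
have -> : delta_row rat C *m simplex_act le V k (segre_act s) =
    delta_row rat (chain_simplex (perm_act s (tau C))).
  rewrite -rowE; apply/rowP=> j; rewrite !mxE eqxx enum_rankK /=.
  congr (_%:R); congr (nat_of_bool _).
  have -> : segre_act s @: val C = val (chain_simplex (perm_act s (tau C))).
    by rewrite /= -segre_act_chain -[in LHS](tauK C).
  rewrite val_eqE; by apply/eqP/eqP => [->|->]; rewrite ?enum_valK ?enum_rankK.
by rewrite delta_chain_mx chainK.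
Qed.

(** A cycle is killed by every map forgetting one rank, so only the w with a descent at each rank
    occur in it. For k = 0 the condition is empty and the single w accounts for the homology of
    degree -1 at n = 1. *)
Lemma top_homology_trace s : homology_trace le V k (segre_act s) =
  \sum_(w | descentsX w == setT) diag_coef s w.
Proof.
rewrite -trace_span_proj; set sp := span_proj _.
have spc i : sp *m colour_map t [set i] = 0.
  apply: span_proj_colour0 => w /eqP ->; rewrite -setI_eq0 setTI.
  by apply/set0Pn; exists i; rewrite inE.
rewrite /homology_trace (@quotient_trace_sub0 _ _ _ (chain_mx *m sp *m chain_mx^T)).
- rewrite -!mulmxA mxtrace_mulC -!mulmxA simplex_act_chain (mulmxA chain_mx^T).
  by rewrite chain_mxTK mul1mx.
(* No chain has k + 1 elements, so there are no boundaries to divide by. *)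
- suff -> : boundary le V k.+1 = 0 by rewrite genmx0.
  apply/matrixP=> i; have := valP (enum_val i).
  by move=> /simplex_card; rewrite ltnn.
- apply/sub_kermxP; apply/row_matrixP => l; rewrite row_mul row0; apply/boundary_kernel => i.
  by rewrite -!row_mul -!(mulmxA (chain_mx *m sp)) chain_mxTK mul1mx -mulmxA spc mulmx0 row0.
- apply/row_matrixP => l; rewrite row_mul; set z := row l _.
  have /boundary_kernel hz : z *m bd = 0 by rewrite -row_mul mulmx_ker row0.
  suff e : z *m chain_mx *m sp = z *m chain_mx.
    by rewrite (mulmxA z) (mulmxA z chain_mx) e -mulmxA chain_mxK mulmx1.
  set z' := z *m chain_mx; set y := z' *m invmx (basis_mx t k).
  have ez : z' = y *m basis_mx t k by rewrite mulmxKV // basis_mx_unit.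
  rewrite /sp /span_proj !mulmxA -/y [RHS]ez; congr (_ *m _).
  apply/rowP=> i; rewrite -[i]enum_valK row_select_mx.
  have [_|ne] := eqVneq (descentsX (enum_val i)) setT; first by rewrite mulr1.
  rewrite mulr0; apply/esym.
  have [p hp] : exists p, p \notin descentsX (enum_val i).
    by move: ne; rewrite -subTset => /subsetPn[p _ hp]; exists p.
  apply: (@basis_mx_kernel _ _ _ [set p]); first by rewrite -ez hz.
  by rewrite disjoint_sym disjoints1.
- apply/sub_kermxP; apply/row_matrixP => l; rewrite row_mul row0; apply/boundary_kernel => i.
  rewrite row_mul -(mulmxA (row l _)) simplex_act_chain mulmxA -mulmxA translate_mx_colour mulmxA.
  set z := row l _.
  have /boundary_kernel hz : z *m bd = 0 by rewrite -row_mul mulmx_ker row0.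
  by rewrite hz mul0mx.
Qed.

End TopHomology.
End MaximalChains.

(** * The character of the top homology and the recursion *)

Section HomologyCharacter.
Variables (t k : nat).
Hypothesis t_gt0 : (0 < t)%N.
Local Notation n := k.+1.
Implicit Types (R : {set 'I_k}) (s : {ffun 'I_t -> 'S_n}) (r : {ffun 'I_k -> bool}).

(** The composition of n into block sizes, padded with zeros to n parts. *)
Definition block_monom R : 'X_{1..n} := [multinom count_colour (block R) c | c < n].

Lemma mdeg_block_monom R : mdeg (block_monom R) = n.
Proof.
rewrite mdegE -[RHS](sum_count_colour (block R)).
by apply: eq_bigr => c _; rewrite mnmE.
Qed.

Lemma count_fixed_colourings R s :
  \sum_(y | colour_act s y == y) (y \in codom (colourX R))%:R =
  \prod_j perm_char (block_monom R) (s j).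
Proof.
under [RHS]eq_bigr do rewrite perm_charE.
rewrite bigA_distr_big_dep; apply: eq_big => [y|y _].
  apply/eqP/familyP => [/ffunP e j|h].
    rewrite unfold_in; apply/fixesP=> v; have := e j; rewrite !ffunE => /ffunP/(_ (s j v)).
    by rewrite ffunE permK.
  apply/ffunP=> j; rewrite ffunE; apply/ffunP=> v; rewrite ffunE.
  have := h j; rewrite unfold_in => /fixesP hj.
  by rewrite -[in RHS](permKV (s j) v) hj.
have -> : (y \in codom (colourX R)) = [forall j, forall c, count_colour (y j) c == block_monom R c].
  apply/codomP/forallP => [[w -> j]|h].
    by apply/forallP=> c; rewrite mnmE ffunE count_colour_perm.
  have /fin_all_exists[p hp] (j : 'I_t) : exists p : 'S_n, y j = [ffun v => block R (p v)].
    apply: same_count_colour => c; have /forallP/(_ c)/eqP := h j.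
    by rewrite mnmE => ->.
  exists [ffun j => (p j)^-1%g]; apply/ffunP=> j; rewrite hp !ffunE.
  by apply/ffunP=> v; rewrite !ffunE invgK.
have [/forallP h|] := boolP [forall j, forall c, count_colour (y j) c == block_monom R c].
  by rewrite big1 // => j _; rewrite h.
by rewrite negb_forall => /existsP[j /negPf hj]; rewrite (bigD1 j) //= hj mul0r.
Qed.

Lemma segre_char_expand s : segre_top_homology_char s =
  \sum_(r : {ffun 'I_k -> bool}) (\prod_i (if r i then -1 else 1)) *
     \prod_j perm_char (block_monom [set i | r i]) (s j).
Proof.
have [tau chainK tauK] := simplex_chain k t_gt0.
rewrite /segre_top_homology_char /= (top_homology_trace chainK tauK).
transitivity (\sum_w diag_coef s w * \sum_(r : {ffun 'I_k ->
  bool}) (\prod_i (if r i then -1 else 1)) *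
    [disjoint descentsX w & [set i | r i]]%:R).
  rewrite big_mkcond; apply: eq_bigr => w _.
  (* The indicator of a full descent set is the product over i of 1 - [i is not a descent].
     Expanding it, with R the set of i where the second term is taken, gives the signed indicators
     of disjointness from R. *)
  transitivity (diag_coef s w * \prod_(i < k) \sum_(b : bool)
      (if b then - (i \notin descentsX w)%:R else 1)).
    have [->|ne] := eqVneq (descentsX w) setT.
      by rewrite big1 ?mulr1 // => i _; rewrite big_bool /= inE oppr0 add0r.
    have [p hp] : exists p, p \notin descentsX w.
      by move: ne; rewrite -subTset => /subsetPn[p _ hp]; exists p.
    by rewrite (bigD1 p) //= big_bool /= hp addNr mul0r mulr0.
  rewrite bigA_distr_bigA /=; congr (_ * _); apply: eq_bigr => r _.
  have [dis|] := boolP [disjoint descentsX w & [set i | r i]].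
    rewrite mulr1; apply: eq_bigr => i _; case: ifP => // ri.
    by rewrite (disjointFl dis) ?inE.
  rewrite -setI_eq0 => /set0Pn[i]; rewrite !inE => /andP[iw ri].
  by rewrite (bigD1 i) //= ri inE iw oppr0 mul0r mulr0.
under [LHS]eq_bigr do rewrite mulr_sumr.
rewrite [LHS]exchange_big; apply: eq_bigr => r _ /=.
under [LHS]eq_bigr do rewrite mulrCA.
rewrite -mulr_sumr; congr (_ * _).
rewrite -count_fixed_colourings -sum_diag_coef [RHS]big_mkcond; apply: eq_bigr => w _.
by case: ifP; rewrite ?mulr1 ?mulr0.
Qed.

(** Existence of a decomposition is what guarantees that the coefficients chosen in [irr_coef] form
    one. *)
Lemma segre_char_decomposition : exists a, char_decomposition (@segre_top_homology_char t n) a.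
Proof.
exists (fun la => \sum_(r : {ffun 'I_k -> bool}) (\prod_i (if r i then -1 else 1)) *
   \prod_j (schur_poly n (la j))@_(block_monom [set i | r i])) => s.
rewrite segre_char_expand.
under [RHS]eq_bigr do rewrite mulr_suml.
rewrite [RHS]exchange_big; apply: eq_bigr => r _ /=.
under [RHS]eq_bigr do rewrite -mulrA -big_split /=.
rewrite -mulr_sumr; congr (_ * _).
under eq_bigr do rewrite perm_char_specht //.
by rewrite bigA_distr_bigA.
Qed.

End HomologyCharacter.

Section Frobenius.
Variables (t n N : nat).
Hypothesis n_gt0 : (0 < n)%N.

HB.instance Definition _ (j : 'I_t) := GRing.LRMorphism.copy (@in_alphabet t N j)
  (comp_mpoly [tuple 'X_(mxvec_index j k) | k < N]).

(** The right side involves no coefficients, so every decomposition that [epsilon] may choose yields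
    the same value. *)
Lemma Pch_powersum (chi : {ffun 'I_t -> 'S_n} -> rat) :
  (exists a, char_decomposition chi a) ->
  (n`! ^ t)%:R *: Pch chi N =
  \sum_s chi s *: \prod_(j < t) in_alphabet j (power_poly N (s j)).
Proof.
move=> /(ClassicalEpsilon.epsilon_spec (inhabits (fun=> 0))); rewrite -/(irr_coef chi) => h.
under [RHS]eq_bigr do rewrite h scaler_suml.
rewrite exchange_big /Pch scaler_sumr; apply: eq_bigr => la _ /=.
under [RHS]eq_bigr do rewrite -scalerA -scaler_prod.
rewrite -scaler_sumr scalerA mulrC -scalerA; congr (_ *: _).
rewrite -(bigA_distr_bigA (fun j s => specht_char (la j) s *: in_alphabet j (power_poly N s))).
have e j : \sum_(s : 'S_n) specht_char (la j) s *: in_alphabet j (power_poly N s) =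
    n`!%:R *: schur j (la j) N.
  rewrite /schur -linearZ /= -frobenius_specht // linear_sum.
  by apply: eq_bigr => s _; rewrite linearZ.
under [RHS]eq_bigr do rewrite e.
by rewrite scaler_prod prodr_const card_ord natrX.
Qed.

End Frobenius.

Lemma beta_expand t k N : (0 < t)%N ->
  beta t k.+1 N = \sum_(r : {ffun 'I_k -> bool}) (\prod_i (if r i then -1 else 1)) *
     \prod_(c < k.+1) \prod_(j < t) hsym j (count_colour (block [set i | r i]) c) N.
Proof.
move=> t_gt0; pose n := k.+1.
have f0 : ((n`! ^ t)%:R : rat) != 0 by rewrite Num.Theory.pnatr_eq0 -lt0n expn_gt0 fact_gt0.
apply: (scalerI f0); rewrite /beta Pch_powersum //; last exact: segre_char_decomposition.
under eq_bigr do rewrite segre_char_expand // scaler_suml.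
rewrite exchange_big scaler_sumr; apply: eq_bigr => r _ /=.
under eq_bigr do rewrite -scalerA -scaler_prod.
rewrite -scaler_sumr.
rewrite -(bigA_distr_bigA (fun j s => perm_char (block_monom [set i | r i]) s *: in_alphabet j
  (power_poly N s))).
have e (j : 'I_t) : \sum_(s : 'S_n) perm_char (block_monom [set i | r i]) s *: in_alphabet j
  (power_poly N s) =
    n`!%:R *: \prod_(c < n) hsym j (count_colour (block [set i | r i]) c) N.
  transitivity (in_alphabet j (\sum_(s :
    'S_n) perm_char (block_monom [set i | r i]) s *: power_poly N s)).
    by rewrite linear_sum; apply: eq_bigr => s _; rewrite linearZ.
  rewrite sum_perm_char_power ?mdeg_block_monom // linearZ /= rmorph_prod; congr (_ *: _).
  by apply: eq_bigr => c _; rewrite mnmE.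
rewrite (eq_bigr _ (fun j _ => e j)).
rewrite scaler_prod prodr_const card_ord natrX exchange_big /=.
have -> : \prod_(i < k) (if r i then -1 else 1) =
    (\prod_(i < k) (if r i then -1 else 1))%:MP :> {mpoly rat[t * N]}.
  by rewrite rmorph_prod; apply: eq_bigr => i _; case: (r i); rewrite ?rmorphN rmorph1.
by rewrite mul_mpolyC !scalerA mulrC.
Qed.

(** * Alternating sums over compositions *)

Section CompositionSum.
Variables (R : comNzRingType) (H : nat -> R).
Hypothesis H0 : H 0%N = 1.

(** A composition of k + 1 is coded by its gaps: neighbours i and i + 1 share a part when [r i]
    holds. This restates [block_index] with natural numbers, so that the first gap can be split
    off. *)
Definition merge_index k (r : {ffun 'I_k -> bool}) (p : nat) : nat :=
  \sum_(i < k) ((i < p)%N && ~~ r i).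

Definition merge_count k (r : {ffun 'I_k -> bool}) (c : nat) : nat :=
  \sum_(p < k.+1) (merge_index r p == c).

(* The first block is enlarged by a elements. *)
Definition merge_weight a k (r : {ffun 'I_k -> bool}) : R :=
  \prod_(c < k.+1) H (merge_count r c + (c == 0%N :> nat) * a)%N.

Definition merge_sum a k : R :=
  \sum_(r : {ffun 'I_k -> bool}) (\prod_i (if r i then -1 else 1)) * merge_weight a r.

Definition ffun_cons k (b : bool) (r : {ffun 'I_k -> bool}) : {ffun 'I_k.+1 -> bool} :=
  [ffun i => if unlift ord0 i is Some i' then r i' else b].

Lemma ffun_cons0 k b (r : {ffun 'I_k -> bool}) : ffun_cons b r ord0 = b.
Proof. by rewrite ffunE unlift_none. Qed.

Lemma ffun_consS k b (r : {ffun 'I_k -> bool}) i : ffun_cons b r (lift ord0 i) = r i.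
Proof. by rewrite ffunE liftK. Qed.

Lemma merge_index_cons k b (r : {ffun 'I_k -> bool}) p :
  merge_index (ffun_cons b r) p.+1 = (~~ b + merge_index r p)%N.
Proof.
rewrite /merge_index big_ord_recl ffun_cons0 /=; congr (_ + _)%N.
by apply: eq_bigr => i _; rewrite ffun_consS /bump leq0n add1n ltnS.
Qed.

Lemma merge_index0 k (r : {ffun 'I_k -> bool}) : merge_index r 0 = 0%N.
Proof. by rewrite /merge_index big1. Qed.

Lemma merge_index_le k (r : {ffun 'I_k -> bool}) p : (merge_index r p <= k)%N.
Proof.
rewrite -[X in (_ <= X)%N](card_ord k) -sum1_card; apply: leq_sum => i _.
exact: leq_b1.
Qed.

Lemma merge_count_oob k (r : {ffun 'I_k -> bool}) c : (k < c)%N -> merge_count r c = 0%N.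
Proof.
move=> hc; rewrite /merge_count big1 // => p _.
by rewrite (ltn_eqF (leq_ltn_trans (merge_index_le r p) hc)).
Qed.

Lemma merge_count_cons k b (r : {ffun 'I_k -> bool}) c :
  merge_count (ffun_cons b r) c =
  ((c == 0%N) + if b then merge_count r c else if c is c'.+1 then merge_count r c' else 0)%N.
Proof.
rewrite /merge_count big_ord_recl merge_index0 eq_sym; congr (_ + _)%N.
case: b.
  by apply: eq_bigr => p _; rewrite lift0 merge_index_cons.
case: c => [|c]; first by rewrite big1 // => p _; rewrite lift0 merge_index_cons.
by apply: eq_bigr => p _; rewrite lift0 merge_index_cons.
Qed.

(** A new first position either joins the next block, raising the enlargement a, or forms a block by
    itself. In the first case one more index stays empty, which costs nothing as H 0 = 1. *)
Lemma merge_weight_cons a k b (r : {ffun 'I_k -> bool}) :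
  merge_weight a (ffun_cons b r) =
  if b then merge_weight a.+1 r else H a.+1 * merge_weight 0 r.
Proof.
rewrite /merge_weight; case: b.
  rewrite big_ord_recr /= merge_count_cons merge_count_oob // H0 mulr1.
  by apply: eq_bigr => c _; rewrite merge_count_cons; congr H; case: (val c) => [|c'] /=; lia.
rewrite big_ord_recl merge_count_cons /= !mul1n add1n; congr (_ * _).
by apply: eq_bigr => c _; rewrite merge_count_cons /bump /= muln0 mul0n.
Qed.

Lemma merge_sum0 a : merge_sum a 0 = H a.+1.
Proof.
rewrite /merge_sum (big_pred1 [ffun=> false]) => [|r]; last first.
  by apply/esym/eqP/ffunP => -[].
rewrite big_ord0 mul1r /merge_weight big_ord1 /merge_count big_ord1 /merge_index big_ord0 /=.
by rewrite mul1n add1n.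
Qed.

Lemma merge_sumS a k : merge_sum a k.+1 = H a.+1 * merge_sum 0 k - merge_sum a.+1 k.
Proof.
rewrite /merge_sum.
transitivity (\sum_(b : bool) \sum_(r : {ffun 'I_k -> bool})
   (\prod_i (if ffun_cons b r i then -1 else 1)) * merge_weight a (ffun_cons b r)).
  rewrite pair_bigA /=.
  apply: (@big_bij _ _ _ _ _ _ _ (fun r : {ffun 'I_k.+1 ->
    bool} => (r ord0, [ffun i => r (lift ord0 i)]))
    (fun br : bool * {ffun 'I_k -> bool} => ffun_cons br.1 br.2)).
  - move=> r _; split=> //; apply/ffunP=> i; rewrite ffunE /=.
    by case: unliftP => [i' ->|->]; rewrite ?ffunE.
  - move=> [b r] _; split=> //=; rewrite ffun_cons0; congr (_, _).
    by apply/ffunP=> i; rewrite ffunE ffun_consS.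
  move=> r _ /=; suff -> : ffun_cons (r ord0) [ffun i => r (lift ord0 i)] = r by [].
  by apply/ffunP=> i; rewrite ffunE /=; case: unliftP => [i' ->|->]; rewrite ?ffunE.
rewrite big_bool /= addrC mulr_sumr -sumrN; congr (_ + _); apply: eq_bigr => r _;
  rewrite big_ord_recl ffun_cons0 merge_weight_cons /=;
  under eq_bigr do rewrite ffun_consS; ring.
Qed.

(** Here i counts the merged gaps before the first separation, so the first part has weight a + i +
    1; the isolated term is the composition with one part. *)
Lemma merge_sum_unroll a k : merge_sum a k = (-1) ^+ k * H (a + k).+1 +
  \sum_(i < k) (-1) ^+ i * H (a + i).+1 * merge_sum 0 (k.-1 - i).
Proof.
elim: k a => [|k IH] a; first by rewrite merge_sum0 big_ord0 addr0 mul1r addn0.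
rewrite merge_sumS (IH a.+1) [in RHS]big_ord_recl /= expr0 mul1r addn0 subn0.
have -> : \sum_(i < k) (-1) ^+ bump 0 i * H (a + bump 0 i).+1 * merge_sum 0 (k - bump 0 i) =
    - \sum_(i < k) (-1) ^+ i * H (a.+1 + i).+1 * merge_sum 0 (k.-1 - i).
  rewrite -sumrN; apply: eq_bigr => i _; rewrite /bump leq0n add1n exprS addnS addSn.
  have -> : (k - i.+1 = k.-1 - i)%N by lia.
  ring.
rewrite exprS addnS addSn; ring.
Qed.

Lemma merge_sum_recursion k :
  H k.+1 + \sum_(i < k.+1) (-1) ^+ i.+1 * merge_sum 0 i * H (k - i) = 0.
Proof.
rewrite big_ord_recr /= subnn H0 mulr1 (merge_sum_unroll 0 k) add0n mulrDr mulrA -exprD.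
have -> : (-1) ^+ (k.+1 + k) = -1 :> R by rewrite -signr_odd addSn addnn /= odd_double.
have -> : (-1) ^+ k.+1 * \sum_(i < k) (-1) ^+ i * H (0 + i).+1 * merge_sum 0 (k.-1 - i)
   = - \sum_(i < k) (-1) ^+ i.+1 * merge_sum 0 i * H (k - i).
  (* Reversal pairs a first part of size k - i with the compositions of the remaining i + 1. *)
  rewrite (reindex_inj rev_ord_inj) /= mulr_sumr -sumrN; apply: eq_bigr => -[i hi] _ /=.
  have -> : (k.-1 - (k - i.+1) = i)%N by lia.
  have -> : (0 + (k - i.+1)).+1 = (k - i)%N by lia.
  rewrite !mulrA -exprD.
  have -> : (-1) ^+ (k.+1 + (k - i.+1)) = (-1) ^+ i :> R.
    by rewrite -signr_odd -[RHS]signr_odd; congr (_ ^+ _); congr nat_of_bool; lia.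
  by rewrite exprS; ring.
ring.
Qed.

End CompositionSum.

Lemma hsym0 t (j : 'I_t) N : hsym j 0 N = 1.
Proof.
rewrite /hsym /complete_poly (big_pred1 bm0) => [|e].
  by rewrite mpolyX0 rmorph1.
by rewrite mdeg_eq0; apply/eqP/eqP => [h|->//]; apply: val_inj.
Qed.

Lemma count_colour_merge k (r : {ffun 'I_k -> bool}) (c : 'I_k.+1) :
  count_colour (block [set i | r i]) c = merge_count r c.
Proof.
rewrite /count_colour -sum1dep_card /merge_count big_mkcond; apply: eq_bigr => p _.
rewrite -val_eqE /= blockE /block_index /merge_index -sum1dep_card big_mkcond /=.
have -> : (\sum_(i < k) (if (i < p)%N && (i \notin [set i0 | r i0]) then 1 else 0) =
           \sum_(i < k) ((i < p)%N && ~~ r i))%N.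
  by apply: eq_bigr => i _; rewrite inE; case: (_ && _).
by case: eqP.
Qed.

Theorem theorem4p2 (t : nat) (ht : (1 <= t)%N) (n : nat) (hn : (1 <= n)%N) :
  forall N : nat,
    \sum_(i < n.+1) (-1) ^+ i * beta t i N * \prod_(j < t) hsym j (n - i) N = 0.
Proof.
move=> N; pose H m := \prod_(j < t) hsym j m N.
have H0 : H 0%N = 1 by rewrite /H big1 // => j _; exact: hsym0.
have betaE i : beta t i.+1 N = merge_sum H 0 i.
  rewrite beta_expand //; apply: eq_bigr => r _; congr (_ * _); apply: eq_bigr => c _.
  by rewrite muln0 addn0 -count_colour_merge.
(* The term i = 0, in which [beta] is 1 by convention, is the isolated [H k.+1] of the recursion. *)
case: n hn => // k _; rewrite -[RHS](merge_sum_recursion H0 k) big_ord_recl; congr (_ + _).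
  by rewrite /= expr0 !mul1r subn0.
by apply: eq_bigr => i _; rewrite lift0 betaE subSS.
Qed.
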